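(* Let $\beta$ be arbitrary (complex). For $s_1,s_2\in\{+1,-1\}$ let $M_{-,-}=KKer_{\mathcal F_{((0,1);\beta)}}$, $M_{+,-}=CKer_{\mathcal F_{((0,1);\beta)}}$, $M_{-,+}=KCoker_{\mathcal F_{((0,1);\beta)}}$, $M_{+,+}=CCoker_{\mathcal F_{((0,1);\beta)}}$ (the indices being the signs of $s_1,s_2$). Their characters and supercharacters are $$Ch_{M_{s_1,s_2}}(q,x_1,x_2,x_3,x_4)=\frac{1}{\prod_{n=1}^\infty(1-q^n)^6}\sum_{l_1,l_2=1}^\infty(-1)^{l_1+l_2}q^{\frac12(l_1^2+l_2^2+s_1l_1+s_2l_2)}\sum_{i,j,k\in\mathbb Z}q^{\frac12(i^2+j^2+k^2-2kj+(1+2s_1l_1)i-(1+2s_1l_1)j+(1+2s_2l_2)k)}x_1^{j}x_2^{i-k}x_3^{-j}x_4^{4\beta+2i-2j+2k},$$ $$Sch_{M_{s_1,s_2}}(q,x_1,x_2,x_3,x_4)=\frac{1}{\prod_{n=1}^\infty(1-q^n)^6}\sum_{l_1,l_2=1}^\infty(-1)^{l_1+l_2}q^{\frac12(l_1^2+l_2^2+s_1l_1+s_2l_2)}\sum_{i,j,k\in\mathbb Z}(-1)^{i-j+k}q^{\frac12(i^2+j^2+k^2-2kj+(1+2s_1l_1)i-(1+2s_1l_1)j+(1+2s_2l_2)k)}x_1^{j}x_2^{i-k}x_3^{-j}x_4^{4\beta+2i-2j+2k}.$$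
   Context: $0<|q|<1$ with a fixed branch of $\log q$, $q^x=e^{x\log q}$, $[x]_q=(q^x-q^{-x})/(q-q^{-1})$. Oscillators: $a^j_n,Q_{a^j}$ ($1\le j\le4$), $c^l_n,Q_{c^l}$ ($l=1,2$), $n\in\mathbb Z$, with $[a^j_n,a^{j'}_m]=(-1)^{j+1}\delta_{jj'}\delta_{m+n,0}\frac{[n]_q^2}n$ and $[c^l_n,c^{l'}_m]=\delta_{ll'}\delta_{m+n,0}\frac{[n]_q^2}n$ for $n\ne0$, $[a^j_0,Q_{a^{j'}}]=\delta_{jj'}$, $[c^l_0,Q_{c^{l'}}]=\delta_{ll'}$, all other commutators zero. The vacuum satisfies $a^j_m|0\rangle=c^l_m|0\rangle=0$ for $m\ge0$; $F_{\lambda_1,\lambda_2,\lambda_3,\lambda_4;\lambda_5,\lambda_6}$ is the Fock space generated freely by the $a^j_{-m},c^l_{-m}$ ($m>0$) over $e^{\sum_{i=1}^4\lambda_iQ_{a^i}+\lambda_5Q_{c^1}+\lambda_6Q_{c^2}}|0\rangle$. Define $$\mathcal F_{((0,1);\beta)}=\bigoplus_{i,j,k\in\mathbb Z}F_{\beta+i,\,-\beta-i+j,\,\beta-j+k,\,-\beta-k;\,i-j,\,k}.$$ It is a level-one $U_q[\widehat{gl(2|2)}]$-module under the free boson realization, in which $h_j$ acts as $A^j_0$ ($1\le j\le4$) and the derivation $d$ as below. For $i=1,2$: $c^i(z)=Q_{c^i}+c^i_0\ln z-\sum_{n\ne0}\frac{c^i_n}{[n]_q}z^{-n}$, $\eta^i(z)=\sum_n\eta^i_nz^{-n-1}=:e^{c^i(z)}:$,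 $\xi^i(z)=\sum_n\xi^i_nz^{-n}=:e^{-c^i(z)}:$ (normal ordering puts negative modes and $Q$'s to the left). For $\mathcal F=\mathcal F_{((0,1);\beta)}$, the following submodules are defined: $KKer_{\mathcal F}=\eta^1_0\xi^1_0\eta^2_0\xi^2_0\mathcal F$, $KCoker_{\mathcal F}=\eta^1_0\xi^1_0\xi^2_0\eta^2_0\mathcal F$, $CKer_{\mathcal F}=\xi^1_0\eta^1_0\eta^2_0\xi^2_0\mathcal F$, $CCoker_{\mathcal F}=\xi^1_0\eta^1_0\xi^2_0\eta^2_0\mathcal F$ (images of commuting projectors on $\mathcal F$). $A^i_n=(-1)^{i+1}(a^i_n+a^{i+1}_n)$ ($i=1,2,3$), $A^4_n=\frac{q^n+q^{-n}}2\sum_{l=1}^4(-1)^{l+1}a^l_n$. Let $(a_{ij})_{1\le i,j\le4}$ be the symmetric invertible matrix with zero diagonal, $a_{12}=1$, $a_{23}=-1$, $a_{13}=0$, $a_{14}=2$, $a_{24}=-2$, $a_{34}=2$. Put $A^{*i}_n=\sum_{l=1}^3a^{-1}_{il}A^l_n+\frac2{q^n+q^{-n}}a^{-1}_{i4}A^4_n$ ($i=1,2,3$), $A^{*4}_n=4\sum_{l=1}^4a^{-1}_{4l}A^l_n$ ($n\ne0$), $A^{*j}_0=\sum_{l=1}^4a^{-1}_{jl}A^l_0$. Then $$d=-\sum_{m>0}\frac{m^2}{[m]_q^2}\Big\{\sum_{i=1}^3A^i_{-m}A^{*i}_m+\frac1{2(q^m+q^{-m})}A^4_{-m}A^{*4}_m+c^1_{-m}c^1_m+c^2_{-m}c^2_m\Big\}-\frac12\Big\{\sum_{i=1}^4A^i_0A^{*i}_0+c^1_0(c^1_0+1)+c^2_0(c^2_0+1)\Big\}.$$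 $Ch_M=\mathrm{tr}_M(q^{-d}x_1^{h_1}x_2^{h_2}x_3^{h_3}x_4^{h_4})$ and $Sch_M=\mathrm{tr}_M((-1)^{N_f}q^{-d}x_1^{h_1}x_2^{h_2}x_3^{h_3}x_4^{h_4})$, where $N_f=a^2_0+a^4_0$ and $(-1)^{N_f}$ is normalized by omitting the overall constant phase $(-1)^{-2\beta}$, i.e. it acts as $e^{\sqrt{-1}\pi(a^2_0+a^4_0+2\beta)}$. Both are formal generating series in complex powers of $x_1,\dots,x_4$; the coefficient of each monomial is a convergent function of $q$. *)

(* Defs.v *)
From HB Require Import structures.
From mathcomp Require Import all_boot all_order all_algebra.
From mathcomp Require Import finmap multiset complex.
From mathcomp Require Import all_classical all_reals all_analysis.
From mathcomp.analysis.showcase Require Export summability.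
(* The notations of monalg are incompatible with those of analysis. *)
From mathcomp.multinomials Require monalg.
Export -(notations) monalg.
Export Order.TTheory GRing.Theory Num.Theory numFieldNormedType.Exports.

Set Implicit Arguments.
Unset Strict Implicit.
Unset Printing Implicit Defensive.

Local Open Scope classical_set_scope.
Local Open Scope ring_scope.

(* The free module on K.  Its operations are locked: otherwise unification    *)
(* unfolds them, at a prohibitive cost, when K is [fock_index] below.         *)
Section FreeModule.
Variables (K : choiceType) (C : nzRingType).

Definition freemod : Type := malg K C.

Fact freemod_key : unit. Proof. exact: tt. Qed.
Local Notation lock := (locked_with freemod_key).
Local Notation lockE := (locked_withE freemod_key).

Definition fm_zero : freemod := lock (0 : malg K C).
Definition fm_opp : freemod -> freemod := lock (fun v : malg K C => - v).
Definition fm_add : freemod -> freemod -> freemod :=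
  lock (fun u v : malg K C => u + v).
Definition fm_scale : C -> freemod -> freemod :=
  lock (fun c (v : malg K C) => c *: v).

Fact fm_addA : associative fm_add.
Proof. by rewrite /fm_add lockE; exact: (@addrA (malg K C)). Qed.
Fact fm_addC : commutative fm_add.
Proof. by rewrite /fm_add lockE; exact: (@addrC (malg K C)). Qed.
Fact fm_add0 : left_id fm_zero fm_add.
Proof. by rewrite /fm_add /fm_zero !lockE; exact: (@add0r (malg K C)). Qed.
Fact fm_addN : left_inverse fm_zero fm_opp fm_add.
Proof.
by rewrite /fm_add /fm_zero /fm_opp !lockE; exact: (@addNr (malg K C)).
Qed.

HB.instance Definition _ := Choice.copy freemod (malg K C).
HB.instance Definition _ :=
  GRing.isZmodule.Build freemod fm_addA fm_addC fm_add0 fm_addN.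

Fact fm_scaleA a b v : fm_scale a (fm_scale b v) = fm_scale (a * b) v.
Proof. by rewrite /fm_scale lockE; exact: (@scalerA C (malg K C)). Qed.
Fact fm_scale1 : left_id 1 fm_scale.
Proof. by rewrite /fm_scale lockE; exact: (@scale1r C (malg K C)). Qed.
Fact fm_scaleDr : right_distributive fm_scale +%R.
Proof.
move=> a u v; rewrite /GRing.add /= /fm_scale /fm_add !lockE.
exact: (@scalerDr C (malg K C)).
Qed.
Fact fm_scaleDl v : {morph fm_scale^~ v : a b / a + b}.
Proof.
move=> a b /=; rewrite [RHS]/(fm_add _ _) /fm_scale /fm_add !lockE.
exact: (@scalerDl C (malg K C)).
Qed.

HB.instance Definition _ := GRing.Zmodule_isLmodule.Build C freemod
  fm_scaleA fm_scale1 fm_scaleDr fm_scaleDl.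

Definition fm_ket : K -> freemod := lock (fun k => mkmalgU k 1 : malg K C).
Definition fm_coef (k : K) (v : freemod) : C := mcoeff k (v : malg K C).
Definition fm_supp (v : freemod) : {fset K} := msupp (v : malg K C).

Lemma fm_coefD k u v : fm_coef k (u + v) = fm_coef k u + fm_coef k v.
Proof. by rewrite [u + v]/(fm_add u v) /fm_add lockE /fm_coef mcoeffD. Qed.

Lemma fm_coefZ k c v : fm_coef k (c *: v) = c * fm_coef k v.
Proof. by rewrite [c *: v]/(fm_scale c v) /fm_scale lockE /fm_coef mcoeffZ. Qed.

Lemma fm_coef_ket k j : fm_coef k (fm_ket j) = (k == j)%:R.
Proof. by rewrite /fm_ket lockE /fm_coef mcoeffU eq_sym. Qed.

Lemma fm_suppE v k : (k \in fm_supp v) = (fm_coef k v != 0).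
Proof. by rewrite /fm_coef mcoeff_neq0. Qed.

Lemma fm_eqP u v : (forall k, fm_coef k u = fm_coef k v) -> u = v.
Proof. by move=> h; apply/malgP. Qed.

End FreeModule.

Section Fock.
Variable C : fieldType.

(* The function x |-> q^x. *)
Variable qpow : C -> C.

Definition qint (x : C) : C :=
  (qpow x - qpow (- x)) / (qpow 1 - qpow (- 1)).

(* [inl j] is the family a^{j+1} and [inr l] the family c^{l+1}: all indices  *)
(* are shifted so as to start from 0.                                         *)
Definition osc : Type := ('I_4 + 'I_2)%type.

Definition osc_sign (b : osc) : C := if b is inl j then (-1) ^+ j else 1.

(* Eigenvalues of the zero modes.  Those of the c^l_0 are integers, which is  *)
(* what makes z^{c^l_0} expand in integral powers of z.                       *)
Definition momentum : Type := ({ffun 'I_4 -> C} * {ffun 'I_2 -> int})%type.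

Definition zero_mode (lam : momentum) (b : osc) : C :=
  match b with inl j => lam.1 j | inr l => (lam.2 l)%:~R end.

(* The pair (lam, mu) stands for the product of the creation operators        *)
(* b_{-(m+1)}, each taken [mu (b, m)] times, applied to the momentum state    *)
(* e^{sum_j lam_j Q_j} |0>.                                                   *)
Definition fock_index : Type := (momentum * {mset (osc * nat)}%mset)%type.

(* The sum of the Fock spaces over all momenta.  The zero modes xi_0 and      *)
(* eta_0 taken separately do not preserve the subspace [Fspace] below.        *)
Definition fock : lmodType C := freemod fock_index C.

Definition ket (k : fock_index) : fock := fm_ket C k.

Definition linext (f : fock_index -> fock) (v : fock) : fock :=
  \sum_(k <- fm_supp v) fm_coef k v *: f k.

Definition mode (b : osc) (n : int) : fock -> fock :=
  linext (fun k => match n with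
    | Posz 0 => zero_mode k.1 b *: ket k
    | Posz m.+1 =>
        (osc_sign b * qint m.+1%:R ^+ 2 / m.+1%:R * (k.2 (b, m))%:R)
          *: ket (k.1, msetB k.2 (msetn 1 (b, m)))
    | Negz m => ket (k.1, msetD (msetn 1 (b, m)) k.2)
    end).

Definition aop (j : 'I_4) : int -> fock -> fock := mode (inl j).
Definition cop (l : 'I_2) : int -> fock -> fock := mode (inr l).

(* e^{r Q_{c^l}} *)
Definition expQ (l : 'I_2) (r : int) : fock -> fock :=
  linext (fun k =>
    ket ((k.1.1, [ffun i => if i == l then k.1.2 i + r else k.1.2 i]), k.2)).

(* The projector onto c^l_0 = r, i.e. the coefficient of z^r in z^{c^l_0}. *)
Definition cproj (l : 'I_2) (r : int) : fock -> fock :=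
  linext (fun k => if k.1.2 l == r then ket k else 0).

(* For a series X(w) = sum_(m > 0) x_m w^m of commuting operators,            *)
(* [pow_coef x r n] is the coefficient of w^n in X(w)^r and [exp_coef x n]    *)
(* that in exp(X(w)); X(w)^r contributes nothing to it when r > n.            *)
Fixpoint pow_coef (x : nat -> fock -> fock) (r n : nat) (v : fock) : fock :=
  if r is r'.+1 then \sum_(1 <= m < n.+1) x m (pow_coef x r' (n - m) v)
  else if n == 0%N then v else 0.

Definition exp_coef (x : nat -> fock -> fock) (n : nat) (v : fock) : fock :=
  \sum_(0 <= r < n.+1) (r`!%:R)^-1 *: pow_coef x r n v.

(* The coefficients of z^m and of z^{-m} (m > 0) in e c^l(z), for e = 1, -1. *)
Definition cplus (l : 'I_2) (e : int) (m : nat) (v : fock) : fock :=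
  - ((e%:~R / qint (- m%:R)) *: cop l (- m%:Z) v).
Definition cminus (l : 'I_2) (e : int) (m : nat) (v : fock) : fock :=
  - ((e%:~R / qint m%:R) *: cop l m%:Z v).

(* The coefficient of z^n in :e^{e c^l(z)}:, for e = 1, -1; on a given vector *)
(* all but finitely many terms of the sum vanish.  The middle factor selects  *)
(* z^{n-p+r} in z^{e c^l_0}.                                                  *)
Definition vertex (l : 'I_2) (e n : int) (v : fock) : fock :=
  \sum_(pr \in [set: nat * nat])
     exp_coef (cplus l e) pr.1 (expQ l e
       (cproj l (e * (n - pr.1%:Z + pr.2%:Z))
         (exp_coef (cminus l e) pr.2 v))).

Definition eta (l : 'I_2) (n : int) : fock -> fock := vertex l 1 (- n - 1).
Definition xi (l : 'I_2) (n : int) : fock -> fock := vertex l (-1) (- n).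

Definition cartan : 'M[C]_4 :=
  \matrix_(i, j) (nth 0 (nth [::]
     [:: [::  0;  1;  0;  2];
         [::  1;  0; -1; -2];
         [::  0; -1;  0;  2];
         [::  2; -2;  2;  0]] i) j)%:~R.

Definition icartan : 'M[C]_4 := invmx cartan.

Definition q2 (n : int) : C := qpow n%:~R + qpow (- n%:~R).

(* A^{i+1}_n *)
Definition Aop (i : 'I_4) (n : int) (v : fock) : fock :=
  if (i < 3)%N then (-1) ^+ i *: (aop i n v + aop (inord i.+1) n v)
  else (q2 n / 2) *: \sum_(l < 4) (-1) ^+ l *: aop l n v.

(* A^{*(i+1)}_n *)
Definition Astar (i : 'I_4) (n : int) (v : fock) : fock :=
  if n == 0 then \sum_(l < 4) icartan i l *: Aop l 0 v
  else if (i < 3)%N then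
    \sum_(l < 4 | (l < 3)%N) icartan i l *: Aop l n v
      + (2 / q2 n * icartan i ord_max) *: Aop ord_max n v
  else 4 *: \sum_(l < 4) icartan ord_max l *: Aop l n v.

Definition dop (v : fock) : fock :=
  - (\sum_(m \in [set m : nat | (0 < m)%N])
       (m%:R ^+ 2 / qint m%:R ^+ 2) *:
         (\sum_(i < 4 | (i < 3)%N) Aop i (- m%:Z) (Astar i m%:Z v)
          + (2 * q2 m%:Z)^-1 *: Aop ord_max (- m%:Z) (Astar ord_max m%:Z v)
          + \sum_(l < 2) cop l (- m%:Z) (cop l m%:Z v)))
  - 2^-1 *: (\sum_(i < 4) Aop i 0 (Astar i 0 v)
             + \sum_(l < 2) cop l 0 (cop l 0 v + v)).

Definition hop (j : 'I_4) : fock -> fock := Aop j 0.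

Definition Nf (v : fock) : fock := aop (inord 1) 0 v + aop (inord 3) 0 v.

Section Modules.
Variable beta : C.

Definition mom (i j k : int) : momentum :=
  ([ffun t : 'I_4 => nth 0 [:: beta + i%:~R; - beta - i%:~R + j%:~R;
                               beta - j%:~R + k%:~R; - beta - k%:~R] t],
   [ffun t : 'I_2 => nth 0 [:: i - j; k] t]).

(* The Fock module for ((0,1); beta). *)
Definition Fspace : set fock :=
  [set v | forall p, p \in fm_supp v -> exists i j k : int, p.1 = mom i j k].

Let eta1 := eta 0 0.
Let xi1 := xi 0 0.
Let eta2 := eta 1 0.
Let xi2 := xi 1 0.

Definition KKer : set fock := (eta1 \o xi1 \o eta2 \o xi2) @` Fspace.
Definition KCoker : set fock := (eta1 \o xi1 \o xi2 \o eta2) @` Fspace.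
Definition CKer : set fock := (xi1 \o eta1 \o eta2 \o xi2) @` Fspace.
Definition CCoker : set fock := (xi1 \o eta1 \o xi2 \o eta2) @` Fspace.

Definition Msub (s1 s2 : int) : set fock :=
  if s1 == 1 then (if s2 == 1 then CCoker else CKer)
  else (if s2 == 1 then KCoker else KKer).

End Modules.

Definition is_basis (T : choiceType) (M : set fock) (b : T -> fock) : Prop :=
  (forall v, M v <->
     exists (A : {fset T}) (c : T -> C), v = \sum_(t <- A) c t *: b t) /\
  (forall (A : {fset T}) (c : T -> C),
     \sum_(t <- A) c t *: b t = 0 -> forall t, t \in A -> c t = 0).

Definition eigenvectors (T : Type) (D : fock -> fock) (b : T -> fock)
    (ev : T -> C) : Prop := forall t, D (b t) = ev t *: b t.

End Fock.

Section Characters.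
Variable R : realType.
Local Notation C := R[i].

Definition cexp (z : C) : C :=
  let: Complex x y := z in Complex (expR x * cos y) (expR x * sin y).

(* The parameter [lq] is the chosen branch of log q. *)
Variable lq : C.

Definition qpow (x : C) : C := cexp (x * lq).

(* A family f of coefficients is the formal series sum_t c_t x^{e_t} in       *)
(* complex powers of x_1, ..., x_4 when, for every exponent mu, f mu is the   *)
(* (unconditionally convergent) sum of the c_t such that e_t = mu.            *)
Definition weight : Type := (4.-tuple C)%type.

Definition formal_series (T : choiceType) (c : T -> C) (e : T -> weight)
    (f : weight -> C) : Prop :=
  forall mu : weight,
    partial_sum (fun t => (if e t == mu then c t else 0) : C^o) A
      @[A --> totally] --> (f mu : C^o).

(* The traces are computed on a basis of M made of joint eigenvectors of the  *)
(* commuting operators involved; they do not depend on that basis, because    *)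
(* the dimensions of the joint eigenspaces do not.                            *)
Definition is_character (M : set (fock C)) (f : weight -> C) : Prop :=
  exists (T : choiceType) (b : T -> fock C) (h : T -> weight) (delta : T -> C),
    [/\ is_basis M b,
        forall j, eigenvectors (hop qpow j) b (fun t => tnth (h t) j),
        eigenvectors (dop qpow) b delta
      & formal_series (fun t => qpow (- delta t)) h f].

(* (-1)^{N_f} acts as e^{i pi (N_f + 2 beta)}. *)
Definition is_supercharacter (beta : C) (M : set (fock C)) (f : weight -> C) :
    Prop :=
  exists (T : choiceType) (b : T -> fock C) (h : T -> weight) (delta : T -> C)
         (nf : T -> C),
    [/\ is_basis M b,
        forall j, eigenvectors (hop qpow j) b (fun t => tnth (h t) j),
        eigenvectors (dop qpow) b delta,
        eigenvectors (Nf qpow) b nf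
      & formal_series (fun t =>
          cexp (Complex 0 pi * (nf t + 2 * beta)) * qpow (- delta t)) h f].

(* The terms of the right-hand sides are indexed by ((n1, n2), (i, j, k))     *)
(* with l1 = n1 + 1 and l2 = n2 + 1.                                          *)
Definition term_index : Type := ((nat * nat) * (int * int * int))%type.

Definition ch_coef (s1 s2 : int) (t : term_index) : C :=
  let: ((n1, n2), (i, j, k)) := t in
  let l1 := n1.+1%:Z in let l2 := n2.+1%:Z in
  (-1) ^+ (n1.+1 + n2.+1)
  * qpow ((l1 ^+ 2 + l2 ^+ 2 + s1 * l1 + s2 * l2)%:~R / 2)
  * qpow ((i ^+ 2 + j ^+ 2 + k ^+ 2 - 2 * k * j
           + (1 + 2 * s1 * l1) * i - (1 + 2 * s1 * l1) * j
           + (1 + 2 * s2 * l2) * k)%:~R / 2).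

Definition sch_coef (s1 s2 : int) (t : term_index) : C :=
  let: (_, (i, j, k)) := t in (-1) ^ (i - j + k) * ch_coef s1 s2 t.

Definition ch_exp (beta : C) (t : term_index) : weight :=
  let: (_, (i, j, k)) := t in
  [tuple j%:~R; (i - k)%:~R; (- j)%:~R;
         4 * beta + (2 * i - 2 * j + 2 * k)%:~R].

End Characters.

(* Main.v *)
Require Import Defs.
From mathcomp Require Import all_boot all_order all_algebra complex.
From mathcomp Require Import all_classical all_reals all_analysis.
From mathcomp Require Import finmap multiset.
From mathcomp Require Import zify ring lra.

(** The four modules are images of projectors on the Fock space; the basis of joint
    eigenvectors is adapted to the projector, and the formulas compute the traces
    of the projector on the finite joint eigenspaces of the whole Fock space.

    Fermions.  Each c^l gives a pair of fields eta^l, xi^l.  A product of two vertex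
    operators is determined by its commutators with the modes and its values on the
    vacua ([vacuum_principle]), and these values follow from Wick's theorem.  So eta^l
    and xi^l are conjugate free fermions ([vertex_anticomm], [vertex_anticomm_same]),
    which commute for distinct l ([vertex_comm]).  Write z_s for the zero mode of
    eta^l (s = 1) or xi^l (s = -1).  Then z_s z_s = 0 and
    z_s z_{-s} + z_{-s} z_s = 1, so that z_{-s} z_s is a projector.

    Finite blocks.  The zero modes conserve E, the sum of the level of a vector and of
    r (r + 1) / 2 for each eigenvalue r of c^1_0 and c^2_0.  For a given momentum, each
    value of E occurs on a finite-dimensional block only, and the projectors act on
    the blocks.  On the block with labels (i, j, k) and energy E the operators
    h_1, ..., h_4 and N_f are scalars, and -d = E + j (i - k).  The module has a basis
    adapted to the blocks, with as many elements in a block as the trace of the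
    projector there ([Msub_basis]).

    Alternating sums.  Let tr_r be the trace on the block of given E with c^l_0 = r, and
    f an operator that commutes with the zero modes of c^l.  As z_s changes r by s and
    traces are cyclic, tr_r(z_{-s} z_s f) = tr_{r+s}(z_s z_{-s} f), hence
    tr_r(z_{-s} z_s f) + tr_{r+s}(z_{-s} z_s f) = tr_{r+s}(f) ([trace_proj_rec]).  Summed
    over E with weight q^E and iterated, this gives
    sum_(l >= 1) (-1)^(l-1) sum_E q^E tr_{r+sl}(f): the remainder tends to 0 because E is
    at least r (r + 1) / 2.  This accounts for the sums over l_1 and l_2
    ([graded_trace_proj2]).  The traces left are those of the identity, the graded
    dimensions of Fock spaces: a power of q times the sum of q^(level) over all
    occupation numbers of six oscillators, the inverse of prod (1 - q^n)^6
    ([partition_sum]).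

    Series.  Distinct labels (i, j, k) give distinct monomials in x_1, ..., x_4, so that
    for a given monomial only E varies in the trace ([formal_series_trace]) and only
    l_1 and l_2 in the formula ([formal_series_theta]).  Both are absolutely convergent,
    and their unordered sums are computed along exhaustions by finite sets. *)

Import Order.TTheory GRing.Theory Num.Theory numFieldNormedType.Exports.

Set Implicit Arguments.
Unset Strict Implicit.
Unset Printing Implicit Defensive.

Local Open Scope classical_set_scope.
Local Open Scope ring_scope.

(** * Linear maps and free modules *)

Section LinearMaps.
Variables (C : nzRingType) (V W : lmodType C) (f : V -> W).
Hypothesis lf : linear f.

Lemma linear_addE u v : f (u + v) = f u + f v.
Proof. by have := lf 1 u v; rewrite !scale1r. Qed.

Lemma linear_0E : f 0 = 0.
Proof. by apply: (addrI (f 0)); rewrite -linear_addE !addr0. Qed.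

Lemma linear_scaleE a u : f (a *: u) = a *: f u.
Proof. by have := lf a u 0; rewrite !addr0 linear_0E addr0. Qed.

Lemma linear_oppE u : f (- u) = - f u.
Proof. by rewrite -scaleN1r linear_scaleE scaleN1r. Qed.

Lemma linear_sumE I (r : seq I) (P : pred I) (F : I -> V) :
  f (\sum_(i <- r | P i) F i) = \sum_(i <- r | P i) f (F i).
Proof. exact: (big_morph f linear_addE linear_0E). Qed.

End LinearMaps.

Section LinearClosure.
Variables (C : comNzRingType) (V : lmodType C).
Implicit Types f g : V -> V.

Lemma linear_id_fun : linear (@id V).
Proof. by []. Qed.

Lemma linear_comp f g : linear f -> linear g -> linear (f \o g).
Proof. by move=> lf lg a u v; rewrite /= lg lf. Qed.

Lemma linear_scale_fun c f : linear f -> linear (fun v => c *: f v).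
Proof. by move=> lf a u v; rewrite lf scalerDr !scalerA mulrC. Qed.

Lemma linear_add_fun f g : linear f -> linear g -> linear (fun v => f v + g v).
Proof. by move=> lf lg a u v; rewrite lf lg scalerDr addrACA. Qed.

Lemma linear_opp_fun f : linear f -> linear (fun v => - f v).
Proof. by move=> lf a u v; rewrite lf opprD scalerN. Qed.

Lemma linear_zero_fun : linear (fun _ : V => 0 : V).
Proof. by move=> a u v; rewrite scaler0 addr0. Qed.

Lemma linear_sum_fun I (r : seq I) (P : pred I) (F : I -> V -> V) :
  (forall i, linear (F i)) -> linear (fun v => \sum_(i <- r | P i) F i v).
Proof.
move=> lF a u v; rewrite scaler_sumr -big_split /=.
by apply: eq_bigr => i _; rewrite lF.
Qed.

End LinearClosure.

Section FreeModules.
Variables (K : choiceType) (C : nzRingType).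
Implicit Types v : freemod K C.

Lemma linear_fm_coef k : linear (fm_coef k : freemod K C -> C^o).
Proof. by move=> a u v; rewrite fm_coefD fm_coefZ. Qed.

Lemma fm_coef_sum k I (r : seq I) (P : pred I) (F : I -> freemod K C) :
  fm_coef k (\sum_(i <- r | P i) F i) = \sum_(i <- r | P i) fm_coef k (F i).
Proof. exact: (linear_sumE (linear_fm_coef k)). Qed.

Lemma fm_coef0 k : fm_coef k (0 : freemod K C) = 0.
Proof. exact: (linear_0E (linear_fm_coef k)). Qed.

Lemma fm_coef_out k v : k \notin fm_supp v -> fm_coef k v = 0.
Proof. by rewrite fm_suppE negbK => /eqP. Qed.

Lemma fm_expand_in (A : {fset K}) v : (forall k, k \in fm_supp v -> k \in A) ->
  v = \sum_(k <- A) fm_coef k v *: fm_ket C k.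
Proof.
move=> sA; apply: fm_eqP => k; rewrite fm_coef_sum.
have [kA|kA] := boolP (k \in A).
  rewrite (big_fsetD1 k) //= fm_coefZ fm_coef_ket eqxx mulr1 big_seq big1 ?addr0 //.
  move=> i; rewrite !inE => /andP[ik _].
  by rewrite fm_coefZ fm_coef_ket eq_sym (negbTE ik) mulr0.
rewrite fm_coef_out; last by apply: contra kA => /sA.
rewrite big_seq big1 // => i iA; rewrite fm_coefZ fm_coef_ket.
by rewrite (_ : k == i = false) ?mulr0 //; apply: contraNF kA => /eqP ->.
Qed.

Lemma fm_expand v : v = \sum_(k <- fm_supp v) fm_coef k v *: fm_ket C k.
Proof. exact: fm_expand_in. Qed.

End FreeModules.

Section FockLinear.
Variable C : fieldType.
Local Notation fock := (fock C).
Implicit Types (v : fock) (k p : fock_index C) (f g : fock -> fock).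

Lemma linear_eq_ket (V : lmodType C) (f g : fock -> V) : linear f -> linear g ->
  (forall k, f (ket k) = g (ket k)) -> f =1 g.
Proof.
move=> lf lg fg v; rewrite (fm_expand v) (linear_sumE lf) (linear_sumE lg).
by apply: eq_bigr => k _; rewrite (linear_scaleE lf) (linear_scaleE lg) fg.
Qed.

Lemma linextE (A : {fset fock_index C}) (h : fock_index C -> fock) v :
  (forall k, k \in fm_supp v -> k \in A) ->
  linext h v = \sum_(k <- A) fm_coef k v *: h k.
Proof.
move=> sA; rewrite /linext.
have sA' : (fm_supp v `<=` A)%fset by apply/fsubsetP.
apply: big_fset_incl => // k _ /fm_coef_out ->.
by rewrite scale0r.
Qed.

Lemma linear_linext h : linear (linext h : fock -> fock).
Proof.
move=> a u v.
pose A := (fm_supp (a *: u + v)%R `|` (fm_supp u `|` fm_supp v))%fset.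
rewrite (@linextE A) => [|k kA]; last by rewrite !inE kA.
rewrite (@linextE A _ u) => [|k kA]; last by rewrite !inE kA orbT.
rewrite (@linextE A _ v) => [|k kA]; last by rewrite !inE kA !orbT.
rewrite scaler_sumr -big_split /=; apply: eq_bigr => k _.
by rewrite fm_coefD fm_coefZ scalerDl scalerA.
Qed.

Lemma linext_ket (h : fock_index C -> fock) p : linext h (ket p) = h p.
Proof.
rewrite (@linextE [fset p]%fset).
  by rewrite big_seq_fset1 fm_coef_ket eqxx scale1r.
move=> k; rewrite fm_suppE fm_coef_ket inE.
by case: (k == p); rewrite ?eqxx.
Qed.

End FockLinear.

(** * Oscillator modes *)

Section Modes.
Variables (C : fieldType) (qpow : C -> C).
Local Notation fock := (fock C).
Local Notation mode := (mode qpow).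
Local Notation qint := (qint qpow).
Implicit Types (v : fock) (lam : momentum C) (mu : {mset (osc * nat)}%mset).

(** The modes up to normalization: with [cre] and [ann], the Heisenberg relations
    reduce to counting in multisets, and the q-integers only enter as scalars. *)
Definition cre (x : osc * nat) : fock -> fock :=
  linext (fun k => ket (k.1, (x +` k.2)%mset)).
Definition ann (x : osc * nat) : fock -> fock :=
  linext (fun k => (k.2 x)%:R *: ket (k.1, (k.2 `\ x)%mset)).

Lemma linear_cre x : linear (cre x).
Proof. exact: linear_linext. Qed.
Lemma linear_ann x : linear (ann x).
Proof. exact: linear_linext. Qed.
Lemma linear_mode b n : linear (mode b n).
Proof. exact: linear_linext. Qed.

Lemma mode_cre b m : mode b (Negz m) = cre (b, m).
Proof. by []. Qed.

Lemma mode_ann b m v : mode b m.+1 v =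
  (osc_sign C b * qint m.+1%:R ^+ 2 / m.+1%:R) *: ann (b, m) v.
Proof.
apply: (linear_eq_ket (linear_mode b m.+1)
                      (linear_scale_fun _ (linear_ann (b, m)))) => k.
by rewrite /mode /ann !linext_ket scalerA.
Qed.

Lemma mode_zero b lam mu : mode b 0 (ket (lam, mu)) = zero_mode lam b *: ket (lam, mu).
Proof. by rewrite /mode linext_ket. Qed.

Lemma cre_ket x lam mu : cre x (ket (lam, mu)) = ket (lam, (x +` mu)%mset).
Proof. by rewrite /cre linext_ket. Qed.

Lemma ann_ket x lam mu :
  ann x (ket (lam, mu)) = (mu x)%:R *: ket (lam, (mu `\ x)%mset).
Proof. by rewrite /ann linext_ket. Qed.

Lemma cre_comm x y v : cre x (cre y v) = cre y (cre x v).
Proof.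
apply: (linear_eq_ket (linear_comp (linear_cre x) (linear_cre y))
                      (linear_comp (linear_cre y) (linear_cre x))).
by case=> lam mu; rewrite /= !cre_ket msetDCA.
Qed.

Lemma ann_comm x y v : ann x (ann y v) = ann y (ann x v).
Proof.
apply: (linear_eq_ket (linear_comp (linear_ann x) (linear_ann y))
                      (linear_comp (linear_ann y) (linear_ann x))).
case=> lam mu; rewrite /= !ann_ket !(linear_scaleE (linear_ann _)) !ann_ket.
have [->//|xy] := eqVneq x y.
rewrite !scalerA !msetB1E (negbTE xy) eq_sym (negbTE xy) !subn0 mulrC.
by congr (_ *: ket (_, _)); apply/msetP => z; rewrite !msetB1E subnAC.
Qed.

Lemma ann_cre x y v : ann x (cre y v) = cre y (ann x v) + (x == y)%:R *: v.
Proof.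
apply: (linear_eq_ket (linear_comp (linear_ann x) (linear_cre y))
  (linear_add_fun (linear_comp (linear_cre y) (linear_ann x))
     (linear_scale_fun (x == y)%:R (@linear_id_fun C (fock))))).
case=> lam mu; rewrite /= !cre_ket !ann_ket !(linear_scaleE (linear_cre _)) !cre_ket.
rewrite mset1DE; have [->|xy] := eqVneq x y.
  rewrite msetD1K natrD scalerDl addrC scale1r; congr (_ + _).
  have [->|my] := eqVneq (mu y) 0%N; first by rewrite !scale0r.
  by rewrite msetB1K // -mset_neq0.
rewrite scale0r addr0 add0n; congr (_ *: ket (_, _)).
apply/msetP => z; rewrite !(mset1DE, msetB1E).
have [->|zx] := eqVneq z x; first by rewrite (negbTE xy).
by rewrite !subn0.
Qed.

Lemma qintN x : qint (- x) = - qint x.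
Proof. by rewrite /Defs.qint opprK -mulNr opprB. Qed.

(** The central value of [b_n, b'_n'] in the Heisenberg algebra. *)
Definition mode_bracket (b : osc) (n : int) (b' : osc) (n' : int) : C :=
  if (b == b') && (n + n' == 0) then osc_sign C b * qint n%:~R ^+ 2 / n%:~R else 0.

Lemma mode_comm0 b b' n v : mode b 0 (mode b' n v) = mode b' n (mode b 0 v).
Proof.
apply: (linear_eq_ket (linear_comp (linear_mode b 0) (linear_mode b' n))
                      (linear_comp (linear_mode b' n) (linear_mode b 0))).
case=> lam mu /=; rewrite mode_zero (linear_scaleE (linear_mode _ _)).
case: n => [[|m]|m]; rewrite ?mode_zero ?mode_ann ?mode_cre ?cre_ket ?ann_ket.
- by rewrite (linear_scaleE (linear_mode _ _)) mode_zero scalerA mulrC -scalerA.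
- rewrite !(linear_scaleE (linear_mode _ _)) mode_zero !scalerA.
  by congr (_ *: _); ring.
- by rewrite mode_zero.
Qed.

(** The bracket also has the right value when n or n' is 0, where the division by
    0 in its formula gives 0. *)
Lemma mode_comm b n b' n' v :
  mode b n (mode b' n' v) =
  mode b' n' (mode b n v) + mode_bracket b n b' n' *: v.
Proof.
have E (m m' : nat) : (m.+1%:Z + Negz m' == 0) = (m == m') by lia.
have E' (m m' : nat) : (Negz m' + m.+1%:Z == 0) = (m == m') by lia.
have B0 : n = 0 \/ n' = 0 -> mode_bracket b n b' n' = 0.
  rewrite /mode_bracket; case=> ->; case: ifP => // /andP[_].
    by rewrite mulr0z invr0 mulr0.
  by rewrite addr0 => /eqP ->; rewrite mulr0z invr0 mulr0.
have [n0|n0] := eqVneq n 0.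
  by rewrite B0; [rewrite n0 mode_comm0 scale0r addr0|left].
have [n'0|n'0] := eqVneq n' 0.
  by rewrite B0; [rewrite n'0 -mode_comm0 scale0r addr0|right].
case: n n' {B0} n0 n'0 => [[//|m]|m] [[//|m']|m'] _ _;
  rewrite /mode_bracket ?mode_cre ?mode_ann.
- rewrite !(linear_scaleE (linear_ann _)) !scalerA ann_comm mulrC.
  rewrite (_ : (_ + _ == 0) = false); last by lia.
  by rewrite andbF scale0r addr0.
- rewrite !(linear_scaleE (linear_cre _)) ann_cre scalerDr E scalerA xpair_eqE.
  congr (_ + _); case: eqP => [->|] /=; last by rewrite mulr0.
  by case: eqP => [->|] /=; rewrite ?mulr1 ?mulr0.
- rewrite !(linear_scaleE (linear_cre _)) ann_cre scalerDr -addrA E' scalerA xpair_eqE.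
  rewrite -scalerDl (eq_sym b) (eq_sym m').
  rewrite NegzE mulrNz qintN sqrrN invrN mulrN.
  case: eqP => [->|] /=; last by rewrite mulr0 addr0 scale0r addr0.
  by case: eqP => [->|] /=; rewrite ?mulr1 ?mulr0 ?subrr ?addr0 scale0r addr0.
- rewrite cre_comm (_ : (_ + _ == 0) = false); last by lia.
  by rewrite andbF scale0r addr0.
Qed.

End Modes.

(** * Exponential series of operators *)

Section Exponentials.
Variables (C : fieldType) (x : nat -> fock C -> fock C).
Local Notation fock := (fock C).
Hypothesis C0 : forall n, n.+1%:R != 0 :> C.
Hypothesis lx : forall m, linear (x m).
Implicit Types (v : fock) (y : fock -> fock).

Lemma linear_pow_coef r n : linear (pow_coef x r n).
Proof.
elim: r n => [|r IHr] n.
  by case: n => [|n] a u v /=; rewrite ?scaler0 ?addr0.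
exact: (linear_sum_fun _ _ (fun m => linear_comp (lx m) (IHr (n - m)%N))).
Qed.

Lemma linear_exp_coef n : linear (exp_coef x n).
Proof.
exact: (linear_sum_fun _ _ (fun r => linear_scale_fun _ (linear_pow_coef r n))).
Qed.

Lemma pow_coef_small r n v : (n < r)%N -> pow_coef x r n v = 0.
Proof.
elim: r n v => [//|r IHr] n v nr /=; rewrite big_nat big1 // => m /andP[m0 mn].
by rewrite IHr ?(linear_0E (lx m)) //; lia.
Qed.

Lemma exp_coef_widen N n v : (n < N)%N ->
  exp_coef x n v = \sum_(0 <= r < N) (r`!%:R)^-1 *: pow_coef x r n v.
Proof.
move=> nN; rewrite (big_cat_nat (n := n.+1)) //= [X in _ + X]big_nat_cond.
rewrite [X in _ + X]big1 ?addr0 // => r.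
by rewrite andbT => /andP[nr _]; rewrite pow_coef_small // scaler0.
Qed.

Lemma exp_coef0 v : exp_coef x 0 v = v.
Proof. by rewrite /exp_coef big_nat1 /= fact0 invr1 scale1r. Qed.

Section Derivation.
Variables (m : nat) (kap : C) (y : fock -> fock).
Hypotheses (m0 : (0 < m)%N) (ly : linear y).
Hypothesis yx : forall i v, (0 < i)%N ->
  y (x i v) = x i (y v) + (if i == m then kap else 0) *: v.

Lemma pow_coef_derivation r n v :
  y (pow_coef x r.+1 n v) = pow_coef x r.+1 n (y v) +
    (r.+1%:R * kap) *: (if (m <= n)%N then pow_coef x r (n - m) v else 0).
Proof.
(* the result of the derivation on the r-th power, also at r = 0 *)
pose R r n := if r is r'.+1 then (r%:R * kap) *:
  (if (m <= n)%N then pow_coef x r' (n - m) v else 0) else 0 : fock.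
suff H : forall n, y (pow_coef x r.+1 n v) = pow_coef x r.+1 n (y v) + R r.+1 n.
  exact: H.
have H0 k : y (pow_coef x 0 k v) = pow_coef x 0 k (y v) + R 0 k.
  by rewrite /= addr0; case: eqP => // _; exact: linear_0E.
suff step s : (forall k, y (pow_coef x s k v) = pow_coef x s k (y v) + R s k) ->
    forall k, y (pow_coef x s.+1 k v) = pow_coef x s.+1 k (y v) + R s.+1 k.
  by elim: r => [|r IHr]; exact: step.
move=> IH k /=; rewrite (linear_sumE ly).
under [LHS]eq_big_nat => i /andP[i0 _] do
  rewrite (yx _ i0) IH (linear_addE (lx i)) -addrA.
rewrite big_split /=; congr (_ + _); rewrite big_split /=.
have -> : \sum_(1 <= i < k.+1) (if i == m then kap else 0) *: pow_coef x s (k - i) v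
    = kap *: (if (m <= k)%N then pow_coef x s (k - m) v else 0).
  have [mk|mk] := leqP m k; last first.
    rewrite scaler0 big_nat big1 // => i /andP[_ ik].
    by rewrite (_ : i == m = false) ?scale0r //; apply/eqP; lia.
  rewrite (bigD1_seq m) ?mem_index_iota ?iota_uniq //=; last by lia.
  rewrite eqxx big1 ?addr0 // => i im.
  by rewrite (negbTE im) scale0r.
have -> : \sum_(1 <= i < k.+1) x i (R s (k - i)%N)
    = (s%:R * kap) *: (if (m <= k)%N then pow_coef x s (k - m) v else 0).
  case: s {IH} => [|s] /=.
    by rewrite mul0r scale0r big1 // => i _; exact: linear_0E.
  have [mk|mk] := leqP m k; last first.
    rewrite scaler0 big_nat big1 // => i /andP[i0 ik].
    rewrite (_ : (m <= k - i)%N = false) ?scaler0 ?(linear_0E (lx i)) //.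
    by apply/negbTE; lia.
  rewrite (big_cat_nat (n := (k - m).+1)) //=; last by lia.
  rewrite [X in _ + X]big_nat_cond [X in _ + X]big1 ?addr0; last first.
    move=> i; rewrite andbT => /andP[i0 ik].
    rewrite (_ : (m <= k - i)%N = false) ?scaler0 ?(linear_0E (lx i)) //.
    by apply/negbTE; lia.
  rewrite scaler_sumr; apply: eq_big_nat => i /andP[i0 ik].
  rewrite (_ : (m <= k - i)%N = true) ?(linear_scaleE (lx i)); last by lia.
  by rewrite subnAC.
by rewrite -scalerDl -natr1 mulrDl mul1r.
Qed.

(** The commutator with y is a derivation that sends X(w) = sum_i x_i w^i to
    kap w^m, so it multiplies exp(X(w)) by kap w^m.  Applied with a mode as y and
    with the two halves of c(z) as X, this is the whole of the operator product
    calculus used below. *)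
Lemma exp_coef_derivation n v :
  y (exp_coef x n v) = exp_coef x n (y v) +
    kap *: (if (m <= n)%N then exp_coef x (n - m) v else 0).
Proof.
rewrite (exp_coef_widen (N := n.+2)) // [X in _ = X + _](exp_coef_widen (N := n.+2)) //.
rewrite (linear_sumE ly) big_nat_recl // [X in _ = X + _]big_nat_recl // -addrA.
congr (_ + _).
  rewrite (linear_scaleE ly) /=; case: eqP => // _.
  by rewrite (linear_0E ly).
under eq_bigr => r _ do
  rewrite (linear_scaleE ly) pow_coef_derivation scalerDr.
rewrite big_split /=; congr (_ + _).
case: leqP => mn; last by rewrite scaler0 big1 // => r _; rewrite !scaler0.
rewrite (exp_coef_widen (N := n.+1)); last by lia.
rewrite scaler_sumr; apply: eq_bigr => r _; rewrite !scalerA; congr (_ *: _).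
rewrite factS natrM invfM mulrA [_ * r.+1%:R]mulrC.
by rewrite mulrA divff // mul1r mulrC.
Qed.

End Derivation.

Lemma exp_coef_comm y n v : linear y ->
  (forall i u, (0 < i)%N -> y (x i u) = x i (y u)) ->
  y (exp_coef x n v) = exp_coef x n (y v).
Proof.
move=> ly yx; rewrite (@exp_coef_derivation 1 0) ?scale0r ?addr0 // => i u i0.
by rewrite if_same scale0r addr0 yx.
Qed.

Section Euler.
Hypothesis xx : forall i j v, x i (x j v) = x j (x i v).

Lemma pow_coef_euler r n v :
  n%:R *: pow_coef x r.+1 n v =
  r.+1%:R *: \sum_(1 <= m < n.+1) m%:R *: x m (pow_coef x r (n - m) v).
Proof.
elim: r n => [|r IHr] n.
  rewrite scale1r /= scaler_sumr; apply: eq_big_nat => m /andP[m0 mn].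
  case: eqP => [/eqP|_]; last by rewrite (linear_0E (lx m)) !scaler0.
  by rewrite subn_eq0 => nm; rewrite (_ : n = m) //; lia.
have -> : n%:R *: pow_coef x r.+2 n v
  = \sum_(1 <= m < n.+1) m%:R *: x m (pow_coef x r.+1 (n - m) v)
    + \sum_(1 <= m < n.+1) x m ((n - m)%:R *: pow_coef x r.+1 (n - m) v).
  rewrite -big_split scaler_sumr; apply: eq_big_nat => m /andP[m0 mn] /=.
  by rewrite (linear_scaleE (lx m)) -scalerDl -natrD subnKC.
rewrite -[in RHS]natr1 scalerDl scale1r addrC; congr (_ + _).
under eq_bigr => m _ do rewrite IHr (linear_scaleE (lx m)) (linear_sumE (lx m)).
rewrite -scaler_sumr; congr (_ *: _).
under [RHS]eq_bigr => m _ do rewrite /= (linear_sumE (lx m)) scaler_sumr.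
have E (i j : nat) : (i < n.+1)%N -> (0 < j)%N -> (j < (n - i).+1)%N =
  (i + j < n.+1)%N by lia.
(* both double sums range over the pairs i, j > 0 with i + j <= n *)
have T (F : nat -> nat -> fock) :
    \sum_(1 <= i < n.+1) \sum_(1 <= j < (n - i).+1) F i j
  = \sum_(1 <= i < n.+1) \sum_(1 <= j < n.+1 | (i + j < n.+1)%N) F i j.
  apply: eq_big_nat => i /andP[i0 iN].
  rewrite (big_nat_widen _ _ n.+1); last by lia.
  rewrite big_nat_cond [RHS]big_nat_cond; apply: eq_bigl => j.
  by case: (leqP 1 j) => // j0; rewrite E.
rewrite !T (exchange_big_dep_nat xpredT) //=; apply: eq_bigr => i _.
apply: eq_big => [j|j _]; first by rewrite addnC.
by rewrite (linear_scaleE (lx j)) xx subnAC.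
Qed.

(** Euler's identity w d/dw exp X = (w d/dw X) exp X; it turns vacuum expectation
    values of exponentials into a recursion. *)
Lemma exp_coef_euler n v :
  n%:R *: exp_coef x n v =
  \sum_(1 <= m < n.+1) m%:R *: x m (exp_coef x (n - m) v).
Proof.
case: n => [|n]; first by rewrite scale0r big_geq.
rewrite (exp_coef_widen (N := n.+2)) // scaler_sumr big_nat_recl //.
rewrite /= !scaler0 add0r.
under eq_bigr => r _ do
  rewrite scalerA mulrC -scalerA -/(pow_coef x r.+1 n.+1 v) pow_coef_euler.
have H m : (0 < m)%N -> (n.+1 - m < n.+1)%N by lia.
under [RHS]eq_big_nat => m /andP[m0 mn] do
  rewrite (exp_coef_widen _ (H m m0)) (linear_sumE (lx m)) scaler_sumr.
rewrite [RHS]exchange_big; apply: eq_bigr => r _ /=.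
rewrite scalerA scaler_sumr; apply: eq_bigr => m _.
rewrite (linear_scaleE (lx m)) !scalerA; congr (_ *: _).
by rewrite factS natrM invfM [_ * r.+1%:R]mulrAC mulVf // mul1r mulrC.
Qed.

End Euler.

(** With the value 0 at negative indices, shifting the index needs no side
    condition. *)
Definition expz (n : int) (v : fock) : fock :=
  if n is Posz m then exp_coef x m v else 0.

Lemma linear_expz n : linear (expz n).
Proof. by case: n => n; [exact: linear_exp_coef | exact: linear_zero_fun]. Qed.

Lemma expz_derivation m kap y n v : (0 < m)%N -> linear y ->
  (forall i u, (0 < i)%N ->
     y (x i u) = x i (y u) + (if i == m then kap else 0) *: u) ->
  y (expz n v) = expz n (y v) + kap *: expz (n - m%:Z) v.
Proof.
move=> m0 ly yx; case: n => n /=.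
  rewrite (exp_coef_derivation m0 ly yx); congr (_ + _ *: _).
  by case: leqP => mn; [rewrite subzn | case E: (_ - _) => //; lia].
rewrite (linear_0E ly) add0r; case E: (_ - _) => /=; last by rewrite scaler0.
by lia.
Qed.

Lemma expz_comm y n v : linear y ->
  (forall i u, (0 < i)%N -> y (x i u) = x i (y u)) ->
  y (expz n v) = expz n (y v).
Proof.
move=> ly yx; case: n => n; first exact: exp_coef_comm.
exact: linear_0E.
Qed.

End Exponentials.

(** * Levels and homogeneous vectors *)

Section Levels.
Variable C : fieldType.
Local Notation fock := (fock C).
Implicit Types (v : fock) (lam : momentum C) (mu : {mset (osc * nat)}%mset) (w : int).

(** The pair (b, m) stands for b_{-(m+1)}, hence the successor. *)
Definition lvl mu : nat := (\sum_(x <- finsupp mu) mu x * x.2.+1)%N.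

Lemma lvlE (A : {fset (osc * nat)}) mu : (finsupp mu `<=` A)%fset ->
  lvl mu = (\sum_(x <- A) mu x * x.2.+1)%N.
Proof.
move=> sA; apply: big_fset_incl => // x _.
by rewrite memNfinsupp => /eqP ->.
Qed.

Lemma lvl_cre x mu : lvl (x +` mu)%mset = (x.2.+1 + lvl mu)%N.
Proof.
pose A := (finsupp (x +` mu)%mset `|` (finsupp mu `|` [fset x]))%fset.
rewrite (@lvlE A); last exact: fsubsetUl.
rewrite (@lvlE A mu); last by rewrite /A fsetUCA fsubsetUl.
under eq_bigr => y _ do rewrite mset1DE mulnDl.
rewrite big_split /=; congr (_ + _)%N.
rewrite (big_fsetD1 x) /=; last by rewrite !inE eqxx !orbT.
rewrite eqxx mul1n big_seq big1 ?addn0 // => y.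
by rewrite !inE => /andP[/negbTE -> _].
Qed.

Lemma lvl_ann x mu : mu x != 0%N -> (x.2.+1 + lvl (mu `\ x)%mset)%N = lvl mu.
Proof. by rewrite mset_neq0 => xmu; rewrite -lvl_cre msetB1K. Qed.

Lemma lvl_mset0 : lvl (mset0 : {mset (osc * nat)}%mset) = 0%N.
Proof. by rewrite /lvl finsupp0 big_nil. Qed.

Lemma lvl_ge x mu : (mu x * x.2.+1 <= lvl mu)%N.
Proof.
have [xA|] := boolP (x \in finsupp mu); last first.
  by rewrite memNfinsupp => /eqP ->.
by rewrite /lvl (big_fsetD1 x) //= leq_addr.
Qed.

(** Every multiset is built from the empty one by additions: the Fock space is
    generated from its vacua by creation operators. *)
Lemma mset_ind (P : {mset (osc * nat)}%mset -> Prop) : P mset0%mset ->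
  (forall x mu, P mu -> P (x +` mu)%mset) -> forall mu, P mu.
Proof.
move=> P0 P1 mu; have [n] := ubnP (lvl mu); elim: n => // n IHn in mu *.
rewrite ltnS => mun; have [->//|] := eqVneq mu mset0%mset => mu0.
have [x xmu] : exists x, mu x != 0%N.
  apply: contrapT => H; case/eqP: mu0; apply/msetP => x; rewrite mset0E.
  by apply/eqP/negPn/negP => mx; apply: H; exists x.
rewrite -(@msetB1K _ x mu) -?mset_neq0 //; apply/P1/IHn.
by have := lvl_ann xmu; lia.
Qed.

(** The level w is an integer, so that every mode shifts it without side condition;
    a vector of negative level is 0. *)
Definition homog lam w v :=
  forall p, p \in fm_supp v -> p.1 = lam /\ (lvl p.2)%:Z = w.

Lemma homog0 lam w : homog lam w 0.
Proof. by move=> p; rewrite fm_suppE fm_coef0 eqxx. Qed.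

Lemma homogD lam w u v : homog lam w u -> homog lam w v -> homog lam w (u + v).
Proof.
move=> hu hv p; rewrite fm_suppE fm_coefD.
have [pu|pu] := boolP (p \in fm_supp u); first by move=> _; exact: hu.
by rewrite (fm_coef_out pu) add0r -fm_suppE; exact: hv.
Qed.

Lemma homogZ lam w a v : homog lam w v -> homog lam w (a *: v).
Proof.
move=> hv p; rewrite fm_suppE fm_coefZ mulf_eq0 negb_or => /andP[_].
by rewrite -fm_suppE; exact: hv.
Qed.

Lemma homog_sum lam w I (r : seq I) (P : pred I) (F : I -> fock) :
  (forall i, P i -> homog lam w (F i)) -> homog lam w (\sum_(i <- r | P i) F i).
Proof.
move=> hF; elim/big_ind: _ => //; [exact: homog0|exact: homogD].
Qed.

Lemma homog_sum_nat lam w m n (F : nat -> fock) :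
  (forall i, (m <= i < n)%N -> homog lam w (F i)) ->
  homog lam w (\sum_(m <= i < n) F i).
Proof.
by move=> hF; rewrite big_nat_cond; apply: homog_sum => i /andP[/hF].
Qed.

Lemma homog_ket lam mu : homog lam (lvl mu) (ket (lam, mu)).
Proof.
move=> p; rewrite fm_suppE fm_coef_ket.
by have [->|_] := eqVneq p (lam, mu); rewrite ?eqxx.
Qed.

Lemma homog_neg lam w v : homog lam w v -> w < 0 -> v = 0.
Proof.
move=> hv w0; apply: fm_eqP => p; rewrite fm_coef0; apply/eqP/negPn/negP.
by rewrite -fm_suppE => /hv[_]; lia.
Qed.

Lemma homog_linext lam w lam' w' (h : fock_index C -> fock) v :
  (forall mu, (lvl mu)%:Z = w -> homog lam' w' (h (lam, mu))) ->
  homog lam w v -> homog lam' w' (linext h v).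
Proof.
move=> hh hv; rewrite /linext big_seq; apply: homog_sum => -[lam1 mu] /hv[/= -> hw].
by apply: homogZ; exact: hh.
Qed.

Variable qpow : C -> C.

Lemma homog_mode b k lam w v : k != 0 -> homog lam w v ->
  homog lam (w - k) (mode qpow b k v).
Proof.
case: k => [[//|m]|m] _ hv; rewrite /mode.
  apply: homog_linext hv => mu /= hw.
  have [->|mx] := eqVneq (mu (b, m)) 0%N.
    by rewrite mulr0 scale0r; exact: homog0.
  apply: homogZ; have := lvl_ann mx; rewrite /= => hl.
  have -> : w - m.+1%:Z = (lvl (mu `\ (b, m))%mset)%:Z by lia.
  exact: homog_ket.
apply: homog_linext hv => mu /= hw.
have -> : w - Negz m = (lvl ((b, m) +` mu)%mset)%:Z by rewrite lvl_cre /=; lia.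
exact: homog_ket.
Qed.

Section Exp.
Variables (x : nat -> fock -> fock) (s : int).
Hypothesis hx : forall i lam w v, (0 < i)%N ->
  homog lam w v -> homog lam (w + s * i%:Z) (x i v).

Lemma homog_pow_coef r n lam w v : homog lam w v ->
  homog lam (w + s * n%:Z) (pow_coef x r n v).
Proof.
move=> hv; elim: r n => [|r IHr] n /=.
  by case: eqP => [->|_]; [rewrite mulr0 addr0 | exact: homog0].
apply: homog_sum_nat => i /andP[i0 ik].
have -> : w + s * n%:Z = w + s * (n - i)%:Z + s * i%:Z.
  by rewrite -addrA -mulrDr -PoszD subnK.
exact/hx/IHr.
Qed.

Lemma homog_exp_coef n lam w v : homog lam w v ->
  homog lam (w + s * n%:Z) (exp_coef x n v).
Proof.
by move=> hv; apply: homog_sum => r _; apply/homogZ/homog_pow_coef.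
Qed.

End Exp.

Definition shift (l : 'I_2) (r : int) (lam : momentum C) : momentum C :=
  (lam.1, [ffun i => if i == l then lam.2 i + r else lam.2 i]).

Lemma expQ_ket l r lam mu :
  expQ l r (ket (lam, mu)) = ket (shift l r lam, mu) :> fock.
Proof. by rewrite /expQ linext_ket. Qed.

Lemma linear_expQ l r : linear (expQ l r : fock -> fock).
Proof. exact: linear_linext. Qed.

Lemma linear_cproj l r : linear (cproj l r : fock -> fock).
Proof. exact: linear_linext. Qed.

Lemma homog_expQ l r lam w v : homog lam w v ->
  homog (shift l r lam) w (expQ l r v).
Proof.
move=> hv; apply: homog_linext hv => mu <-; exact: homog_ket.
Qed.

Lemma cproj_homog l r lam w v : homog lam w v ->
  cproj l r v = if lam.2 l == r then v else 0.
Proof.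
move=> hv; rewrite /cproj /linext big_seq.
under eq_bigr => p /hv[-> _] do [].
case: eqP => _; last by rewrite big1 // => p _; rewrite scaler0.
by rewrite -big_seq /ket -fm_expand.
Qed.

Lemma mode_expQ b k l r v : k != 0 ->
  mode qpow b k (expQ l r v) = expQ l r (mode qpow b k v).
Proof.
move=> k0; apply: (linear_eq_ket (linear_comp (linear_mode _ b k) (linear_expQ l r))
  (linear_comp (linear_expQ l r) (linear_mode _ b k))).
case=> lam mu; rewrite /= expQ_ket.
case: k k0 => [[//|m]|m] _; last by rewrite mode_cre !cre_ket expQ_ket.
rewrite !mode_ann !ann_ket !(linear_scaleE (linear_expQ l r)).
by rewrite expQ_ket.
Qed.

End Levels.

(** * Vertex operators *)

Section Vertex.
Variables (C : fieldType) (qpow : C -> C).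
Local Notation fock := (fock C).
Local Notation mode := (mode qpow).
Local Notation qint := (qint qpow).
Local Notation cplus := (cplus qpow).
Local Notation cminus := (cminus qpow).
Local Notation vertex := (vertex qpow).
Hypothesis C0 : forall n, n.+1%:R != 0 :> C.
Hypothesis q0 : forall m, qint m.+1%:R != 0.
Implicit Types (v : fock) (lam : momentum C) (mu : {mset (osc * nat)}%mset).

Lemma linear_cplus l e m : linear (cplus l e m).
Proof. exact/linear_opp_fun/linear_scale_fun/linear_mode. Qed.

Lemma linear_cminus l e m : linear (cminus l e m).
Proof. exact/linear_opp_fun/linear_scale_fun/linear_mode. Qed.

Lemma cplusE l e i v :
  cplus l e i v = (e%:~R / qint i%:R) *: mode (inr l) (- i%:Z) v.
Proof. by rewrite /Defs.cplus qintN invrN mulrN scaleNr opprK. Qed.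

Lemma cminusE l e i v :
  cminus l e i v = (- (e%:~R / qint i%:R)) *: mode (inr l) i%:Z v.
Proof. by rewrite /Defs.cminus scaleNr. Qed.

(** The coefficient of z^k in [b_k, e c^l(z)], where no other power of z occurs. *)
Definition mode_charge (b : osc) (l : 'I_2) (e k : int) : C :=
  if b == inr l then e%:~R * qint k%:~R / k%:~R else 0.

Lemma mode_cplus b k l e i v : (0 < i)%N ->
  mode b k (cplus l e i v) = cplus l e i (mode b k v) +
    (if i%:Z == k then mode_charge b l e k else 0) *: v.
Proof.
case: i => // i _; rewrite !cplusE (linear_scaleE (linear_mode _ _ _)).
rewrite mode_comm scalerDr scalerA.
congr (_ + _ *: _); rewrite /mode_bracket /mode_charge subr_eq0 [k == _]eq_sym.
case: (b =P inr l) => [->|] /=; last by rewrite mulr0 if_same.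
case: (i.+1%:Z =P k) => [<-|]; last by rewrite mulr0.
rewrite mul1r -pmulrn; move: (qint _) (q0 i) => Q Q0.
by rewrite expr2 !mulrA; congr (_ * _); rewrite divfK.
Qed.

Lemma mode_cminus b k l e i v : (0 < i)%N ->
  mode b k (cminus l e i v) = cminus l e i (mode b k v) +
    (if - i%:Z == k then mode_charge b l e k else 0) *: v.
Proof.
case: i => // i _; rewrite !cminusE (linear_scaleE (linear_mode _ _ _)).
rewrite mode_comm scalerDr scalerA.
congr (_ + _ *: _); rewrite /mode_bracket /mode_charge addr_eq0 [k == _]eq_sym.
case: (b =P inr l) => [->|] /=; last by rewrite mulr0 if_same.
case: (- i.+1%:Z =P k) => [<-|]; last by rewrite mulr0.
rewrite mul1r !mulrNz qintN -pmulrn sqrrN; move: (qint _) (q0 i) => Q Q0.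
by rewrite expr2 !mulrA; congr (_ * _); rewrite mulNr divfK // mulrN mulNr.
Qed.

Lemma cminus_comm l e i l' e' j v :
  cminus l e i (cminus l' e' j v) = cminus l' e' j (cminus l e i v).
Proof.
rewrite !cminusE !(linear_scaleE (linear_mode _ _ _)) mode_comm !scalerA.
rewrite mulrC /mode_bracket; case: ifP => [/andP[_]|_]; last by rewrite scale0r addr0.
rewrite addr_eq0 => /eqP ij.
have -> : i%:Z = 0 by lia.
by rewrite mulr0z invr0 mulr0 scale0r addr0.
Qed.

(** The contraction of e c^l(z) with e' c^l(w) is e e' log (1 - w/z): the factors
    [m] / m of the brackets cancel against the 1 / [m] in the fields. *)
Lemma cminus_cplus l e i l' e' j v : (0 < i)%N -> (0 < j)%N ->
  cminus l e i (cplus l' e' j v) = cplus l' e' j (cminus l e i v) +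
    (if j == i then (if l == l' then - (e * e')%:~R / i%:R else 0) else 0) *: v.
Proof.
case: i => // i _ j0; rewrite !cminusE mode_cplus // scalerDr.
rewrite (linear_scaleE (linear_cplus _ _ _)) scalerA; congr (_ + _ *: _).
rewrite eqz_nat; case: (j =P i.+1) => _; last by rewrite mulr0.
rewrite /mode_charge; have -> : (inr l == inr l' :> osc) = (l == l') by [].
case: eqP => _; last by rewrite mulr0.
rewrite -!pmulrn intrM; move: (qint _) (q0 i) => Q Q0.
by rewrite !mulNr; congr (- _); rewrite !mulrA [_ * Q]mulrAC divfK.
Qed.

Lemma homog_cplus l e i lam w v : (0 < i)%N ->
  homog lam w v -> homog lam (w + 1 * i%:Z) (cplus l e i v).
Proof.
move=> i0 hv; rewrite cplusE mul1r; apply: homogZ.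
by rewrite -{1}[i%:Z]opprK; apply: homog_mode => //; lia.
Qed.

Lemma homog_cminus l e i lam w v : (0 < i)%N ->
  homog lam w v -> homog lam (w + -1 * i%:Z) (cminus l e i v).
Proof.
move=> i0 hv; rewrite cminusE mulN1r; apply: homogZ.
by apply: homog_mode => //; lia.
Qed.

Lemma homog_cminus_exp l e n lam w v :
  homog lam w v -> homog lam (w - n%:Z) (exp_coef (cminus l e) n v).
Proof.
move=> hv; rewrite -[- n%:Z]mulN1r.
by apply: homog_exp_coef => // *; apply: homog_cminus.
Qed.

Lemma homog_cplus_expz l e n lam w v :
  homog lam w v -> homog lam (w + n) (expz (cplus l e) n v).
Proof.
case: n => n hv /=; last exact: homog0.
rewrite -[n%:Z]mul1r.
by apply: homog_exp_coef => // *; apply: homog_cplus.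
Qed.

Lemma cminus_exp_large l e n lam w v : homog lam w v -> w < n%:Z ->
  exp_coef (cminus l e) n v = 0.
Proof. by move=> hv wn; apply: (homog_neg (@homog_cminus_exp l e n _ _ _ hv)); lia. Qed.

Lemma linear_cplus_exp l e n : linear (exp_coef (cplus l e) n).
Proof. exact/linear_exp_coef/linear_cplus. Qed.

Lemma linear_cplus_expz l e n : linear (expz (cplus l e) n).
Proof. exact/linear_expz/linear_cplus. Qed.

Lemma linear_cminus_exp l e n : linear (exp_coef (cminus l e) n).
Proof. exact/linear_exp_coef/linear_cminus. Qed.

(** The part of the z^n-coefficient of :e^{e c^l(z)}: that takes z^p from the
    creation modes and z^{-r} from the annihilation modes. *)
Definition vertex_term l (e n : int) (p r : nat) v : fock :=
  exp_coef (cplus l e) p (expQ l e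
    (cproj l (e * (n - p%:Z + r%:Z)) (exp_coef (cminus l e) r v))).

Lemma linear_vertex_term l e n p r : linear (vertex_term l e n p r).
Proof.
exact: (linear_comp (linear_cplus_exp l e p) (linear_comp (linear_expQ l e)
  (linear_comp (linear_cproj l _) (linear_cminus_exp l e r)))).
Qed.

Lemma vertex_sum l e n v B :
  (forall p r, (B <= p)%N || (B <= r)%N -> vertex_term l e n p r v = 0) ->
  vertex l e n v = \sum_(0 <= p < B) \sum_(0 <= r < B) vertex_term l e n p r v.
Proof.
move=> hB; rewrite /Defs.vertex.
rewrite (fsbigE [seq (p, r) | p <- index_iota 0 B, r <- index_iota 0 B]) //=.
- rewrite (eq_bigl xpredT); last by move=> i; rewrite in_setT.
  by rewrite big_allpairs.
- by apply: allpairs_uniq; rewrite ?iota_uniq // => -[? ?] [? ?].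
case=> p r _ /negP prB; apply: hB; apply: contrapT => /negP.
rewrite negb_or -!ltnNge => /andP[pB rB]; apply: prB.
by apply/allpairsP; exists (p, r); rewrite !mem_index_iota pB rB.
Qed.

Lemma vertex_term_homog l e n p r lam w v : e = 1 \/ e = -1 -> homog lam w v ->
  vertex_term l e n p r v = if p%:Z == n - e * lam.2 l + r%:Z then
    exp_coef (cplus l e) p (expQ l e (exp_coef (cminus l e) r v)) else 0.
Proof.
move=> he hv; rewrite /vertex_term (cproj_homog _ _ (@homog_cminus_exp l e r _ _ _ hv)).
have -> : (lam.2 l == e * (n - p%:Z + r%:Z)) = (p%:Z == n - e * lam.2 l + r%:Z).
  by case: he => ->; apply/eqP/eqP; lia.
case: eqP => // _.
by rewrite (linear_0E (linear_expQ l e)) (linear_0E (linear_cplus_exp l e p)).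
Qed.

(** A vector has finitely many momenta and bounded level, so that all but finitely
    many terms vanish on it; this makes the vertex operators linear. *)
Lemma vertex_term_bound l e n v : e = 1 \/ e = -1 -> exists B, forall p r,
  (B <= p)%N || (B <= r)%N -> vertex_term l e n p r v = 0.
Proof.
move=> he.
have H (k : fock_index C) : exists B, forall p r,
    (B <= p)%N || (B <= r)%N -> vertex_term l e n p r (ket k) = 0.
  case: k => lam mu; exists (absz (n - e * lam.2 l)%R + lvl mu + 1)%N => p r hB.
  rewrite (vertex_term_homog _ _ _ _ he (homog_ket (lam := lam) (mu := mu))).
  case: eqP => // pr.
  rewrite (@cminus_exp_large l e r lam (lvl mu)%:Z); [|exact: homog_ket|lia].
  by rewrite (linear_0E (linear_expQ l e)) (linear_0E (linear_cplus_exp l e p)).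
have [b hb] := choice H.
exists (\max_(k <- fm_supp v) b k) => p r hB; rewrite (fm_expand v).
rewrite (linear_sumE (linear_vertex_term l e n p r)) big_seq big1 // => k kv.
rewrite (linear_scaleE (linear_vertex_term l e n p r)) -/(ket k) hb ?scaler0 //.
have bk : (b k <= \max_(k <- fm_supp v) b k)%N by apply: leq_bigmax_seq.
by case/orP: hB => hB; rewrite (leq_trans bk hB) ?orbT.
Qed.

Lemma linear_vertex l e n : e = 1 \/ e = -1 -> linear (vertex l e n).
Proof.
move=> he a u v.
have [B1 h1] := vertex_term_bound l n u he.
have [B2 h2] := vertex_term_bound l n v he.
pose B := maxn B1 B2.
have {}h1 p r : (B <= p)%N || (B <= r)%N -> vertex_term l e n p r u = 0.
  by rewrite !geq_max => hB; apply: h1; case/orP: hB => /andP[-> _]; rewrite ?orbT.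
have {}h2 p r : (B <= p)%N || (B <= r)%N -> vertex_term l e n p r v = 0.
  by rewrite !geq_max => hB; apply: h2; case/orP: hB => /andP[_ ->]; rewrite ?orbT.
rewrite (vertex_sum h1) (vertex_sum h2) (@vertex_sum l e n _ B); last first.
  by move=> p r hB; rewrite linear_vertex_term h1 // h2 // scaler0 addr0.
rewrite scaler_sumr -big_split; apply: eq_bigr => p _ /=.
rewrite scaler_sumr -big_split; apply: eq_bigr => r _ /=.
exact: linear_vertex_term.
Qed.

(** On a vector of given momentum, z^{e c^l_0} is a single power of z, so only
    the total degree of the creation and annihilation parts matters. *)
Lemma vertexE l e n lam w v B : e = 1 \/ e = -1 -> homog lam w v -> w < B%:Z ->
  vertex l e n v = \sum_(0 <= r < B)
    expz (cplus l e) (n - e * lam.2 l + r%:Z)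
      (expQ l e (exp_coef (cminus l e) r v)).
Proof.
move=> he hv wB; pose d := n - e * lam.2 l; pose N := (absz d + B + 1)%N.
rewrite (@vertex_sum _ _ _ _ N); last first.
  move=> p r hB; rewrite (vertex_term_homog _ _ _ _ he hv).
  case: eqP => // pr; rewrite (cminus_exp_large l e hv); last by lia.
  by rewrite (linear_0E (linear_expQ l e)) (linear_0E (linear_cplus_exp l e p)).
rewrite exchange_big /= (big_cat_nat (n := B)) //=; last by lia.
rewrite [X in _ + X]big_nat_cond [X in _ + X]big1 ?addr0; last first.
  move=> r; rewrite andbT => /andP[Br _]; rewrite big1 // => p _.
  rewrite (vertex_term_homog _ _ _ _ he hv); case: eqP => // pr.
  rewrite (cminus_exp_large l e hv); last by lia.
  by rewrite (linear_0E (linear_expQ l e)) (linear_0E (linear_cplus_exp l e p)).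
apply: eq_big_nat => r /andP[_ rB].
under eq_bigr => p _ do rewrite (vertex_term_homog _ _ _ _ he hv) -/d.
rewrite -/d; case E: (d + r%:Z) => [m|m] /=; last first.
  by rewrite big1 // => p _; case: eqP => //; lia.
rewrite (bigD1_seq m) ?mem_index_iota ?iota_uniq //=; last by lia.
by rewrite eqxx big1 ?addr0 // => p pm; rewrite eqz_nat (negbTE pm).
Qed.

End Vertex.

(** * Covariance, the vacuum principle and contractions *)

Section VertexRelations.
Variables (C : fieldType) (qpow : C -> C).
Local Notation fock := (fock C).
Local Notation mode := (mode qpow).
Local Notation qint := (qint qpow).
Local Notation cplus := (cplus qpow).
Local Notation cminus := (cminus qpow).
Local Notation vertex := (vertex qpow).
Local Notation mode_charge := (mode_charge qpow).
Hypothesis C0 : forall n, n.+1%:R != 0 :> C.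
Hypothesis q0 : forall m, qint m.+1%:R != 0.
Implicit Types (v : fock) (lam : momentum C) (mu : {mset (osc * nat)}%mset).

Lemma homog_vertex l e n lam w v : e = 1 \/ e = -1 -> homog lam w v ->
  homog (shift l e lam) (w + (n - e * lam.2 l)) (vertex l e n v).
Proof.
move=> he hv; rewrite (@vertexE _ _ l e n lam w v `|w|.+1) //; last by lia.
apply: homog_sum_nat => r _.
have -> : w + (n - e * lam.2 l) = w - r%:Z + (n - e * lam.2 l + r%:Z) by lia.
exact/homog_cplus_expz/homog_expQ/homog_cminus_exp.
Qed.

(** z^k e^{c(z)} has the coefficients of e^{c(z)} shifted by k: the vertex
    operator carries the charge of its exponent under every mode. *)
Lemma mode_vertex b k l e n v : e = 1 \/ e = -1 -> k != 0 ->
  mode b k (vertex l e n v) =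
  vertex l e n (mode b k v) + mode_charge b l e k *: vertex l e (n - k) v.
Proof.
move=> he k0; have lV m := linear_vertex qpow l m he.
apply: (linear_eq_ket (linear_comp (linear_mode _ b k) (lV n))
  (linear_add_fun (linear_comp (lV n) (linear_mode _ b k))
    (linear_scale_fun _ (lV (n - k))))).
case=> lam mu; have hp := homog_ket (lam := lam) (mu := mu).
move: (ket _) hp => {}v hv; set w := (lvl mu)%:Z in hv.
have hkv := @homog_mode C qpow b k lam w v k0 hv.
pose B := (lvl mu + `|k|).+1; have wB : w < B%:Z by rewrite /w /B; lia.
rewrite /= (vertexE qpow l n he hv wB) (vertexE qpow l n he hkv (B := B)); last by rewrite /B; lia.
rewrite (linear_sumE (linear_mode _ b k)).
case: k k0 hkv @B wB => [[//|k]|k] k0 hkv B wB.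
  rewrite (vertexE qpow l _ he hv wB) scaler_sumr -big_split; apply: eq_bigr => r _.
  rewrite (expz_derivation (m := k.+1) C0 (linear_cplus qpow l e)
    (kap := mode_charge b l e k.+1)) //; last first.
  - by move=> i u i0; rewrite mode_cplus.
  - exact: linear_mode.
  congr (expz _ _ _ + _ *: expz _ _ _); last by lia.
  rewrite mode_expQ // (exp_coef_comm C0 (linear_cminus qpow l e)) //.
    exact: linear_mode.
  move=> i u i0; rewrite mode_cminus // (_ : (_ == _) = false) ?scale0r ?addr0 //.
  by apply/eqP; lia.
rewrite (vertexE qpow l _ he hv (B := (lvl mu).+1)); last by rewrite /w; lia.
pose F r := expz (cplus l e) (n - e * lam.2 l + r%:Z)
  (expQ l e (if (k.+1 <= r)%N then exp_coef (cminus l e) (r - k.+1) v else 0)).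
transitivity (\sum_(0 <= r < B) (expz (cplus l e) (n - e * lam.2 l + r%:Z)
    (expQ l e (exp_coef (cminus l e) r (mode b (Negz k) v))) +
    mode_charge b l e (Negz k) *: F r)).
  apply: eq_bigr => r _.
  rewrite (expz_comm C0 (linear_cplus qpow l e)) //; first last.
  - move=> i u i0; rewrite mode_cplus // (_ : (_ == _) = false) ?scale0r ?addr0 //.
  - exact: linear_mode.
  rewrite mode_expQ // (exp_coef_derivation C0 (linear_cminus qpow l e) (m := k.+1)
     (kap := mode_charge b l e (Negz k))) //; last 2 first.
  - exact: linear_mode.
  - by move=> i u i0; rewrite mode_cminus // NegzE eqr_opp.
  rewrite (linear_addE (linear_expQ l e)) (linear_scaleE (linear_expQ l e)).
  rewrite (linear_addE (linear_cplus_expz _ l e _)).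
  by rewrite (linear_scaleE (linear_cplus_expz _ l e _)).
rewrite big_split /= -scaler_sumr; congr (_ + _ *: _).
rewrite (big_cat_nat (n := k.+1)) //=; last by rewrite /B; lia.
rewrite big_nat_cond big1 ?add0r; last first.
  move=> r; rewrite andbT => /andP[_ rk]; rewrite /F leqNgt rk /=.
  by rewrite (linear_0E (linear_expQ l e)) (linear_0E (linear_cplus_expz _ l e _)).
rewrite -{1}[k.+1]add0n big_addn (_ : (B - k.+1)%N = (lvl mu).+1); last by rewrite /B; lia.
apply: eq_bigr => r _; rewrite /F leq_addl addnK.
by congr (expz _ _ _); lia.
Qed.

(** A basis vector of positive level contains some quantum x, and distinct basis
    vectors containing x stay distinct when x is removed: annihilating x loses
    nothing. *)
Lemma ann_all_zero lam w v : homog lam w v -> 0 < w ->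
  (forall b m, mode b m.+1%:Z v = 0) -> v = 0.
Proof.
move=> hv w0 hann; apply: fm_eqP => -[lam1 mu]; rewrite fm_coef0.
apply/eqP/negPn/negP => cp; have := cp; rewrite -fm_suppE => /hv[/= lamE muw].
have [x xmu] : exists x, mu x != 0%N.
  apply: contrapT => H; suff E : mu = mset0%mset by rewrite E lvl_mset0 in muw; lia.
  apply/msetP => x; rewrite mset0E; apply/eqP/negPn/negP => mx.
  by apply: H; exists x.
have annx : ann x v = 0.
  case: x {xmu} => b m; have := hann b m; rewrite mode_ann => /eqP.
  rewrite scaler_eq0 => /orP[|/eqP//].
  have s0 : osc_sign C b != 0 by case: b => ?; rewrite /= ?signr_eq0 ?oner_eq0.
  have := mulf_neq0 (mulf_neq0 s0 (expf_neq0 2 (q0 m))) (invr_neq0 (C0 m)).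
  by move/negbTE ->.
case/negP: cp; have := fm_coef0 _ (lam1, (mu `\ x)%mset) : _ = 0 :> C.
rewrite -annx /ann /linext fm_coef_sum.
have [pv|pv] := boolP ((lam1, mu) \in fm_supp v); last by move=> _; rewrite fm_coef_out.
rewrite (big_fsetD1 (lam1, mu)) //= !fm_coefZ fm_coef_ket eqxx mulr1.
rewrite big_seq big1 ?addr0.
  move/eqP; rewrite mulf_eq0 => /orP[//|].
  by case: (mu x) xmu => // m _; rewrite (negbTE (C0 m)).
case=> lam2 mu2; rewrite !inE => /andP[neq _]; rewrite !fm_coefZ fm_coef_ket /=.
have [->|x2] := eqVneq (mu2 x) 0%N; first by rewrite mul0r mulr0.
rewrite (_ : (_ == _) = false) ?mulr0 //; apply: contraNF neq => /eqP[-> E].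
by rewrite -(msetB1K (a := x) (A := mu2)) -?mset_neq0 // -E msetB1K // -mset_neq0.
Qed.

Definition vac lam : fock := ket (lam, mset0%mset).

Lemma mode_vac b m lam : mode b m.+1%:Z (vac lam) = 0.
Proof. by rewrite mode_ann ann_ket mset0E scale0r scaler0. Qed.

Lemma homog_vac lam : homog lam 0 (vac lam).
Proof. by have := @homog_ket C lam mset0%mset; rewrite lvl_mset0. Qed.

(** The commutation relations with the modes of a product of two vertex operators,
    of charges alpha and beta; they are stable under sums and differences. *)
Definition covariant (alpha beta : osc -> int -> C)
    (X : int -> int -> fock -> fock) :=
  forall b k n n' v, k != 0 ->
    mode b k (X n n' v) = X n n' (mode b k v)
      + alpha b k *: X (n - k) n' v + beta b k *: X n (n' - k) v.

Lemma covariantD alpha beta X Y : covariant alpha beta X ->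
  covariant alpha beta Y -> covariant alpha beta (fun n n' v => X n n' v + Y n n' v).
Proof.
move=> cX cY b k n n' v k0; rewrite (linear_addE (linear_mode _ _ _)).
by rewrite cX // cY // !scalerDr [LHS]addrACA; congr (_ + _); rewrite addrACA.
Qed.

Lemma covariantN alpha beta X : covariant alpha beta X ->
  covariant alpha beta (fun n n' v => - X n n' v).
Proof.
move=> cX b k n n' v k0; rewrite (linear_oppE (linear_mode _ _ _)).
by rewrite cX // !opprD !scalerN.
Qed.

(** Positive modes lower the level, and no vector of positive level is killed by all
    of them.  Hence the values on a vacuum vanish by induction on their level, which
    starts at level 0; the creation operators transport this to the whole Fock
    space. *)
Lemma vacuum_principle alpha beta (X : int -> int -> fock -> fock)
    (c : momentum C -> int) :
  (forall n n', linear (X n n')) -> covariant alpha beta X ->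
  (forall n n' lam, exists lam', homog lam' (n + n' + c lam) (X n n' (vac lam))) ->
  (forall n n' lam, n + n' + c lam = 0 -> X n n' (vac lam) = 0) ->
  forall n n' v, X n n' v = 0.
Proof.
move=> lX bX hX zX.
have Xvac lam n n' : X n n' (vac lam) = 0.
  have [N] := ubnP (absz (n + n' + c lam)); elim: N => // N IH in n n' *.
  rewrite ltnS => hN; have [lam' h] := hX n n' lam.
  have [wneg|wpos|w0] := ltrgt0P (n + n' + c lam); last exact: zX.
    apply: (ann_all_zero h wneg) => b m.
    have X0 i i' :
        (absz (i + i' + c lam)%R < absz (n + n' + c lam)%R)%N \/ i + i' + c lam < 0 ->
        X i i' (vac lam) = 0.
      case=> lt; first by apply: IH; lia.
      by have [lam2 h2] := hX i i' lam; exact: homog_neg h2 lt.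
    by rewrite bX // mode_vac (linear_0E (lX _ _)) !X0 ?scaler0 ?addr0 //; lia.
  exact: homog_neg h wpos.
suff Xket n n' lam mu : X n n' (ket (lam, mu)) = 0.
  by move=> n n'; apply: (linear_eq_ket (lX n n') (@linear_zero_fun _ fock)) => -[].
elim/mset_ind: mu n n' => [|[b m] mu IH] n n'; first exact: Xvac.
rewrite -cre_ket -(mode_cre qpow).
have := bX b (Negz m) n n' (ket (lam, mu)) isT; rewrite !IH !scaler0 !addr0 => <-.
exact: linear_0E (linear_mode _ _ _).
Qed.

(** The coefficient of t^a in (1 - t)^{-k}; only k = -1, 0, 1 are meant. *)
Definition wick (k a : int) : C :=
  match a with
  | Posz 0 => 1
  | Posz 1 => k%:~R
  | Posz _ => (k == 1)%:R
  | Negz _ => 0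
  end.

Definition contraction (l : 'I_2) (e : int) (l' : 'I_2) (e' : int) : int :=
  if l == l' then - (e * e') else 0.

Lemma cminus_vac l e m lam : cminus l e m.+1 (vac lam) = 0.
Proof. by rewrite cminusE mode_vac scaler0. Qed.

(** Wick's theorem for two vertex operators: the annihilation part of one
    meets the creation part of the other through
    exp(contraction * sum_m t^m / m) = (1 - t)^{- contraction}. *)
Lemma exp_cminus_cplus_vac l e l' e' a lam :
  e = 1 \/ e = -1 -> e' = 1 \/ e' = -1 ->
  exp_coef (cminus l e) a (exp_coef (cplus l' e') a (vac lam)) =
  wick (contraction l e l' e') a *: vac lam.
Proof.
move=> he he'; set k := contraction l e l' e'.
(* both exponentials have degree a, so W a is a multiple of the vacuum, and Euler's
   identity gives a W_a = k (W_0 + ... + W_(a-1)) *)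
pose W a := exp_coef (cminus l e) a (exp_coef (cplus l' e') a (vac lam)).
have WS i : i.+1%:R *: W i.+1 = k%:~R *: \sum_(0 <= j < i.+1) W j.
  rewrite /W (exp_coef_euler C0 (linear_cminus qpow l e)
    (fun i j => cminus_comm qpow l e i l e j)).
  rewrite big_add1 /= [in RHS]big_nat_rev /= scaler_sumr.
  apply: eq_big_nat => j /andP[_ ji]; rewrite add0n subSS.
  rewrite (exp_coef_comm C0 (linear_cminus qpow l e) _ _ (linear_cminus qpow l e j.+1)
    (fun i u _ => cminus_comm qpow l e j.+1 l e i u)).
  rewrite (exp_coef_derivation C0 (linear_cplus qpow l' e') (m := j.+1)
    (kap := k%:~R / j.+1%:R) (y := cminus l e j.+1)) //; last 2 first.
  - exact: linear_cminus.
  - move=> r u r0; rewrite cminus_cplus // /k /contraction.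
    by case: (l == l'); rewrite ?mulrNz // mulr0z mul0r.
  rewrite cminus_vac (linear_0E (linear_cplus_exp _ l' e' _)) add0r ltnS.
  rewrite (_ : (j <= i)%N = true) // subSS (linear_scaleE (linear_cminus_exp _ l e _)).
  by rewrite scalerA mulrC divfK.
have W0 : W 0%N = vac lam by rewrite /W !exp_coef0.
have scI i u (w : fock) : i.+1%:R *: u = i.+1%:R *: w -> u = w.
  by move=> /(scalerI (C0 i)).
have hk : k = 1 \/ k = 0 \/ k = -1.
  rewrite /k /contraction; case: eqP => _; last by right; left.
  by case: he => ->; case: he' => ->; [right; right|left|left|right; right].
have W1 : W 1%N = k%:~R *: vac lam.
  by have := WS 0%N; rewrite scale1r big_nat1 W0.
have [k1|k1] := eqVneq k 1.
  have Wall i : W i = vac lam.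
    have [N] := ubnP i; elim: N => // N IH in i *; case: i => [//|i] iN.
    apply: (scI i); rewrite WS k1 scale1r.
    transitivity (\sum_(0 <= j < i.+1) vac lam).
      by apply: eq_big_nat => j /andP[_ ji]; apply: IH; lia.
    by rewrite sumr_const_nat subn0 scaler_nat.
  rewrite -/(W a) Wall k1 /wick.
  by case: a => [|[|a]]; rewrite ?scale1r.
have W2 i : W i.+2 = 0.
  elim/ltn_ind: i => i IH; apply: (scI i.+1); rewrite WS scaler0 big_ltn // big_ltn //.
  rewrite W0 W1 big_nat big1 ?addr0; last first.
    by case=> [//|[//|j]] ji; apply: IH; lia.
  by case: hk => [E|[->|->]]; rewrite ?E ?eqxx // in k1 *;
    rewrite ?scale0r // mulrN1z !scaleN1r subrr oppr0.
rewrite -/(W a) /wick; case: a => [|[|a]].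
- by rewrite W0 scale1r.
- by rewrite W1.
- by rewrite W2 (negbTE k1) scale0r.
Qed.

Lemma vertex_vac l e n lam : e = 1 \/ e = -1 ->
  vertex l e n (vac lam) =
  expz (cplus l e) (n - e * lam.2 l) (vac (shift l e lam)).
Proof.
move=> he; rewrite (vertexE qpow l n he (@homog_vac lam) (B := 1)) // big_nat1 addr0.
by rewrite exp_coef0 // /vac expQ_ket.
Qed.

(** The hypothesis says that the total level is 0: of the first exponential, all
    quanta are absorbed by the annihilation part of the second. *)
Lemma vertex2_vac l e n l' e' n' lam : e = 1 \/ e = -1 -> e' = 1 \/ e' = -1 ->
  n - e * (shift l' e' lam).2 l = - (n' - e' * lam.2 l') ->
  vertex l e n (vertex l' e' n' (vac lam)) =
  wick (contraction l e l' e') (n' - e' * lam.2 l') *: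
    vac (shift l e (shift l' e' lam)).
Proof.
move=> he he' hn; rewrite (vertex_vac l' n' lam he').
set a := n' - _ in hn *; case: a hn => a hn /=; last first.
  by rewrite scale0r; apply: linear_0E (linear_vertex qpow l n he).
have hu : homog (shift l' e' lam) a (exp_coef (cplus l' e') a (vac (shift l' e' lam))).
  rewrite -[a%:Z]add0r.
  exact: (@homog_cplus_expz _ _ l' e' a _ _ _ (@homog_vac (shift l' e' lam))).
rewrite (vertexE qpow l n he hu (B := a.+1)) ?ltz_nat // hn big_nat_recr //= addNr /=.
rewrite big_nat big1 ?add0r => [|r /andP[_ ra]]; last first.
  by case E: (_ + _) => //; lia.
rewrite exp_coef0 (@exp_cminus_cplus_vac l e l' e' a _ he he').
by rewrite (linear_scaleE (linear_expQ l e)) /vac expQ_ket.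
Qed.

End VertexRelations.

(** * Fermionic relations *)

Section FermionRelations.
Variables (C : fieldType) (qpow : C -> C).
Local Notation fock := (fock C).
Local Notation mode := (mode qpow).
Local Notation qint := (qint qpow).
Local Notation vertex := (vertex qpow).
Hypothesis C0 : forall n, n.+1%:R != 0 :> C.
Hypothesis q0 : forall m, qint m.+1%:R != 0.
Implicit Types (v : fock) (lam : momentum C).

Lemma shiftE l r lam i : (shift l r lam).2 i = lam.2 i + (if i == l then r else 0).
Proof. by rewrite ffunE; case: eqP => _; rewrite ?addr0. Qed.

Lemma shift_comm l r l' r' lam :
  shift l r (shift l' r' lam) = shift l' r' (shift l r lam).
Proof.
congr (_, _); apply/ffunP => i; rewrite !ffunE.
by case: (i == l); case: (i == l') => //; rewrite addrAC.
Qed.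

Lemma shiftK l r lam : shift l r (shift l (- r) lam) = lam.
Proof.
case: lam => la lc; congr (_, _); apply/ffunP => i; rewrite !ffunE /=.
by case: eqP => // _; rewrite subrK.
Qed.

Lemma homog_vertex2 l e n l' e' n' lam : e = 1 \/ e = -1 -> e' = 1 \/ e' = -1 ->
  homog (shift l e (shift l' e' lam))
    (n + n' - e * lam.2 l - e' * lam.2 l' - (if l == l' then e * e' else 0))
    (vertex l e n (vertex l' e' n' (vac lam))).
Proof.
move=> he he'.
have h := @homog_vertex _ _ l e n _ _ _ he
  (@homog_vertex _ qpow l' e' n' _ _ _ he' (@homog_vac _ lam)).
suff -> : n + n' - e * lam.2 l - e' * lam.2 l' - (if l == l' then e * e' else 0) =
  0 + (n' - e' * lam.2 l') + (n - e * (shift l' e' lam).2 l) by [].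
by rewrite shiftE; case: (l == l'); ring.
Qed.

Lemma linear_vertex2 l e n l' e' n' : e = 1 \/ e = -1 -> e' = 1 \/ e' = -1 ->
  linear (vertex l e n \o vertex l' e' n').
Proof. by move=> he he'; apply: linear_comp; apply: linear_vertex. Qed.

Lemma covariant_vertex2 l e l' e' : e = 1 \/ e = -1 -> e' = 1 \/ e' = -1 ->
  covariant qpow (fun b => mode_charge qpow b l e) (fun b => mode_charge qpow b l' e')
    (fun n n' v => vertex l e n (vertex l' e' n' v)).
Proof.
move=> he he' b k n n' v k0; rewrite !(mode_vertex C0 q0) //.
have lV := linear_vertex qpow l n he.
by rewrite (linear_addE lV) (linear_scaleE lV) addrAC.
Qed.

Lemma covariant_vertex2_swap l e l' e' : e = 1 \/ e = -1 -> e' = 1 \/ e' = -1 ->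
  covariant qpow (fun b => mode_charge qpow b l e) (fun b => mode_charge qpow b l' e')
    (fun n n' v => vertex l' e' n' (vertex l e n v)).
Proof.
by move=> he he' b k n n' v k0; rewrite (covariant_vertex2 l' l he' he) // addrAC.
Qed.

Lemma covariant_delta l e :
  covariant qpow (fun b => mode_charge qpow b l e) (fun b => mode_charge qpow b l (- e))
    (fun n n' v => (n + n' == -1)%:R *: v).
Proof.
move=> b k n n' v k0; rewrite (linear_scaleE (linear_mode _ _ _)) -addrA.
have -> : n - k + n' = n + n' - k by ring.
have -> : n + (n' - k) = n + n' - k by ring.
have -> : mode_charge qpow b l (- e) k = - mode_charge qpow b l e k.
  by rewrite /mode_charge mulrNz; case: eqP => _; rewrite ?oppr0 // !mulNr.
by rewrite scaleNr subrr addr0.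
Qed.

Lemma wick1 a : wick C 1 a = (0 <= a)%R%:R.
Proof. by case: a => [[|[|a]]|a]. Qed.

(** The fields :e^{c(z)}: and :e^{-c(z)}: are conjugate free fermions.  By the vacuum
    principle only level 0 has to be checked: there the two products contribute
    the coefficients of index a and b of 1 / (1 - t), where a + b = -1. *)
Lemma vertex_anticomm l e n n' v : e = 1 \/ e = -1 ->
  vertex l e n (vertex l (- e) n' v) + vertex l (- e) n' (vertex l e n v) =
  (n + n' == -1)%:R *: v.
Proof.
move=> he; have he' : - e = 1 \/ - e = -1 by case: he => ->; [right|left].
apply: subr0_eq; move: n n' v.
apply: (@vacuum_principle _ _ C0 q0 _ _ _ (fun=> 1)).
- move=> n n'; have h1 := linear_vertex2 l n l n' he he'.
  have h2 := linear_vertex2 l n' l n he' he.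
  exact: (linear_add_fun (linear_add_fun h1 h2)
    (linear_opp_fun (linear_scale_fun _ (@linear_id_fun _ fock)))).
- apply: covariantD; last exact/covariantN/covariant_delta.
  by apply: covariantD; [exact: covariant_vertex2 | exact: covariant_vertex2_swap].
- move=> n n' lam; exists lam.
  have e2 : e * e = 1 by case: he => ->.
  apply: homogD; [apply: homogD|].
  + have := @homog_vertex2 l e n l (- e) n' lam he he'.
    by rewrite shiftK eqxx; congr (homog _ _ _); lia.
  + have := @homog_vertex2 l (- e) n' l e n lam he' he.
    by rewrite shift_comm shiftK eqxx; congr (homog _ _ _); lia.
  + rewrite -scaleNr; case: eqP => [->|_]; last by rewrite oppr0 scale0r; exact: homog0.
    by apply: homogZ; exact: homog_vac.
- move=> n n' lam nn; have e2 : e * e = 1 by case: he => ->.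
  rewrite vertex2_vac //; last by rewrite shiftE eqxx; lia.
  rewrite vertex2_vac //; last by rewrite shiftE eqxx; lia.
  rewrite (shift_comm l (- e)) shiftK.
  have -> : contraction l e l (- e) = 1 by rewrite /contraction eqxx; lia.
  have -> : contraction l (- e) l e = 1 by rewrite /contraction eqxx; lia.
  rewrite mulNr opprK -scalerDl -scalerBl (_ : n + n' == -1); last by apply/eqP; lia.
  suff -> : wick C 1 (n' + e * lam.2 l) + wick C 1 (n - e * lam.2 l) = 1.
    by rewrite subrr scale0r.
  set a := n' + _; have -> : n - e * lam.2 l = - a - 1 by rewrite /a; lia.
  rewrite !wick1; have [a0|a0] := leP 0 a.
    by rewrite (_ : (0 <= _) = false) ?addr0 //; apply/negbTE; lia.
  by rewrite (_ : (0 <= _) = true) ?add0r //; lia.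
Qed.

(** Same argument, with the coefficients of index a and b of 1 - t, where
    a + b = 1. *)
Lemma vertex_anticomm_same l e n n' v : e = 1 \/ e = -1 ->
  vertex l e n (vertex l e n' v) + vertex l e n' (vertex l e n v) = 0.
Proof.
move=> he; move: n n' v.
apply: (@vacuum_principle _ _ C0 q0 _ _ _ (fun lam => - (e * lam.2 l) *+ 2 - 1)).
- by move=> n n'; apply: linear_add_fun; apply: linear_vertex2.
- by apply: covariantD; [exact: covariant_vertex2 | exact: covariant_vertex2_swap].
- move=> n n' lam; exists (shift l e (shift l e lam)).
  have e2 : e * e = 1 by case: he => ->.
  apply: homogD.
    have := @homog_vertex2 l e n l e n' lam he he.
    by rewrite eqxx; congr (homog _ _ _); lia.
  have := @homog_vertex2 l e n' l e n lam he he.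
  by rewrite eqxx; congr (homog _ _ _); lia.
- move=> n n' lam nn; have e2 : e * e = 1 by case: he => ->.
  rewrite vertex2_vac //; last by rewrite shiftE eqxx; lia.
  rewrite vertex2_vac //; last by rewrite shiftE eqxx; lia.
  rewrite /contraction eqxx e2 -scalerDl.
  suff -> : wick C (-1) (n' - e * lam.2 l) + wick C (-1) (n - e * lam.2 l) = 0.
    by rewrite scale0r.
  set a := n' - _; have -> : n - e * lam.2 l = 1 - a by rewrite /a; lia.
  case: a => [[|[|a]]|a].
  - by rewrite subr0 /= subrr.
  - by rewrite subrr /= addrC subrr.
  - by case E: (1 - _) => [k|k]; [lia | rewrite /= addr0].
  - by case E: (1 - _) => [[|[|k]]|k] /=; [lia | lia | rewrite addr0 | lia].
Qed.

(** Same argument without contraction, so that level 0 only involves the vacuum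
    terms. *)
Lemma vertex_comm l e l' e' n n' v : e = 1 \/ e = -1 -> e' = 1 \/ e' = -1 ->
  l != l' -> vertex l e n (vertex l' e' n' v) = vertex l' e' n' (vertex l e n v).
Proof.
move=> he he' ll; apply: subr0_eq; move: n n' v.
apply: (@vacuum_principle _ _ C0 q0 _ _ _ (fun lam => - (e * lam.2 l) - e' * lam.2 l')).
- move=> n n'; apply: linear_add_fun; first exact: linear_vertex2.
  by apply: linear_opp_fun; exact: linear_vertex2.
- apply: covariantD; first exact: covariant_vertex2.
  by apply: covariantN; exact: covariant_vertex2_swap.
- move=> n n' lam; exists (shift l e (shift l' e' lam)); apply: homogD.
    have := @homog_vertex2 l e n l' e' n' lam he he'.
    by rewrite (negbTE ll); congr (homog _ _ _); lia.
  rewrite -scaleN1r; apply: homogZ.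
  have := @homog_vertex2 l' e' n' l e n lam he' he.
  by rewrite eq_sym (negbTE ll) shift_comm; congr (homog _ _ _); lia.
- move=> n n' lam nn; have ll' := ll; rewrite eq_sym in ll'.
  rewrite vertex2_vac //; last by rewrite shiftE (negbTE ll); lia.
  rewrite vertex2_vac //; last by rewrite shiftE (negbTE ll'); lia.
  rewrite (shift_comm l') /contraction (negbTE ll) (negbTE ll') -scalerBl.
  set a := n' - _; have -> : n - e * lam.2 l = - a by rewrite /a; lia.
  suff -> : wick C 0 a = wick C 0 (- a) by rewrite subrr scale0r.
  by case: a => [[|[|a]]|[|a]].
Qed.

End FermionRelations.

(** * Zero modes, projectors and the conserved energy *)

Section ZeroModes.
Variables (C : fieldType) (qpow : C -> C).
Local Notation fock := (fock C).
Local Notation qint := (qint qpow).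
Hypothesis C0 : forall n, n.+1%:R != 0 :> C.
Hypothesis q0 : forall m, qint m.+1%:R != 0.
Implicit Types (v : fock) (lam : momentum C).

(** eta_0 for e = 1 and xi_0 for e = -1. *)
Definition zmode (l : 'I_2) (e : int) : fock -> fock :=
  vertex qpow l e (if e == 1 then -1 else 0).

(** eta_0 xi_0 for s = -1 and xi_0 eta_0 for s = 1. *)
Definition proj (l : 'I_2) (s : int) : fock -> fock := zmode l (- s) \o zmode l s.

Lemma signN (e : int) : e = 1 \/ e = -1 -> - e = 1 \/ - e = -1.
Proof. by case=> ->; [right|left]. Qed.

Lemma linear_zmode l e : e = 1 \/ e = -1 -> linear (zmode l e).
Proof. by move=> he; apply: linear_vertex. Qed.

Lemma linear_proj l s : s = 1 \/ s = -1 -> linear (proj l s).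
Proof.
by move=> hs; apply: linear_comp; apply: linear_zmode => //; exact: signN.
Qed.

Lemma zmode_anticomm l e v : e = 1 \/ e = -1 ->
  zmode l e (zmode l (- e) v) + zmode l (- e) (zmode l e v) = v.
Proof.
move=> he; rewrite /zmode (vertex_anticomm C0 q0) //.
rewrite (_ : _ == _ = true) ?scale1r //.
by case: he => ->.
Qed.

Lemma zmode_sqr l e v : e = 1 \/ e = -1 -> zmode l e (zmode l e v) = 0.
Proof.
move=> he; have := vertex_anticomm_same C0 q0 l _ _ v he.
move=> /(_ (if e == 1 then -1 else 0) (if e == 1 then -1 else 0)).
rewrite -/(zmode l e (zmode l e v)) => /eqP.
rewrite -mulr2n -scaler_nat scaler_eq0 => /orP[|/eqP//].
by rewrite (negbTE (C0 1)).
Qed.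

Lemma zmode_comm l e l' e' v : e = 1 \/ e = -1 -> e' = 1 \/ e' = -1 -> l != l' ->
  zmode l e (zmode l' e' v) = zmode l' e' (zmode l e v).
Proof. by move=> he he' ll; apply: (vertex_comm C0 q0). Qed.

(** From z_s z_s = 0 and z_s z_{-s} + z_{-s} z_s = 1. *)
Lemma proj_idem l s v : s = 1 \/ s = -1 -> proj l s (proj l s v) = proj l s v.
Proof.
move=> hs; rewrite /proj; set w := zmode l s v.
have := zmode_anticomm l w hs; rewrite [zmode l s w](zmode_sqr l v hs).
rewrite (linear_0E (linear_zmode l (signN hs))) addr0 => E.
exact: (congr1 (zmode l (- s)) E).
Qed.

Lemma proj_comm l s l' s' v : s = 1 \/ s = -1 -> s' = 1 \/ s' = -1 -> l != l' ->
  proj l s (proj l' s' v) = proj l' s' (proj l s v).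
Proof.
move=> hs hs' ll; have hn := signN hs; have hn' := signN hs'.
rewrite /proj /= (zmode_comm _ hs hn' ll) (zmode_comm _ hs hs' ll).
by rewrite (zmode_comm _ hn hn' ll) (zmode_comm _ hn hs' ll).
Qed.

Lemma zmode_proj_comm l e l' s v : e = 1 \/ e = -1 -> s = 1 \/ s = -1 -> l != l' ->
  zmode l e (proj l' s v) = proj l' s (zmode l e v).
Proof.
move=> he hs ll; have hn := signN hs.
by rewrite /proj /= (zmode_comm _ he hn ll) (zmode_comm _ he hs ll).
Qed.

(** The number r (r + 1) / 2, which is invariant under r |-> -1 - r. *)
Definition tri (r : int) : nat :=
  match r with Posz n => 'C(n.+1, 2) | Negz n => 'C(n.+1, 2) end.

Lemma tri_mul2 r : (tri r)%:Z * 2 = r * (r + 1).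
Proof.
have E n : ('C(n.+1, 2))%:Z * 2 = n%:Z * (n%:Z + 1).
  by rewrite bin2 /= -divn2 -PoszM divnK ?dvdn2 ?oddM /= ?andNb // PoszM; lia.
by case: r => n; rewrite /= E // NegzE; lia.
Qed.

Definition mtri lam : nat := (tri (lam.2 0%R) + tri (lam.2 1%R))%N.

Definition block lam (E : nat) := homog lam (E%:Z - (mtri lam)%:Z).

Lemma ord2P (l : 'I_2) : l = 0 \/ l = 1.
Proof. by case: l => [[|[|//]] ?]; [left|right]; apply: val_inj. Qed.

(** A zero mode changes the level by minus what c^l_0 (c^l_0 + 1) / 2 gains.  The
    conserved sum cuts each momentum space into finite blocks. *)
Lemma zmode_block l e lam E v : e = 1 \/ e = -1 -> block lam E v ->
  block (shift l e lam) E (zmode l e v).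
Proof.
move=> he hv; rewrite /block.
suff -> : E%:Z - (mtri (shift l e lam))%:Z =
  E%:Z - (mtri lam)%:Z + ((if e == 1 then -1 else 0) - e * lam.2 l).
  exact: homog_vertex.
rewrite /mtri !shiftE.
have h r : (tri (r + e))%:Z = (tri r)%:Z + (e * r - if e == 1 then -1 else 0).
  have := tri_mul2 (r + e); have := tri_mul2 r.
  by case: he => -> /=; lia.
by case: (ord2P l) => -> /=; rewrite addr0 !PoszD h; ring.
Qed.

Lemma proj_block l s lam E v : s = 1 \/ s = -1 -> block lam E v ->
  block lam E (proj l s v).
Proof.
move=> hs hv; rewrite -(shiftK l (- s) lam) opprK.
by apply/zmode_block/zmode_block => //; exact: signN.
Qed.

End ZeroModes.

(** * Finite sets of occupation numbers *)

Section Boxes.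

Definition mbox_dom N : {fset (osc * nat)} :=
  [fset (y.1, val y.2) | y in {: osc * 'I_N}]%fset.

(** Multisets on levels up to N with multiplicities below N, coded by functions:
    sums over them factor into products of geometric sums. *)
Definition mbox N (f : {ffun (osc * 'I_N) -> 'I_N}) : {mset (osc * nat)}%mset :=
  [fsfun x in mbox_dom N =>
     if insub x.2 is Some i then val (f (x.1, i)) else 0%N].

Lemma mboxE N (f : {ffun (osc * 'I_N) -> 'I_N}) x :
  mbox f x = if insub x.2 is Some i then val (f (x.1, i)) else 0%N.
Proof.
rewrite fsfunE; case: ifP => // /negbT xN.
case: insubP => // i _ ix; case/negP: xN.
by apply/imfsetP; exists (x.1, i) => //=; case: x ix => ? ? /= ->.
Qed.

Lemma mbox_inj N : injective (@mbox N).
Proof.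
move=> f g fg; apply/ffunP => -[b i]; apply/val_inj.
have : mbox f (b, val i) = mbox g (b, val i) by rewrite fg.
by rewrite !mboxE /= valK.
Qed.

Definition box N : {fset {mset (osc * nat)}%mset} :=
  [fset mbox f | f in {ffun (osc * 'I_N) -> 'I_N}]%fset.

Lemma in_box (mu : {mset (osc * nat)}%mset) N : (forall x, mu x < N)%N ->
  (forall x, mu x != 0%N -> x.2 < N)%N -> mu \in box N.
Proof.
move=> hb hx; apply/imfsetP.
exists [ffun y => Ordinal (hb (y.1, val y.2))] => //=.
apply/msetP => -[b m]; rewrite mboxE /=; case: insubP => [i _ /= im|mN].
  by rewrite ffunE /= im.
by apply/eqP; apply: contraNT mN => /hx.
Qed.

Lemma box_lvl mu N : (lvl mu < N)%N -> mu \in box N.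
Proof.
move=> muN; have hx x : (mu x * x.2.+1 < N)%N := leq_ltn_trans (lvl_ge x mu) muN.
apply: in_box => x; first by apply: leq_ltn_trans (hx x); rewrite leq_pmulr.
move=> mx; apply: leq_ltn_trans (hx x); rewrite (leq_trans (leqnSn _)) // leq_pmull //.
by rewrite lt0n.
Qed.

Lemma box_mono N : (box N `<=` box N.+1)%fset.
Proof.
apply/fsubsetP => _ /imfsetP[f _ ->]; apply: in_box => x; rewrite mboxE.
  by case: insubP => // i _ _; apply: leqW; exact: ltn_ord.
by case: insubP => // i xN _ _; rewrite ltnS ltnW.
Qed.

Lemma lvl_mbox N (f : {ffun (osc * 'I_N) -> 'I_N}) :
  lvl (mbox f) = (\sum_(y : osc * 'I_N) f y * y.2.+1)%N.
Proof.
rewrite (@lvlE (mbox_dom N)); last first.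
  by apply/fsubsetP => x; rewrite mem_finsupp /mbox fsfunE; case: ifP.
rewrite big_imfset /=; last by move=> [? ?] [? ?] _ _ /= [-> /val_inj ->].
rewrite big_enum /=; apply: eq_bigr => -[b i] _.
by rewrite mboxE /= valK.
Qed.

Definition layer n : {fset {mset (osc * nat)}%mset} :=
  [fset mu in box n.+1 | lvl mu == n]%fset.

Lemma in_layer n mu : (mu \in layer n) = (lvl mu == n).
Proof.
rewrite !inE /=; case: eqP => [E|_]; last by rewrite andbF.
by rewrite box_lvl // E.
Qed.

End Boxes.

(** * Finite blocks and traces *)

Section Traces.
Variable C : fieldType.
Local Notation fock := (fock C).
Implicit Types (v : fock) (lam : momentum C) (K : {fset fock_index C}) (f g : fock -> fock).

Definition blk lam (E : nat) : {fset fock_index C} :=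
  if (mtri lam <= E)%N then [fset (lam, mu) | mu in layer (E - mtri lam)]%fset
  else fset0.

Lemma in_blk lam E p : (p \in blk lam E) = (p.1 == lam) && (lvl p.2 + mtri lam == E)%N.
Proof.
rewrite /blk; case: leqP => hE; last first.
  by rewrite in_fset0; apply/esym/negbTE/nandP; right; apply/eqP; lia.
case: p => lam1 mu /=; apply/imfsetP/andP => /= [[nu] + [-> ->]|[/eqP -> /eqP hl]].
  by rewrite in_layer => /eqP ->; rewrite subnK.
by exists mu => //; rewrite in_layer -hl addnK.
Qed.

Lemma blockP lam E v : block lam E v <-> {subset fm_supp v <= blk lam E}.
Proof.
split=> h p pv; first by rewrite in_blk; have [-> ?] := h p pv; apply/andP; split => //; lia.
by have := h p pv; rewrite in_blk => /andP[/eqP -> /eqP <-]; split => //; lia.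
Qed.

Lemma block_ket lam E k : k \in blk lam E -> block lam E (ket k).
Proof.
move=> kK; apply/blockP => p; rewrite fm_suppE fm_coef_ket.
by have [->|_] := eqVneq p k; rewrite ?eqxx.
Qed.

Definition trace K f : C := \sum_(k <- K) fm_coef k (f (ket k)).

Definition maps_into K K' f :=
  forall k, k \in K -> {subset fm_supp (f (ket k)) <= K'}.

Lemma trace_comp K K' f g : linear f -> maps_into K K' g ->
  trace K (f \o g) =
  \sum_(k <- K) \sum_(k' <- K') fm_coef k' (g (ket k)) * fm_coef k (f (ket k')).
Proof.
move=> lf gK; apply: eq_big_seq => k kK /=.
rewrite {1}(fm_expand_in (gK k kK)) (linear_sumE lf) fm_coef_sum.
by apply: eq_bigr => k' _; rewrite (linear_scaleE lf) fm_coefZ.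
Qed.

(** Only the finite blocks that the two maps exchange matter, not the ambient
    infinite-dimensional space. *)
Lemma trace_cyclic K K' f g : linear f -> linear g ->
  maps_into K K' g -> maps_into K' K f -> trace K (f \o g) = trace K' (g \o f).
Proof.
move=> lf lg gK fK; rewrite (trace_comp lf gK) (trace_comp lg fK) exchange_big.
by apply: eq_bigr => k _; apply: eq_bigr => k' _; rewrite mulrC.
Qed.

Lemma eq_trace K f g : f =1 g -> trace K f = trace K g.
Proof. by move=> fg; apply: eq_bigr => k _; rewrite fg. Qed.

Lemma traceB K f g : trace K (fun v => f v - g v) = trace K f - trace K g.
Proof.
rewrite /trace -sumrB; apply: eq_bigr => k _.
by rewrite fm_coefD -scaleN1r fm_coefZ mulN1r.
Qed.

Lemma trace_id K : trace K id = #|` K|%:R.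
Proof.
rewrite /trace (eq_bigr (fun=> 1)); last by move=> k _; rewrite fm_coef_ket eqxx.
by rewrite big_const_seq count_predT iter_addr_0.
Qed.

End Traces.

(** * Images of idempotents *)

Section Ranks.

(** A full-rank factorization A = L R of an idempotent has R L = 1, so that
    tr (L R) = tr (R L) is the size of R L. *)
Lemma mxtrace_idem (F : fieldType) n (A : 'M[F]_n) :
  A *m A = A -> \tr A = (\rank A)%:R.
Proof.
move=> AA; have LR := mulmx_base A.
suff RL : row_base A *m col_base A = 1%:M.
  by rewrite -{1}LR mxtrace_mulC RL mxtrace1.
apply: (row_full_inj (col_base_full A)); apply: (row_free_inj (row_base_free A)).
rewrite /= mulmx1.
by rewrite LR (mulmxA (col_base A)) LR -(mulmxA A) LR AA.
Qed.

Variable C : fieldType.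
Local Notation fock := (fock C).
Implicit Types (v : fock) (K : {fset fock_index C}) (P : fock -> fock).

Lemma fm_supp_sum K I (r : seq I) (Q : pred I) (F : I -> fock) :
  (forall i, Q i -> {subset fm_supp (F i) <= K}) ->
  {subset fm_supp (\sum_(i <- r | Q i) F i) <= K}.
Proof.
move=> hF p; rewrite fm_suppE fm_coef_sum; apply: contraR => pK.
rewrite big1 // => i Qi; apply: fm_coef_out; apply: contra pK; exact: hF.
Qed.

Lemma fm_supp_scale K a v : {subset fm_supp v <= K} -> {subset fm_supp (a *: v) <= K}.
Proof.
move=> hv p; rewrite fm_suppE fm_coefZ mulf_eq0 negb_or => /andP[_].
by rewrite -fm_suppE; exact: hv.
Qed.

Lemma fm_supp_ket K k : k \in K -> {subset fm_supp (ket k : fock) <= K}.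
Proof.
by move=> kK p; rewrite fm_suppE fm_coef_ket; have [->|_] := eqVneq p k; rewrite ?eqxx.
Qed.

(** The basis consists of the rows of R in a full-rank factorization A = L R of the
    matrix A of P; by [mxtrace_idem] their number is the trace. *)
Lemma idem_basis K P : linear P -> (forall v, P (P v) = P v) -> maps_into K K P ->
  exists r (b : 'I_r -> fock),
    [/\ trace K P = r%:R /\ (r <= #|` K|)%N,
        forall i, {subset fm_supp (b i) <= K},
        forall i, P (b i) = b i,
        forall c : 'I_r -> C, \sum_i c i *: b i = 0 -> forall i, c i = 0
      & forall k, k \in K -> exists c : 'I_r -> C, P (ket k) = \sum_i c i *: b i].
Proof.
move=> lP PP PK; pose n := #|{: K}|.
pose kk (x : 'I_n) : fock_index C := val (enum_val x).
have kkK x : kk x \in K by exact: valP.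
have kk_inj : injective kk by move=> x y /val_inj/enum_val_inj.
have kk_onto k : k \in K -> exists x, k = kk x.
  by move=> kK; exists (enum_rank [` kK]%fset); rewrite /kk enum_rankK.
have sumK (V : nmodType) (F : fock_index C -> V) : \sum_(k <- K) F k = \sum_x F (kk x).
  rewrite big_seq_fsetE /= (reindex (@enum_val _ (mem {: K}))) //=.
  by apply: onW_bij; exact: enum_val_bij.
have coef_kk x y : fm_coef (kk x) (ket (kk y)) = (x == y)%:R :> C.
  by rewrite fm_coef_ket (inj_eq kk_inj).
pose A : 'M[C]_n := \matrix_(x, y) fm_coef (kk y) (P (ket (kk x))).
have PA x : P (ket (kk x)) = \sum_y A x y *: ket (kk y).
  rewrite {1}(fm_expand_in (PK (kk x) (kkK x))) sumK.
  by apply: eq_bigr => y _; rewrite mxE.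
pose vec (u : 'rV[C]_n) : fock := \sum_y u ord0 y *: ket (kk y).
have Pvec u : P (vec u) = vec (u *m A).
  rewrite /vec (linear_sumE lP).
  under eq_bigr => y _ do rewrite (linear_scaleE lP) PA scaler_sumr.
  rewrite exchange_big; apply: eq_bigr => y _ /=.
  by rewrite mxE scaler_suml; apply: eq_bigr => z _; rewrite scalerA.
have coef_vec u x : fm_coef (kk x) (vec u) = u ord0 x.
  rewrite /vec fm_coef_sum (bigD1 x) //= fm_coefZ coef_kk eqxx mulr1 big1 ?addr0 //.
  by move=> y yx; rewrite fm_coefZ coef_kk eq_sym (negbTE yx) mulr0.
have vec_inj : injective vec.
  by move=> u w uw; apply/rowP => x; rewrite -!coef_vec uw.
have vecE x : ket (kk x) = vec (delta_mx ord0 x).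
  rewrite /vec (bigD1 x) //= mxE !eqxx scale1r big1 ?addr0 // => y yx.
  by rewrite mxE (negbTE yx) andbF scale0r.
have vec_sum I (r : seq I) (c : I -> C) (u : I -> 'rV[C]_n) :
    \sum_(i <- r) c i *: vec (u i) = vec (\sum_(i <- r) c i *: u i).
  rewrite /vec; under eq_bigr => i _ do rewrite scaler_sumr.
  rewrite exchange_big; apply: eq_bigr => y _ /=.
  rewrite summxE scaler_suml; apply: eq_bigr => i _.
  by rewrite mxE scalerA.
have AA : A *m A = A.
  apply/row_matrixP => x; rewrite row_mul !rowE; apply: vec_inj.
  by rewrite -!Pvec PP.
exists (\rank A), (fun i => vec (row i (row_base A))).
have LR := mulmx_base A.
split.
- split; last by rewrite (leq_trans (rank_leq_row A)) // /n cardfE.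
  rewrite -mxtrace_idem // /trace sumK /mxtrace.
  by apply: eq_bigr => x _; rewrite mxE.
- move=> i; rewrite /vec; apply: fm_supp_sum => y _.
  by apply/fm_supp_scale/fm_supp_ket.
- move=> i; rewrite Pvec -row_mul; congr (vec (row i _)).
  apply: (row_full_inj (col_base_full A)).
  by rewrite (mulmxA (col_base A)) LR AA.
- move=> c; rewrite vec_sum => c0 i.
  have {}c0 : \sum_i c i *: row i (row_base A) = 0.
    apply: vec_inj; rewrite c0 /vec big1 // => y _; by rewrite mxE scale0r.
  have : (\row_i c i) *m row_base A = 0.
    by rewrite mulmx_sum_row -[RHS]c0; apply: eq_bigr => j _; rewrite mxE.
  rewrite -(mul0mx _ (row_base A)) => /(row_free_inj (row_base_free A)) /rowP /(_ i).
  by rewrite !mxE.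
- move=> k /kk_onto[x ->]; exists (fun i => col_base A x i).
  rewrite vec_sum vecE Pvec; congr vec.
  rewrite -rowE -{1}LR row_mul mulmx_sum_row.
  by apply: eq_bigr => i _; rewrite mxE.
Qed.

End Ranks.

(** * The four modules *)

Section Modules.
Variables (C : fieldType) (qpow : C -> C).
Local Notation fock := (fock C).
Local Notation qint := (qint qpow).
Local Notation zmode := (zmode qpow).
Local Notation proj := (proj qpow).
Hypothesis C0 : forall n, n.+1%:R != 0 :> C.
Hypothesis q0 : forall m, qint m.+1%:R != 0.
Implicit Types (v : fock) (lam : momentum C).

Lemma zmode_maps_into l e lam E : e = 1 \/ e = -1 ->
  maps_into (blk lam E) (blk (shift l e lam) E) (zmode l e).
Proof. by move=> he k /block_ket hk; apply/blockP/zmode_block. Qed.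

(** The one place where the dimensions are computed: moving z_{-s} around the trace
    leads to the block of shifted momentum, where z_s z_{-s} = 1 - z_{-s} z_s. *)
Lemma trace_proj_rec l s lam E (f : fock -> fock) : s = 1 \/ s = -1 -> linear f ->
  (forall mom v, block mom E v -> block mom E (f v)) ->
  (forall v, zmode l (- s) (f v) = f (zmode l (- s) v)) ->
  trace (blk lam E) (proj l s \o f) =
  trace (blk (shift l s lam) E) f - trace (blk (shift l s lam) E) (proj l s \o f).
Proof.
move=> hs lf fE fz; have hn := signN hs.
have zs := linear_zmode qpow l hs; have zn := linear_zmode qpow l hn.
rewrite -traceB; transitivity (trace (blk lam E) (zmode l (- s) \o (zmode l s \o f))).
  exact: eq_trace.
rewrite (@trace_cyclic _ _ (blk (shift l s lam) E)) //.
- apply: eq_trace => v.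
  have -> : (proj l s \o f) v = zmode l (- s) (zmode l s (f v)) by [].
  rewrite [LHS]/= -fz.
  by rewrite -[X in X - _](zmode_anticomm C0 q0 l (f v) hs) addrK.
- exact: linear_comp.
- by move=> k /block_ket hk; apply/blockP/zmode_block/fE.
- have E0 : shift l (- s) (shift l s lam) = lam by rewrite -{2}[s]opprK shiftK.
  by rewrite -{2}E0; exact: zmode_maps_into.
Qed.

Section Basis.
Variables (beta : C) (s1 s2 : int).
Hypotheses (hs1 : s1 = 1 \/ s1 = -1) (hs2 : s2 = 1 \/ s2 = -1).

Definition proj2 : fock -> fock := proj 0 s1 \o proj 1 s2.

Lemma linear_proj2 : linear proj2.
Proof. by apply: linear_comp; apply: linear_proj. Qed.

Lemma proj2_idem v : proj2 (proj2 v) = proj2 v.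
Proof.
rewrite /proj2 /=; set w := proj 1 s2 v.
have E1 : proj 1 s2 (proj 0 s1 w) = proj 0 s1 (proj 1 s2 w).
  exact: esym (@proj_comm _ _ C0 q0 0 s1 1 s2 w hs1 hs2 isT).
have E2 : proj 1 s2 w = w := @proj_idem _ _ C0 q0 1 s2 v hs2.
have E3 : proj 0 s1 (proj 0 s1 w) = proj 0 s1 w := @proj_idem _ _ C0 q0 0 s1 w hs1.
have E4 := etrans E1 (congr1 (proj 0 s1) E2).
have E5 := etrans (congr1 (proj 0 s1) E4) E3.
exact E5.
Qed.

Lemma proj2_block lam E v : block lam E v -> block lam E (proj2 v).
Proof. move=> hv.
exact: (@proj_block _ qpow 0 s1 lam E _ hs1 (@proj_block _ qpow 1 s2 lam E v hs2 hv)). Qed.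

Lemma Msub_proj2 : Msub qpow beta s1 s2 = proj2 @` Fspace beta.
Proof. by rewrite /proj2; case: hs1 => ->; case: hs2 => ->. Qed.

Lemma intr0 (n : int) : (n%:~R == 0 :> C) = (n == 0).
Proof.
case: n => [[|n]|n]; first by rewrite mulr0z !eqxx.
  by rewrite -pmulrn (negbTE (C0 n)).
by rewrite NegzE mulrNz oppr_eq0 -pmulrn (negbTE (C0 n)).
Qed.

Definition momt (B : int * int * int) : momentum C := mom beta B.1.1 B.1.2 B.2.

Lemma momt_inj : injective momt.
Proof.
move=> [[i j] k] [[i' j'] k'] [/ffunP Ea /ffunP Ec].
have := Ec 0; have := Ec 1; rewrite !ffunE /= => -> ij.
have := Ea 0; rewrite !ffunE /= => /addrI /eqP.
rewrite -subr_eq0 -mulrzBr intr0 subr_eq0 => /eqP ii.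
by rewrite -ii in ij *; congr (_, _, _); lia.
Qed.

Lemma Fspace_blk B E v : {subset fm_supp v <= blk (momt B) E} -> Fspace beta v.
Proof.
case: B => [[i j] k] hv p /hv; rewrite in_blk => /andP[/eqP -> _].
by exists i, j, k.
Qed.

(** The projector preserves the blocks of given momentum and conserved energy, so
    its image has a basis adapted to them, and in each block the trace of the
    projector counts the basis vectors. *)
Lemma Msub_basis : exists (r : (int * int * int) * nat -> nat)
    (b : {B : (int * int * int) * nat & 'I_(r B)} -> fock),
  [/\ forall B, trace (blk (momt B.1) B.2) proj2 = (r B)%:R,
      forall B, (r B <= #|` blk (momt B.1) B.2|)%N,
      forall t, {subset fm_supp (b t) <= blk (momt (tag t).1) (tag t).2}
    & is_basis (Msub qpow beta s1 s2) b].
Proof.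
have H (B : (int * int * int) * nat) := idem_basis linear_proj2 proj2_idem
  (fun k kK => (blockP _ _ _).1 (proj2_block (@block_ket _ (momt B.1) B.2 k kK))).
have [r {}H] := choice H.
pose b (t : {B : (int * int * int) * nat & 'I_(r B)}) : fock :=
  projT1 (cid (H (tag t))) (tagged t).
have bP t : {subset fm_supp (b t) <= blk (momt (tag t).1) (tag t).2} /\ proj2 (b t) = b t.
  by rewrite /b; case: cid => /= ? [_ ? ? _ _].
have bfree B (c : 'I_(r B) -> C) :
    \sum_i c i *: b (Tagged (fun B => 'I_(r B)) i) = 0 -> forall i, c i = 0.
  by rewrite /b /=; case: cid => /= ? [_ _ _ + _]; apply.
have bspan B k : k \in blk (momt B.1) B.2 ->
    exists c : 'I_(r B) -> C, proj2 (ket k) = \sum_i c i *: b (Tagged (fun B => 'I_(r B)) i).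
  by rewrite /b /=; case: cid => /= ? [_ _ _ _]; apply.
exists r, b; split=> [B|B|t|].
- by have [b' [[]]] := H B.
- by have [b' [[]]] := H B.
- by have [] := bP t.
pose span (v : fock) := exists (A : {fset {B : (int * int * int) * nat & 'I_(r B)}}) c,
  v = \sum_(t <- A) c t *: b t.
have span0 : span 0 by exists fset0, (fun=> 0); rewrite big_seq_fset0.
have spanZ a v : span v -> span (a *: v).
  case=> A [c ->]; exists A, (fun t => a * c t); rewrite scaler_sumr.
  by apply: eq_bigr => t _; rewrite scalerA.
have spanb t : span (b t).
  by exists [fset t]%fset, (fun=> 1); rewrite big_seq_fset1 scale1r.
have ext (A A' : {fset {B : (int * int * int) * nat & 'I_(r B)}}) (c : _ -> C) :
    (A `<=` A')%fset ->
    \sum_(t <- A) c t *: b t = \sum_(t <- A') (if t \in A then c t else 0) *: b t.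
  move=> AA'; rewrite -(big_fset_incl _ AA') => [|t _ /negbTE ->]; last exact: scale0r.
  by apply: eq_big_seq => t /= ->.
have spanD u v : span u -> span v -> span (u + v).
  case=> A [c ->] [A' [c' ->]]; exists (A `|` A')%fset.
  exists (fun t => (if t \in A then c t else 0) + (if t \in A' then c' t else 0)).
  rewrite (ext _ _ c (fsubsetUl A A')) (ext _ _ c' (fsubsetUr A A')) -big_split /=.
  by apply: eq_bigr => t _; rewrite scalerDl.
have spansum (I : eqType) (s : seq I) (F : I -> fock) :
    {in s, forall i, span (F i)} -> span (\sum_(i <- s) F i).
  by move=> hF; rewrite big_seq; elim/big_rec: _ => // i u /hF; exact: spanD.
split=> [v|A c c0 [B i] iA].
  rewrite Msub_proj2; split=> [[w hw <-]|[A [c ->]]].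
    rewrite (fm_expand w) (linear_sumE linear_proj2); apply: (spansum) => p pw.
    rewrite (linear_scaleE linear_proj2); apply: (spanZ).
    have [i [j [k pE]]] := hw p pw; rewrite -/(ket p).
    have [|c ->] := bspan (i, j, k, (lvl p.2 + mtri p.1)%N) p.
      by rewrite in_blk pE !eqxx.
    by apply: (spansum) => s _; apply: spanZ; exact: spanb.
  exists (\sum_(t <- A) c t *: b t).
    move=> p; rewrite fm_suppE fm_coef_sum => /eqP.
    apply: contra_notP => hp; rewrite big1 // => t _; rewrite fm_coefZ.
    have [pt|/fm_coef_out -> //] := boolP (p \in fm_supp (b t)); last by rewrite mulr0.
    by case: hp; exact: (Fspace_blk (bP t).1).
  rewrite (linear_sumE linear_proj2); apply: eq_bigr => t _.
  by rewrite (linear_scaleE linear_proj2) (bP t).2.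
pose d (s : 'I_(r B)) : C :=
  if Tagged (fun B => 'I_(r B)) s \in A then c (Tagged (fun B => 'I_(r B)) s) else 0.
suff /bfree/(_ i) : \sum_s d s *: b (Tagged (fun B => 'I_(r B)) s) = 0 by rewrite /d iA.
pose A0 : {fset {B : (int * int * int) * nat & 'I_(r B)}} :=
  [fset Tagged (fun B => 'I_(r B)) s | s in 'I_(r B)]%fset.
have A0P t : tag t = B -> t \in A0.
  case: t => B' s /= E; move: s; rewrite E => s.
  by apply/imfsetP; exists s.
apply: fm_eqP => k; rewrite fm_coef0.
have [kB|kB] := boolP (k \in blk (momt B.1) B.2); last first.
  rewrite fm_coef_sum big1 // => s _; rewrite fm_coefZ fm_coef_out ?mulr0 //.
  by apply: contra kB; exact: ((bP (Tagged (fun B => 'I_(r B)) s)).1).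
have := congr1 (fm_coef k) c0; rewrite fm_coef0 => <-.
have -> : \sum_s d s *: b (Tagged (fun B => 'I_(r B)) s) =
    \sum_(t <- A0) (if t \in A then c t else 0) *: b t.
  rewrite big_imfset /=; last by move=> s s' _ _ /eqP; rewrite eq_Tagged /= => /eqP.
  by rewrite big_enum.
rewrite !fm_coef_sum.
pose F t := if (t \in A) && (t \in A0) then c t * fm_coef k (b t) else 0.
have F1 : \sum_(t <- A0) F t = \sum_(t <- (A `|` A0)%fset) F t.
  apply: big_fset_incl; first exact: fsubsetUr.
  by move=> t _ /negbTE tA; rewrite /F tA andbF.
have F2 : \sum_(t <- A) F t = \sum_(t <- (A `|` A0)%fset) F t.
  apply: big_fset_incl; first exact: fsubsetUl.
  by move=> t _ /negbTE tA; rewrite /F tA.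
transitivity (\sum_(t <- A0) F t).
  apply: eq_big_seq => t /= tA; rewrite /F tA andbT fm_coefZ.
  by case: ifP => // _; rewrite mul0r.
rewrite F1 -F2.
apply: eq_big_seq => t /= tA; rewrite /F tA fm_coefZ /=.
case: ifP => // /negP tA0; rewrite fm_coef_out ?mulr0 //.
apply/negP => /(bP t).1 kt; apply: tA0.
apply: A0P.
move: kt kB; rewrite !in_blk => /andP[/eqP k1 /eqP k2] /andP[/eqP k1' /eqP k2'].
have E1 : (tag t).1 = B.1 by apply: momt_inj; rewrite -k1 -k1'.
have E2 : (tag t).2 = B.2 by rewrite -k2 -k2' E1.
by move: E1 E2; case: (tag t) => ? ? /= -> ->; case: (B).
Qed.

End Basis.

End Modules.

(** * Eigenvalues of the Cartan elements and of the derivation *)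

Section Cartan.
Variable C : fieldType.
Hypothesis C0 : forall n, n.+1%:R != 0 :> C.

Lemma invmx_eq (F : fieldType) n (A B : 'M[F]_n) : A *m B = 1%:M -> invmx A = B.
Proof.
move=> AB; have [uA _] := mulmx1_unit AB.
by rewrite -[invmx A]mulmx1 -AB mulKmx.
Qed.

Definition icartan4 : seq (seq int) :=
  [:: [:: 2;  2;  0; 1];
      [:: 2;  0; -2; 0];
      [:: 0; -2; -2; 1];
      [:: 1;  0;  1; 0]].

Lemma icartanE (i j : 'I_4) :
  icartan C i j = (nth 0 (nth [::] icartan4 i) j)%:~R / 4.
Proof.
have n4 : 4 != 0 :> C by exact: (C0 3).
rewrite /icartan.
rewrite (_ : invmx _ = \matrix_(i, j) ((nth 0 (nth [::] icartan4 i) j)%:~R / 4)) ?mxE //.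
apply: invmx_eq; apply/matrixP => {}i {}j; rewrite !mxE.
under eq_bigr => k _ do rewrite !mxE mulrA -intrM.
rewrite -mulr_suml -rmorph_sum /=; apply: (canLR (mulfK n4)).
have -> : (i == j)%:R * 4 = ((i == j)%:R * 4 : int)%:~R :> C.
  by rewrite intrM; case: (i == j).
congr _%:~R.
rewrite !big_ord_recr big_ord0 /=.
by case: i j => [[|[|[|[|//]]]] ?] [[|[|[|[|//]]]] ?].
Qed.

End Cartan.

Section Eigenvalues.
Variables (C : fieldType) (qpow : C -> C).
Local Notation fock := (fock C).
Local Notation qint := (qint qpow).
Local Notation mode := (mode qpow).
Local Notation q2 := (q2 qpow).
Local Notation Aop := (Aop qpow).
Local Notation Astar := (Astar qpow).
Local Notation aop := (aop qpow).
Local Notation cop := (cop qpow).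
Hypothesis C0 : forall n, n.+1%:R != 0 :> C.
Hypothesis q0 : forall m, qint m.+1%:R != 0.
Hypothesis qpow0 : qpow 0 = 1.
Hypothesis q2_neq0 : forall m, q2 m.+1%:Z != 0.
Implicit Types (v : fock) (lam : momentum C).

Let o0 : 'I_4 := inord 0.
Let o1 : 'I_4 := inord 1.
Let o2 : 'I_4 := inord 2.
Let o3 : 'I_4 := inord 3.

Lemma ord4E : (forall i : 'I_4, [\/ i = o0, i = o1, i = o2 | i = o3]).
Proof.
move=> i; case: i => [[|[|[|[|//]]]] hi];
  [constructor 1|constructor 2|constructor 3|constructor 4];
  by apply: val_inj; rewrite /= inordK.
Qed.

Lemma sum_ord4 (V : nmodType) (F : 'I_4 -> V) :
  \sum_(i < 4) F i = F o0 + F o1 + F o2 + F o3.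
Proof.
rewrite !big_ord_recr big_ord0 /= add0r.
by congr (F _ + F _ + F _ + F _); apply: val_inj; rewrite /= inordK.
Qed.

Lemma sum_ord4_3 (V : nmodType) (F : 'I_4 -> V) :
  \sum_(i < 4 | (i < 3)%N) F i = F o0 + F o1 + F o2.
Proof. by rewrite big_mkcond sum_ord4 /= !inordK //= addr0. Qed.

Lemma linear_aop j n : linear (aop j n).
Proof. exact: linear_mode. Qed.

Lemma linear_comb4 (V : lmodType C) (f : V -> V) c0 c1 c2 c3 x0 x1 x2 x3 :
  linear f -> f (c0 *: x0 + c1 *: x1 + c2 *: x2 + c3 *: x3) =
  c0 *: f x0 + c1 *: f x1 + c2 *: f x2 + c3 *: f x3.
Proof. by move=> lf; rewrite !(linear_addE lf) !(linear_scaleE lf). Qed.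

Lemma alternating4 (V : lmodType C) (a b c d : V) :
  (-1) ^+ 0 *: a + (-1) ^+ 1 *: b + (-1) ^+ 2 *: c + (-1) ^+ 3 *: d = a - b + c - d.
Proof.
have e2 : (-1) ^+ 2 = 1 :> C by rewrite sqrrN expr1n.
have e3 : (-1) ^+ 3 = -1 :> C by rewrite exprS e2 mulr1.
by rewrite e2 e3 expr0 expr1 !scale1r !scaleN1r.
Qed.

Lemma Aop0E n v : Aop o0 n v = aop o0 n v + aop o1 n v.
Proof. by rewrite /Defs.Aop inordK //= scale1r. Qed.

Lemma Aop1E n v : Aop o1 n v = - (aop o1 n v + aop o2 n v).
Proof. by rewrite /Defs.Aop inordK //= scaleN1r. Qed.

Lemma Aop2E n v : Aop o2 n v = aop o2 n v + aop o3 n v.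
Proof. by rewrite /Defs.Aop inordK //= (sqrrN 1) expr1n scale1r. Qed.

Lemma Aop3E n v : Aop o3 n v =
  (q2 n / 2) *: (aop o0 n v - aop o1 n v + aop o2 n v - aop o3 n v).
Proof.
rewrite /Defs.Aop inordK //= sum_ord4 !inordK //=; congr (_ *: _).
exact: alternating4.
Qed.

Lemma fm_coefN k v : fm_coef k (- v) = - fm_coef k v.
Proof. by rewrite -scaleN1r fm_coefZ mulN1r. Qed.

Lemma q2N n : q2 (- n) = q2 n.
Proof. by rewrite /Defs.q2 !mulrNz opprK addrC. Qed.

(** Up to the q-deformed normalization of A^4, the A^{*i} are dual to the A^i for
    the bracket of the a^j, so both sides are its inverse quadratic form, written
    in two bases. *)
Lemma casimir m v :
  \sum_(i < 4 | (i < 3)%N) Aop i (- m.+1%:Z) (Astar i m.+1%:Z v)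
    + (2 * q2 m.+1%:Z)^-1 *: Aop ord_max (- m.+1%:Z) (Astar ord_max m.+1%:Z v)
  = \sum_(j < 4) (-1) ^+ j *: aop j (- m.+1%:Z) (aop j m.+1%:Z v).
Proof.
have n2 : 2 != 0 :> C by exact: (C0 1).
have n4 : 4 != 0 :> C by exact: (C0 3).
have omax : ord_max = o3 by apply: val_inj; rewrite /= inordK.
pose X j := aop j m.+1%:Z v.
pose w (c0 c1 c2 c3 : C) := c0 *: X o0 + c1 *: X o1 + c2 *: X o2 + c3 *: X o3.
have qn := q2_neq0 m.
(* the vectors w are the rows of the inverse Cartan matrix in the basis a^j *)
have W0 : Astar o0 m.+1%:Z v = w (3 / 4) (- 1 / 4) (- 1 / 4) (- 1 / 4).
  rewrite /Defs.Astar omax inordK //= sum_ord4_3 !icartanE // !inordK //=.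
  rewrite Aop0E Aop1E Aop2E Aop3E /w.
  rewrite -/(X o0) -/(X o1) -/(X o2) -/(X o3).
  move: (X o0) (X o1) (X o2) (X o3) (q2 _) qn => x0 x1 x2 x3 Q qn.
  apply: fm_eqP => p; rewrite !(fm_coefD, fm_coefZ, fm_coefN).
  by field; rewrite ?n2 ?n4 ?qn.
have W1 : Astar o1 m.+1%:Z v = w (1 / 2) (1 / 2) (- 1 / 2) (- 1 / 2).
  rewrite /Defs.Astar omax inordK //= sum_ord4_3 !icartanE // !inordK //=.
  rewrite Aop0E Aop1E Aop2E Aop3E /w.
  rewrite -/(X o0) -/(X o1) -/(X o2) -/(X o3).
  move: (X o0) (X o1) (X o2) (X o3) (q2 _) qn => x0 x1 x2 x3 Q qn.
  apply: fm_eqP => p; rewrite !(fm_coefD, fm_coefZ, fm_coefN).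
  by field; rewrite ?n2 ?n4 ?qn.
have W2 : Astar o2 m.+1%:Z v = w (1 / 4) (1 / 4) (1 / 4) (- 3 / 4).
  rewrite /Defs.Astar omax inordK //= sum_ord4_3 !icartanE // !inordK //=.
  rewrite Aop0E Aop1E Aop2E Aop3E /w.
  rewrite -/(X o0) -/(X o1) -/(X o2) -/(X o3).
  move: (X o0) (X o1) (X o2) (X o3) (q2 _) qn => x0 x1 x2 x3 Q qn.
  apply: fm_eqP => p; rewrite !(fm_coefD, fm_coefZ, fm_coefN).
  by field; rewrite ?n2 ?n4 ?qn.
have W3 : Astar o3 m.+1%:Z v = w 1 1 1 1.
  rewrite /Defs.Astar omax inordK //= sum_ord4 !icartanE // !inordK //=.
  rewrite Aop0E Aop1E Aop2E Aop3E /w.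
  rewrite -/(X o0) -/(X o1) -/(X o2) -/(X o3).
  move: (X o0) (X o1) (X o2) (X o3) (q2 _) qn => x0 x1 x2 x3 Q qn.
  apply: fm_eqP => p; rewrite !(fm_coefD, fm_coefZ, fm_coefN).
  by field; rewrite ?n2 ?n4 ?qn.
rewrite omax sum_ord4_3 sum_ord4 W0 W1 W2 W3 Aop0E Aop1E Aop2E Aop3E q2N !inordK //=.
rewrite -/(X o0) -/(X o1) -/(X o2) -/(X o3).
have [Y YE] : exists Y, forall i j, aop i (- m.+1%:Z) (X j) = Y i j.
  by exists (fun i j => aop i (- m.+1%:Z) (X j)).
have wE j c0 c1 c2 c3 : aop j (- m.+1%:Z) (w c0 c1 c2 c3) =
    c0 *: Y j o0 + c1 *: Y j o1 + c2 *: Y j o2 + c3 *: Y j o3.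
  by rewrite -!YE; apply: linear_comb4; exact: linear_aop.
rewrite !wE !YE alternating4; move: (q2 _) qn => Q qn.
apply: fm_eqP => p; rewrite !(fm_coefD, fm_coefZ, fm_coefN).
by field; rewrite ?n2 ?n4 ?qn.
Qed.

Lemma mode0_homog b lam w v : homog lam w v -> mode b 0 v = zero_mode lam b *: v.
Proof.
move=> hv; rewrite {1}(fm_expand v) (linear_sumE (linear_mode _ b 0)).
rewrite [in RHS](fm_expand v) scaler_sumr big_seq [RHS]big_seq.
apply: eq_bigr => -[lam1 mu] /hv[/= -> _].
rewrite (linear_scaleE (linear_mode _ b 0)) -/(ket (lam, mu)) mode_zero.
by rewrite !scalerA mulrC.
Qed.

(** b_{-m} b_m counts the quanta of level m, up to the bracket [b_m, b_{-m}]. *)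
Lemma mode_number_ket b m lam mu :
  (m.+1%:R ^+ 2 / qint m.+1%:R ^+ 2) *:
    (osc_sign C b *: mode b (- m.+1%:Z) (mode b m.+1%:Z (ket (lam, mu)))) =
  (m.+1 * mu (b, m))%:R *: ket (lam, mu).
Proof.
have s2 : osc_sign C b * osc_sign C b = 1.
  by case: b => j /=; rewrite ?mulr1 // -expr2 sqrr_sign.
have -> : - m.+1%:Z = Negz m by rewrite NegzE.
rewrite mode_ann mode_cre ann_ket !(linear_scaleE (linear_cre _)) cre_ket !scalerA.
have [->|mx] := eqVneq (mu (b, m)) 0%N; first by rewrite muln0 mulr0n !mulr0 !scale0r.
rewrite msetB1K -?mset_neq0 // natrM; congr (_ *: _).
move: (qint m.+1%:R) (q0 m) => Q Q0; move: (m.+1%:R) (C0 m) => M M0.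
transitivity (osc_sign C b * osc_sign C b * (M * (mu (b, m))%:R)); last by rewrite s2 mul1r.
by field; rewrite Q0 M0.
Qed.

(** The summand of index m in the derivation d, for m > 0. *)
Definition level_term m v : fock := (m%:R ^+ 2 / qint m%:R ^+ 2) *:
  (\sum_(i < 4 | (i < 3)%N) Aop i (- m%:Z) (Astar i m%:Z v)
   + (2 * q2 m%:Z)^-1 *: Aop ord_max (- m%:Z) (Astar ord_max m%:Z v)
   + \sum_(l < 2) cop l (- m%:Z) (cop l m%:Z v)).

Lemma level_termE m v : level_term m.+1 v =
  \sum_b (m.+1%:R ^+ 2 / qint m.+1%:R ^+ 2) *:
    (osc_sign C b *: mode b (- m.+1%:Z) (mode b m.+1%:Z v)).
Proof.
rewrite /level_term casimir -scaler_sumr; congr (_ *: _).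
rewrite big_sumType /=; congr (_ + _).
by apply: eq_bigr => l _; rewrite scale1r.
Qed.

Lemma linear_level_term m : linear (level_term m.+1).
Proof.
have lF b : linear (fun v => (m.+1%:R ^+ 2 / qint m.+1%:R ^+ 2) *:
    (osc_sign C b *: mode b (- m.+1%:Z) (mode b m.+1%:Z v))).
  apply/linear_scale_fun/linear_scale_fun.
  exact: linear_comp (linear_mode _ _ _) (linear_mode _ _ _).
move=> a u v; rewrite !level_termE.
exact: (linear_sum_fun (index_enum osc) xpredT lF a u v).
Qed.

Lemma level_term_ket m lam mu :
  level_term m.+1 (ket (lam, mu)) = (\sum_b m.+1 * mu (b, m))%N%:R *: ket (lam, mu).
Proof.
rewrite level_termE natr_sum scaler_suml; apply: eq_bigr => b _.
exact: mode_number_ket.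
Qed.

Lemma lvl_by_level N mu : (lvl mu <= N)%N ->
  lvl mu = (\sum_(0 <= m < N) \sum_b m.+1 * mu (b, m))%N.
Proof.
move=> hN; rewrite (@lvlE (mbox_dom N)); last first.
  apply/fsubsetP => -[b m]; rewrite mem_finsupp => mx.
  have mN : (m < N)%N.
    apply: leq_trans hN; apply: leq_trans (lvl_ge (b, m) mu) => /=.
    by rewrite leq_pmull // lt0n.
  by apply/imfsetP; exists (b, Ordinal mN).
rewrite /mbox_dom big_imfset /=; last by move=> [? ?] [? ?] _ _ /= [-> /val_inj ->].
rewrite big_enum /= big_mkord exchange_big /=.
rewrite (pair_bigA _ (fun b (m : 'I_N) => m.+1 * mu (b, val m))%N) /=.
by apply: eq_bigr => -[b m] _; rewrite mulnC.
Qed.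

Lemma level_sum lam E v : block lam E v ->
  \sum_(m \in [set m : nat | (0 < m)%N]) level_term m v =
  (E%:R - (mtri lam)%:R) *: v.
Proof.
move=> /blockP hv.
have tE m : level_term m.+1 v = \sum_(k <- blk lam E) fm_coef k v *: level_term m.+1 (ket k).
  rewrite {1}(fm_expand_in hv) (linear_sumE (linear_level_term m)).
  by apply: eq_bigr => k _; rewrite (linear_scaleE (linear_level_term m)).
rewrite (fsbigE (index_iota 1 E.+1)) ?iota_uniq //; first last.
- move=> [|m] //= _; rewrite mem_index_iota /= ltnS -leqNgt => Em; rewrite tE.
  rewrite big_seq big1 // => -[lam1 mu]; rewrite in_blk /= => /andP[/eqP -> /eqP kE].
  rewrite level_term_ket big1 ?scale0r ?scaler0 // => b _.
  have := lvl_ge (b, m) mu; rewrite /=; case: (mu (b, m)) => [|r]; first by rewrite muln0.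
  by rewrite mulSn; lia.
- by move=> m /=; rewrite mem_index_iota => /andP[].
rewrite big_mkcond /= (eq_big_seq (fun m => level_term m v)) => [|m]; last first.
  by rewrite mem_index_iota => /andP[m0 _]; rewrite mem_set.
rewrite big_add1 /=; under eq_bigr => m _ do rewrite tE.
rewrite exchange_big /= [in RHS](fm_expand_in hv) scaler_sumr.
apply: eq_big_seq => -[lam1 mu]; rewrite in_blk /= => /andP[/eqP -> /eqP kE].
under eq_bigr => m _ do rewrite level_term_ket.
rewrite -scaler_sumr -scaler_suml -natr_sum -lvl_by_level; last by lia.
by rewrite !scalerA mulrC -kE natrD addrK.
Qed.

Lemma q20 : q2 0 = 2.
Proof. by rewrite /Defs.q2 oppr0 mulr0z qpow0. Qed.

(** The eigenvalues of the A^i_0, that is, the weights of the Cartan elements. *)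
Definition weight_of lam (i : 'I_4) : C :=
  nth 0 [:: lam.1 o0 + lam.1 o1; - (lam.1 o1 + lam.1 o2); lam.1 o2 + lam.1 o3;
            lam.1 o0 - lam.1 o1 + lam.1 o2 - lam.1 o3] i.

Lemma Aop_zero i lam w v : homog lam w v -> Aop i 0 v = weight_of lam i *: v.
Proof.
move=> hv; have h j : aop j 0 v = lam.1 j *: v by exact: mode0_homog hv.
have n2 : 2 != 0 :> C by exact: (C0 1).
by case: (ord4E i) => ->; rewrite ?Aop0E ?Aop1E ?Aop2E ?Aop3E /weight_of inordK //=
  ?q20 ?divff // !h ?scale1r -?scaleNr -?scalerDl // -scaleNr opprD scalerDl !scaleNr.
Qed.

End Eigenvalues.

Section ModuleEigenvalues.
Variables (C : fieldType) (qpow : C -> C).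
Local Notation fock := (fock C).
Local Notation qint := (qint qpow).
Hypothesis C0 : forall n, n.+1%:R != 0 :> C.
Hypothesis q0 : forall m, qint m.+1%:R != 0.
Hypothesis qpow0 : qpow 0 = 1.
Hypothesis q2_neq0 : forall m, q2 qpow m.+1%:Z != 0.
Implicit Types (v : fock) (lam : momentum C).

Lemma casimir_zero lam w v : homog lam w v ->
  \sum_(i < 4) Aop qpow i 0 (Astar qpow i 0 v) =
  (lam.1 (inord 0) ^+ 2 - lam.1 (inord 1) ^+ 2
   + lam.1 (inord 2) ^+ 2 - lam.1 (inord 3) ^+ 2) *: v.
Proof.
move=> hv; have n4 : 4 != 0 :> C by exact: (C0 3).
have A0 i u : homog lam w u -> Aop qpow i 0 u = weight_of lam i *: u.
  exact: Aop_zero.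
have S0 i : Astar qpow i 0 v = (\sum_l icartan C i l * weight_of lam l) *: v.
  rewrite /Astar eqxx scaler_suml; apply: eq_bigr => l _.
  by rewrite A0 // scalerA.
have A1 i a : Aop qpow i 0 (a *: v) = (weight_of lam i * a) *: v.
  by rewrite A0 ?scalerA //; exact: homogZ.
under eq_bigr => i _ do rewrite S0 A1.
rewrite -scaler_suml; congr (_ *: _).
rewrite !sum_ord4 !icartanE // /weight_of !inordK //=.
by field.
Qed.

Lemma cop_zero l lam w v : homog lam w v ->
  cop qpow l 0 (cop qpow l 0 v + v) = ((lam.2 l * (lam.2 l + 1))%:~R) *: v.
Proof.
move=> hv; have h : cop qpow l 0 v = (lam.2 l)%:~R *: v by exact: mode0_homog hv.
have lc := linear_mode qpow (inr l) 0.
rewrite h -{2}[v]scale1r -scalerDl [LHS](linear_scaleE lc) -/(cop qpow l 0 v) h.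
by rewrite scalerA intrM intrD mulrC.
Qed.

(** The terms in c^l_0 complete the level to the conserved energy E. *)
Lemma dop_block lam E v : block lam E v ->
  dop qpow v = - (E%:R + 2^-1 *
   (lam.1 (inord 0) ^+ 2 - lam.1 (inord 1) ^+ 2
    + lam.1 (inord 2) ^+ 2 - lam.1 (inord 3) ^+ 2)) *: v.
Proof.
move=> hv; have n2 : 2 != 0 :> C by exact: (C0 1).
rewrite /dop (casimir_zero hv).
under [X in _ - 2^-1 *: (_ + X)]eq_bigr => l _ do rewrite (cop_zero l hv).
rewrite -scaler_suml -scalerDl scalerA.
have := level_sum C0 q0 q2_neq0 hv; rewrite /level_term => ->.
rewrite -!scaleNr -scalerDl; congr (_ *: _).
rewrite big_ord_recr big_ord_recr big_ord0 /= add0r.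
have T r : (r * (r + 1))%:~R = (tri r)%:R * 2 :> C.
  by rewrite -tri_mul2 intrM -pmulrn.
have -> : widen_ord (leqnSn 1) ord_max = 0 :> 'I_2 by apply: val_inj.
have -> : ord_max = 1 :> 'I_2 by apply: val_inj.
rewrite !T /mtri natrD.
by field.
Qed.

Variable beta : C.

Lemma momE (i j k : int) n : (n < 4)%N ->
  (mom beta i j k).1 (inord n) = nth 0 [:: beta + i%:~R; - beta - i%:~R + j%:~R;
                               beta - j%:~R + k%:~R; - beta - k%:~R] n.
Proof. by move=> n4; rewrite ffunE inordK. Qed.

Lemma dop_mom i j k E v : block (mom beta i j k) E v ->
  dop qpow v = - (E%:R + (j * (i - k))%:~R) *: v.
Proof.
move=> /dop_block ->; rewrite !momE //=; congr (- (_ + _) *: _).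
have n2 : 2 != 0 :> C by exact: (C0 1).
by rewrite intrM intrB; field.
Qed.

Lemma hop_mom t i j k E v : block (mom beta i j k) E v ->
  hop qpow t v = tnth [tuple j%:~R; (i - k)%:~R; (- j)%:~R;
         4 * beta + (2 * i - 2 * j + 2 * k)%:~R] t *: v.
Proof.
move=> hv; rewrite /hop (Aop_zero C0 qpow0 t hv); congr (_ *: _).
rewrite (tnth_nth 0) /weight_of !momE //= !(intrM, intrD, intrB, mulrNz).
by case: t => [[|[|[|[|//]]]] ?] /=; ring.
Qed.

Lemma Nf_mom i j k E v : block (mom beta i j k) E v ->
  Nf qpow v = (- 2 * beta + (- i + j - k)%:~R) *: v.
Proof.
move=> hv; rewrite /Nf.
have h t : aop qpow t 0 v = (mom beta i j k).1 t *: v by exact: mode0_homog hv.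
rewrite !h -scalerDl !momE //=; congr (_ *: _).
by rewrite !(intrD, intrB, mulrNz); ring.
Qed.

End ModuleEigenvalues.

(** * The modulus of a complex number *)

Section ComplexNorm.
Variable R : realType.
Local Notation C := R[i].
Implicit Types z w : C.

(** The norm on R[i] takes its values in R[i]; estimates are done in the reals. *)
Definition cnorm z : R := complex.Re `|z|.

Lemma cnormE z : `|z| = (cnorm z)%:C%C.
Proof. by rewrite /cnorm normc_def. Qed.

Lemma cnormM z w : cnorm (z * w) = cnorm z * cnorm w.
Proof. by apply: (@complexI R); rewrite rmorphM /= -!cnormE normrM. Qed.

Lemma cnormN z : cnorm (- z) = cnorm z.
Proof. by rewrite /cnorm normrN. Qed.

Lemma cnormB z w : cnorm (z - w) = cnorm (w - z).
Proof. by rewrite /cnorm distrC. Qed.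

Lemma cnorm_ge0 z : 0 <= cnorm z.
Proof. by rewrite -lecR -cnormE; exact: normr_ge0. Qed.

Lemma cnormD z w : cnorm (z + w) <= cnorm z + cnorm w.
Proof. by rewrite -lecR rmorphD /= -!cnormE ler_normD. Qed.

Lemma cnorm1 : cnorm 1 = 1.
Proof. by rewrite /cnorm normr1. Qed.

Lemma cnorm0 : cnorm 0 = 0.
Proof. by rewrite /cnorm normr0. Qed.

Lemma cnormX z n : cnorm (z ^+ n) = cnorm z ^+ n.
Proof. by elim: n => [|n IHn]; rewrite ?expr0 ?cnorm1 // !exprS cnormM IHn. Qed.

Lemma cnorm_sign n : cnorm ((-1) ^+ n) = 1.
Proof. by rewrite cnormX cnormN cnorm1 expr1n. Qed.

Lemma cnorm_nat n : cnorm n%:R = n%:R.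
Proof. by rewrite /cnorm normr_nat -(rmorph_nat (real_complex R)). Qed.

Lemma cnorm_sum I (r : seq I) (P : pred I) (F : I -> C) :
  cnorm (\sum_(i <- r | P i) F i) <= \sum_(i <- r | P i) cnorm (F i).
Proof.
elim/big_rec2: _ => [|i x z _ h]; first by rewrite cnorm0.
by apply: le_trans (cnormD _ _) _; rewrite lerD2l.
Qed.

Lemma cnorm_prod I (r : seq I) (P : pred I) (F : I -> C) :
  cnorm (\prod_(i <- r | P i) F i) = \prod_(i <- r | P i) cnorm (F i).
Proof. exact: (big_morph cnorm cnormM cnorm1). Qed.

Lemma cnorm_re_im (x y : R) : cnorm (Complex x y) <= `|x| + `|y|.
Proof.
have -> : Complex x y = x%:C%C + 'i%C * y%:C%C by simpc.
apply: le_trans (cnormD _ _) _; rewrite cnormM.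
have N (t : R) : cnorm t%:C%C = `|t|.
  by rewrite /cnorm normc_def /= expr0n addr0 sqrtr_sqr.
rewrite !N; have -> : cnorm 'i%C = 1.
  by rewrite /cnorm normc_def /= expr0n expr1n add0r sqrtr1.
by rewrite mul1r.
Qed.

Lemma re_cnorm z : `|complex.Re z| <= cnorm z.
Proof. by have := normc_ge_Re z; rewrite cnormE lecR. Qed.

Lemma im_cnorm z : `|complex.Im z| <= cnorm z.
Proof.
rewrite /cnorm normc_def /= -sqrtr_sqr ler_sqrt ?addr_ge0 ?sqr_ge0 //.
by rewrite lerDr sqr_ge0.
Qed.

Lemma cvg_cnorm T (F : set_system T) (FF : Filter F) (u : T -> C^o) (l : C) :
  (forall e : R, 0 < e -> \forall t \near F, cnorm (l - u t) < e) ->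
  u @ F --> (l : C^o).
Proof.
move=> h; apply/cvgrPdist_lt => e e0.
have [e1 ee] : complex.Im e = 0 /\ 0 < complex.Re e.
  by move: e0; rewrite ltcE /= => /andP[/eqP].
have -> : e = (complex.Re e)%:C%C by case: e e1 {e0 ee} => x y /= ->.
apply: filterS (h _ ee) => t ht.
by rewrite cnormE ltcR.
Qed.

Lemma cvg_cnormP T (F : set_system T) (FF : Filter F) (u : T -> C^o) (l : C) :
  u @ F --> (l : C^o) -> forall e : R, 0 < e -> \forall t \near F, cnorm (l - u t) < e.
Proof.
move=> /cvgrPdist_lt h e e0; have ee : 0 < e%:C%C :> C by rewrite -[0]/(0%:C%C) ltcR.
by apply: filterS (h _ ee) => t; rewrite cnormE ltcR.
Qed.

End ComplexNorm.

(** * Unordered sums *)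

#[local] Existing Instance totally_filter.

Section UnorderedSums.
Variable R : realType.
Local Notation C := R[i].

Lemma partial_sumE (T : choiceType) (a : T -> C) (A : {fset T}) :
  partial_sum a A = \sum_(t <- A) a t.
Proof. by rewrite /partial_sum [RHS]big_seq_fsetE. Qed.

Lemma fset_mono (T : choiceType) (G : nat -> {fset T}) :
  (forall n, (G n `<=` G n.+1)%fset) ->
  forall m n, (m <= n)%N -> (G m `<=` G n)%fset.
Proof.
move=> hG m n /subnK <-; elim: (n - m)%N => [|k IH]; first exact: fsubset_refl.
by rewrite addSn; exact: fsubset_trans IH (hG _).
Qed.

Lemma fset_exhaust (T : choiceType) (V : nmodType) (a : T -> V) (G : nat -> {fset T})
    (A : {fset T}) : (forall n, (G n `<=` G n.+1)%fset) ->
  (forall t, a t != 0 -> exists n, t \in G n) ->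
  exists N, forall t, t \in A -> a t != 0 -> t \in G N.
Proof.
move=> hG hE; have H t : exists n, a t != 0 -> t \in G n.
  by have [a0|a0] := eqVneq (a t) 0; [exists 0%N | have [n] := hE t a0; exists n].
have [f hf] := choice H.
exists (\max_(t <- A) f t) => t tA at0.
apply: (fsubsetP (fset_mono hG _)) (hf t at0).
by apply: leq_bigmax_seq.
Qed.

Lemma sum_restrict (T : choiceType) (V : nmodType) (a : T -> V) (A B : {fset T}) :
  (A `<=` B)%fset -> (forall t, t \in B -> a t != 0 -> t \in A) ->
  \sum_(t <- B) a t = \sum_(t <- A) a t.
Proof.
move=> AB h; apply/esym/big_fset_incl => // t tB tA.
by apply/eqP; apply: contraNT tA => at0; exact: h.
Qed.

(** Every finite set is contained in some G n up to zero terms. *)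
Lemma totally_exhaust (T : choiceType) (a : T -> C) (G : nat -> {fset T}) (S : C) :
  partial_sum (a : T -> C^o) A @[A --> totally] --> (S : C^o) ->
  (forall n, (G n `<=` G n.+1)%fset) ->
  (forall t, a t != 0 -> exists n, t \in G n) ->
  (\sum_(t <- G n) a t : C^o) @[n --> \oo] --> (S : C^o).
Proof.
move=> hS hG hE; apply: cvg_cnorm => e e0.
have [A _ hA] := cvg_cnormP _ hS e0.
have [N hN] := fset_exhaust A hG hE.
exists N => // n /= Nn.
have -> : \sum_(t <- G n) a t = partial_sum (a : T -> C^o) (A `|` G n)%fset.
  rewrite partial_sumE; apply/esym/sum_restrict; first exact: fsubsetUr.
  move=> t; rewrite inE => /orP[tA at0|//].
  by apply: (fsubsetP (fset_mono hG Nn)); exact: hN.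
by apply: hA => /=; exact: fsubsetUl.
Qed.

Lemma ler_sum_fset (T : choiceType) (x : T -> R) (A B : {fset T}) :
  (A `<=` B)%fset -> (forall t, 0 <= x t) ->
  \sum_(t <- A) x t <= \sum_(t <- B) x t.
Proof.
move=> AB x0; rewrite [leRHS](big_fsetID _ (mem A)) /=.
have -> : [fset t in B | t \in A]%fset = A.
  apply/fsetP => t; rewrite !inE /=; apply/andP/idP => [[]//|tm].
  by split=> //; exact: (fsubsetP AB).
by rewrite lerDl sumr_ge0.
Qed.

(** Write x = (x + |x|) - |x|: both sums are monotone and bounded. *)
Lemma bounded_sum_cvg (T : choiceType) (x : T -> R) (G : nat -> {fset T}) (M : R) :
  (forall n, (G n `<=` G n.+1)%fset) ->
  (forall n, \sum_(t <- G n) `|x t| <= M) ->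
  cvgn (fun n => \sum_(t <- G n) x t).
Proof.
move=> hG hM.
have pos (y : T -> R) : (forall t, 0 <= y t <= `|x t| *+ 2) ->
    cvgn (fun n => \sum_(t <- G n) y t).
  move=> hy; apply: nondecreasing_is_cvgn.
    move=> m n mn; apply: ler_sum_fset; first exact: fset_mono.
    by move=> t; case/andP: (hy t).
  exists (M *+ 2) => _ [n _ <-]; apply: le_trans (_ : (\sum_(t <- G n) `|x t|) *+ 2 <= _).
    by rewrite -sumrMnl; apply: ler_sum => t _; case/andP: (hy t).
  by rewrite lerMn2r hM orbT.
have -> : (fun n => \sum_(t <- G n) x t) =
    (fun n => \sum_(t <- G n) (x t + `|x t|) - \sum_(t <- G n) `|x t|).
  by apply/funext => n; rewrite big_split /= addrK.
have h (t : T) := normr_ge0 (x t); have h1 t := ler_norm (x t).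
have h2 t : - `|x t| <= x t by rewrite lerNl -normrN ler_norm.
apply: is_cvgB; apply: pos => t; have := h t; have := h1 t; have := h2 t;
  rewrite mulr2n => *; apply/andP; split; lra.
Qed.

(** The limit is taken on real and imaginary parts.  Any finite set beyond G N is,
    up to zero terms, contained in some G n, so that the remainder is bounded by a
    tail of the convergent sum of moduli. *)
Lemma abs_exhaust (T : choiceType) (a : T -> C) (G : nat -> {fset T}) (M : R) :
  (forall n, (G n `<=` G n.+1)%fset) ->
  (forall t, a t != 0 -> exists n, t \in G n) ->
  (forall n, \sum_(t <- G n) cnorm (a t) <= M) ->
  exists S : C, partial_sum (a : T -> C^o) A @[A --> totally] --> (S : C^o).
Proof.
move=> hG hE hM.
have hb (f : C -> R) : (forall z, `|f z| <= cnorm z) ->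
    cvgn (fun n => \sum_(t <- G n) f (a t)).
  move=> hf; apply: (@bounded_sum_cvg _ _ _ M) => // n.
  by apply: le_trans (hM n); apply: ler_sum => t _.
have /cvg_ex[/= x hx] := hb _ (@re_cnorm R).
have /cvg_ex[/= y hy] := hb _ (@im_cnorm R).
have /cvg_ex[/= L hL] : cvgn (fun n => \sum_(t <- G n) cnorm (a t)).
  by apply: hb => z; rewrite ger0_norm // cnorm_ge0.
exists (Complex x y); apply: cvg_cnorm => e e0.
have e3 : 0 < e / 4 by rewrite divr_gt0.
have /cvgrPdist_lt/(_ _ e3)[N1 _ h1] := hx.
have /cvgrPdist_lt/(_ _ e3)[N2 _ h2] := hy.
have /cvgrPdist_lt/(_ _ e3)[N3 _ h3] := hL.
have ndL : nondecreasing_seq (fun n => \sum_(t <- G n) cnorm (a t)).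
  by move=> m n mn; apply: ler_sum_fset => [|t]; [exact: fset_mono | exact: cnorm_ge0].
have leL n : \sum_(t <- G n) cnorm (a t) <= L.
  rewrite -(cvg_lim (@Rhausdorff R) hL).
  by apply: (nondecreasing_cvgn_le ndL); apply/cvg_ex; exists L.
pose N := maxn N1 (maxn N2 N3).
exists (G N) => // A /= GA; rewrite partial_sumE.
have [N' hN'] := fset_exhaust A hG hE.
have NN1 : (N1 <= N)%N by rewrite leq_maxl.
have NN2 : (N2 <= N)%N by rewrite !leq_max leqnn !orbT.
have NN3 : (N3 <= N)%N by rewrite !leq_max leqnn !orbT.
have tail : cnorm (\sum_(t <- A) a t - \sum_(t <- G N) a t) < e / 4.
  pose A1 := [fset t in A | t \notin G N]%fset.
  have -> : \sum_(t <- A) a t - \sum_(t <- G N) a t = \sum_(t <- A1) a t.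
    rewrite (big_fsetID _ (mem (G N))) /=.
    have -> : [fset t in A | t \in G N]%fset = G N.
      apply/fsetP => t; rewrite !inE /=; apply/andP/idP => [[]//|tm].
      by split=> //; exact: (fsubsetP GA).
    by rewrite addrAC subrr add0r.
  apply: le_lt_trans (cnorm_sum _ _ _) _.
  pose B := [fset t in G (maxn N N') | t \notin G N]%fset.
  apply: (@le_lt_trans _ _ (\sum_(t <- B) cnorm (a t))).
    have -> : \sum_(t <- B) cnorm (a t) = \sum_(t <- (A1 `|` B)%fset) cnorm (a t).
      apply/esym/sum_restrict; first exact: fsubsetUr.
      move=> t; rewrite inE => /orP[|//]; rewrite !inE /= => /andP[tA -> at0].
      rewrite andbT; apply: (fsubsetP (fset_mono hG (leq_maxr N N'))); apply: hN' => //.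
      by apply: contraNneq at0 => ->; rewrite cnorm0.
    by apply: ler_sum_fset => [|t]; [exact: fsubsetUl | exact: cnorm_ge0].
  have := h3 N NN3; have := leL (maxn N N').
  rewrite (big_fsetID _ (mem (G N))) /= -/B.
  have -> : [fset t in G (maxn N N') | t \in G N]%fset = G N.
    apply/fsetP => t; rewrite !inE /=; apply/andP/idP => [[]//|tm].
    by split=> //; exact: (fsubsetP (fset_mono hG (leq_maxl N N'))).
  by move=> h4 /ltr_normlP[_]; lra.
have near : cnorm (Complex x y - \sum_(t <- G N) a t) < e / 4 + e / 4.
  have -> : \sum_(t <- G N) a t = Complex (\sum_(t <- G N) complex.Re (a t))
                                          (\sum_(t <- G N) complex.Im (a t)).
    elim/big_rec3: _ => [//|t u v w _ ->].
    by case: (a t) => ? ?; simpc.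
  rewrite (_ : Complex x y - _ = Complex (x - \sum_(t <- G N) complex.Re (a t))
                                  (y - \sum_(t <- G N) complex.Im (a t))); last by simpc.
  by apply: le_lt_trans (cnorm_re_im _ _) _; apply: ltrD; [exact: h1 | exact: h2].
have -> : Complex x y - \sum_(t <- A) a t = (Complex x y - \sum_(t <- G N) a t)
    - (\sum_(t <- A) a t - \sum_(t <- G N) a t) by ring.
apply: le_lt_trans (cnormD _ _) _; rewrite cnormN.
by have := ltrD near tail; lra.
Qed.

(** Absolute boundedness along one exhaustion gives unordered summability, and the
    sum can then be computed along that exhaustion. *)
Lemma totally_of_exhaust (T : choiceType) (a : T -> C) (G : nat -> {fset T}) (M : R) (Z : C) :
  (forall n, (G n `<=` G n.+1)%fset) ->
  (forall t, a t != 0 -> exists n, t \in G n) ->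
  (forall n, \sum_(t <- G n) cnorm (a t) <= M) ->
  (\sum_(t <- G n) a t : C^o) @[n --> \oo] --> (Z : C^o) ->
  partial_sum (a : T -> C^o) A @[A --> totally] --> (Z : C^o).
Proof.
move=> hG hE hM hZ; have [S' hS'] := abs_exhaust hG hE hM.
have h := totally_exhaust hS' hG hE.
by have <- : S' = Z by apply: (cvg_unique _ h hZ); exact: norm_hausdorff.
Qed.

End UnorderedSums.

(** * Powers of q *)

Section Exponential.
Variable R : realType.
Local Notation C := R[i].
Implicit Types z w : C.

Lemma cexpD z w : cexp (z + w) = cexp z * cexp w.
Proof.
case: z w => [a b] [c d]; rewrite /cexp /=; simpc.
rewrite expRD cosD sinD.
by apply/eqP; rewrite eq_complex /=; apply/andP; split; apply/eqP; ring.
Qed.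

Lemma cexp0 : cexp (0 : C) = 1.
Proof. by rewrite /cexp /= expR0 cos0 sin0 mulr1 mulr0. Qed.

Lemma cexp_neq0 z : cexp z != 0.
Proof.
have : cexp z * cexp (- z) = 1 by rewrite -cexpD subrr cexp0.
by move=> h; apply/eqP => z0; move/eqP: h; rewrite z0 mul0r eq_sym oner_eq0.
Qed.

Lemma cexpN z : cexp (- z) = (cexp z)^-1.
Proof.
apply: (mulIf (cexp_neq0 z)); rewrite mulVf ?cexp_neq0 //.
by rewrite -cexpD addNr cexp0.
Qed.

Lemma cexp_int z (n : int) : cexp (z * n%:~R) = cexp z ^ n.
Proof.
have E m : cexp (z * m%:R) = cexp z ^+ m.
  elim: m => [|m IHm]; first by rewrite mulr0 cexp0.
  by rewrite -natr1 mulrDr mulr1 cexpD IHm exprSr.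
case: n => n; first by rewrite -pmulrn E.
by rewrite NegzE mulrNz mulrN -pmulrn cexpN E exprnN.
Qed.

Lemma cexp_pi (n : int) : cexp (Complex 0 pi * n%:~R : C) = (-1) ^ n.
Proof.
have E : cexp (Complex 0 pi) = -1 :> C.
  by rewrite /cexp expR0 cospi sinpi !mul1r; apply/eqP; rewrite eq_complex /= oppr0 !eqxx.
by rewrite cexp_int E.
Qed.

Variables (lq q : C).
Hypothesis hlq : cexp lq = q.
Local Notation qpow := (qpow lq).

Lemma qpowD z w : qpow (z + w) = qpow z * qpow w.
Proof. by rewrite /Defs.qpow mulrDl cexpD. Qed.

Lemma qpow_int (n : int) : qpow n%:~R = q ^ n.
Proof. by rewrite /Defs.qpow mulrC cexp_int hlq. Qed.

Lemma qpow_nat n : qpow n%:R = q ^+ n.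
Proof. by rewrite pmulrn qpow_int. Qed.

Lemma qpow_0 : qpow 0 = 1.
Proof. by rewrite /Defs.qpow mul0r cexp0. Qed.

Hypothesis hq : 0 < `|q| < 1.
Local Notation rho := (cnorm q).

Lemma rho_gt0 : 0 < rho.
Proof. by case/andP: hq => h _; rewrite -ltcR -cnormE. Qed.

Lemma rho_lt1 : rho < 1.
Proof. by case/andP: hq => _ h; rewrite -ltcR -cnormE. Qed.

Lemma q_neq0 : q != 0.
Proof. by case/andP: hq; rewrite normr_gt0. Qed.

Lemma exp_neq1 n z : cnorm z = 1 -> q ^+ n.+1 != z.
Proof.
move=> z1; apply/eqP => qz; have := z1; rewrite -qz cnormX => /eqP.
by rewrite pexpr_eq1 ?ltW ?rho_gt0 // (lt_eqF rho_lt1).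
Qed.

Lemma char0 n : n.+1%:R != 0 :> C.
Proof. by rewrite pnatr_eq0. Qed.

Lemma qint_neq0 m : qint qpow m.+1%:R != 0.
Proof.
have E n : qpow n.+1%:R - qpow (- n.+1%:R) != 0.
  rewrite pmulrn -mulrNz !qpow_int -exprnN subr_eq0.
  apply/eqP => /(congr1 ( *%R^~ (q ^+ n.+1))).
  rewrite mulVf ?expf_neq0 ?q_neq0 // -exprD addSn => /eqP.
  by apply/negP; apply: exp_neq1; rewrite cnorm1.
by rewrite /qint mulf_neq0 ?invr_neq0 // (E 0%N).
Qed.

Lemma q2_neq0 m : q2 qpow m.+1%:Z != 0.
Proof.
rewrite /q2 -mulrNz !qpow_int -exprnN addr_eq0; apply/eqP => /(congr1 ( *%R^~ (q ^+ m.+1))).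
rewrite mulNr mulVf ?expf_neq0 ?q_neq0 // -exprD addSn => /eqP.
by apply/negP; apply: exp_neq1; rewrite cnormN cnorm1.
Qed.

End Exponential.

(** * The generating function of occupation numbers *)

Section PartitionSums.

(** Truncations of the sum of x^(level) over all occupation numbers, as a function
    of x in any ring: both q and its modulus are used. *)
Definition boxsum (K : comNzRingType) (x : K) N : K := \sum_(mu <- box N) x ^+ lvl mu.

Lemma card_osc : #|{: osc}| = 6%N.
Proof. by rewrite card_sum !card_ord. Qed.

Lemma boxsum_prod (K : comNzRingType) (x : K) N :
  boxsum x N = (\prod_(m < N) \sum_(n < N) x ^+ (n * m.+1)) ^+ 6.
Proof.
rewrite /boxsum /box big_imfset /=; last by move=> f g _ _; exact: mbox_inj.
rewrite big_enum /=.
under eq_bigr => f _ do rewrite lvl_mbox expr_sum.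
rewrite -(bigA_distr_bigA (fun (y : osc * 'I_N) (n : 'I_N) => x ^+ (n * y.2.+1))) /=.
rewrite -(pair_bigA _ (fun b (m : 'I_N) => \sum_(n < N) x ^+ (n * m.+1))) /=.
by rewrite prodr_const card_osc.
Qed.

(** There are six oscillators, hence six copies of each geometric sum. *)
Lemma boxsum_euler (K : comNzRingType) (x : K) N :
  boxsum x N * \prod_(m < N) (1 - x ^+ m.+1) ^+ 6 =
  (\prod_(m < N) (1 - x ^+ (m.+1 * N))) ^+ 6.
Proof.
rewrite boxsum_prod prodrXl -exprMn -big_split; congr (_ ^+ 6).
apply: eq_bigr => m _ /=; rewrite exprM -[RHS]opprB subrX1 -mulNr opprB mulrC.
congr (_ * _).
by apply: eq_bigr => n _; rewrite mulnC exprM.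
Qed.

Variable R : realType.

Lemma geometric_le (r : R) N : 0 <= r < 1 -> \sum_(m < N) r ^+ m <= (1 - r)^-1.
Proof.
case/andP=> r0 r1; rewrite -[leRHS]mul1r ler_pdivlMr ?subr_gt0 //.
by rewrite mulrC -opprB mulNr -subrX1 opprB lerBlDr lerDl exprn_ge0.
Qed.

Lemma prod_1D_le N (y : 'I_N -> R) : (forall m, 0 <= y m) ->
  \prod_(m < N) (1 + y m) <= expR (\sum_(m < N) y m).
Proof.
move=> y0; rewrite expR_sum; apply: ler_prod => m _.
by rewrite expR_ge1Dx addr_ge0.
Qed.

Variable rho : R.
Hypothesis rho01 : 0 < rho < 1.

Let rho0 : 0 <= rho. Proof. by case/andP: rho01 => /ltW. Qed.
Let rho1 : rho < 1. Proof. by case/andP: rho01. Qed.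
Let rhoX m : rho ^+ m.+1 <= rho.
Proof. by rewrite exprS ler_piMr // exprn_ile1 // ltW. Qed.

Lemma sum_rhoS N : \sum_(m < N) rho ^+ m.+1 <= (1 - rho)^-1.
Proof.
apply: le_trans (_ : \sum_(m < N) rho ^+ m <= _); last by apply: geometric_le; rewrite rho0.
by apply: ler_sum => m _; rewrite exprS ler_piMl ?exprn_ge0 // ltW.
Qed.

(** From exp (x / (1 - x)) >= 1 / (1 - x), applied to each factor. *)
Lemma euler_lower N :
  expR (- ((1 - rho)^-1 * (1 - rho)^-1)) <= \prod_(m < N) (1 - rho ^+ m.+1).
Proof.
have r1 : 0 < 1 - rho by rewrite subr_gt0.
apply: le_trans (_ : expR (\sum_(m < N) - (rho ^+ m.+1 / (1 - rho))) <= _).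
  rewrite ler_expR sumrN lerN2 -mulr_suml ler_wpM2r ?invr_ge0 ?(ltW r1) //.
  exact: sum_rhoS.
rewrite expR_sum; apply: ler_prod => m _; rewrite expR_ge0 /=.
set x := rho ^+ m.+1; have x1 : 0 < 1 - x.
  by rewrite subr_gt0 (le_lt_trans (rhoX m)).
rewrite expRN -[leRHS]invrK lef_pV2 ?posrE ?invr_gt0 ?expR_gt0 //.
apply: le_trans (_ : expR (x / (1 - x)) <= _).
  apply: le_trans (expR_ge1Dx _).
  by rewrite le_eqVlt; apply/orP; left; apply/eqP; field; exact: lt0r_neq0.
rewrite ler_expR ler_wpM2l ?exprn_ge0 // lef_pV2 ?posrE //.
by rewrite lerD2l lerN2 rhoX.
Qed.

Lemma boxsum_bounded : exists M, forall N, boxsum rho N <= M.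
Proof.
set c := expR (- ((1 - rho)^-1 * (1 - rho)^-1)).
exists ((c ^+ 6)^-1) => N; have c0 : 0 < c := expR_gt0 _.
have := boxsum_euler rho N; rewrite prodrXl => E.
rewrite -[leRHS]mul1r ler_pdivlMr ?exprn_gt0 //.
have b0 : 0 <= boxsum rho N by apply: sumr_ge0 => mu _; rewrite exprn_ge0.
apply: le_trans (_ : boxsum rho N * (\prod_(m < N) (1 - rho ^+ m.+1)) ^+ 6 <= _).
  by rewrite ler_wpM2l // lerXn2r ?nnegrE ?euler_lower // ltW // (lt_le_trans c0) ?euler_lower.
have h m : 0 <= 1 - rho ^+ (m.+1 * N) <= 1.
  apply/andP; split; first by rewrite subr_ge0 exprn_ile1 // ltW.
  by rewrite lerBlDr lerDl exprn_ge0.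
rewrite E exprn_ile1 ?prodr_ge0 //; first by move=> m _; case/andP: (h m).
by apply: prodr_ile1 => m _; exact: h.
Qed.

End PartitionSums.

Section EulerLimit.
Variables (R : realType) (q : R[i]).
Local Notation C := R[i].
Local Notation rho := (cnorm q).
Hypothesis rho01 : 0 < rho < 1.

Let rho0 : 0 <= rho. Proof. by case/andP: rho01 => /ltW. Qed.
Let rho1 : rho < 1. Proof. by case/andP: rho01. Qed.
Let r1 : 0 < 1 - rho. Proof. by rewrite subr_gt0. Qed.

Lemma cvg_expn (u : nat -> C^o) (l : C) n :
  u @ \oo --> (l : C^o) -> (fun N => u N ^+ n : C^o) @ \oo --> (l ^+ n : C^o).
Proof.
move=> ul; elim: n => [|n IHn]; first exact: cvg_cst.
rewrite exprS (_ : (fun N => u N ^+ n.+1) = (fun N => u N * u N ^+ n)).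
  exact: (@cvgM (C : numFieldType) _ _ _ u _ _ _ ul IHn).
by apply/funext => N; rewrite exprS.
Qed.

Lemma cvg_scale (u : nat -> C^o) (l a : C) :
  u @ \oo --> (l : C^o) -> (fun N => a * u N : C^o) @ \oo --> (a * l : C^o).
Proof. by apply: (@cvgM (C : numFieldType)); exact: cvg_cst. Qed.

Lemma cvg_rho (c : R) : (fun n => rho ^+ n * c) @ \oo --> (0 : R).
Proof.
rewrite -(mul0r c); apply: cvgM; last exact: cvg_cst.
by apply: cvg_expr; rewrite ger0_norm.
Qed.

Lemma prod_1B_dist N (y : 'I_N -> C) :
  cnorm (\prod_(m < N) (1 - y m) - 1) <= \prod_(m < N) (1 + cnorm (y m)) - 1.
Proof.
elim/big_rec2: _ => [|m X x _ h]; first by rewrite !subrr cnorm0.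
have -> : (1 - y m) * x - 1 = (x - 1) - y m * x by ring.
apply: le_trans (cnormD _ _) _; rewrite cnormN cnormM.
have hx : cnorm x <= X.
  have -> : x = (x - 1) + 1 by ring.
  by apply: le_trans (cnormD _ _) _; rewrite cnorm1; lra.
have := ler_wpM2l (cnorm_ge0 (y m)) hx; rewrite mulrDl mul1r; lra.
Qed.

(** The correction factors of the truncated geometric sums tend to 1: their product
    differs from 1 by at most exp (rho^N / (1 - rho)) - 1. *)
Lemma euler_tail_cvg :
  (fun N => (\prod_(m < N) (1 - q ^+ (m.+1 * N))) ^+ 6 : C^o) @ \oo --> (1 : C^o).
Proof.
rewrite -[X in _ --> X](expr1n C 6); apply: cvg_expn; apply: cvg_cnorm => e e0.
have /cvgrPdist_lt/(_ _ e0)[N0 _ hN0] :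
    (fun N => expR (rho ^+ N * (1 - rho)^-1)) @ \oo --> (1 : R).
  rewrite -(expR0 R); apply: continuous_cvg; [exact: continuous_expR | exact: cvg_rho].
exists N0.+1 => // N /= NN; rewrite cnormB.
apply: le_lt_trans (prod_1B_dist _) _.
have /ltr_normlP[h _] := hN0 N (ltnW NN).
apply: le_lt_trans h; rewrite opprB lerD2r.
under eq_bigr => m _ do rewrite cnormX.
apply: le_trans (prod_1D_le (fun=> _)) _; first by move=> m; rewrite exprn_ge0.
rewrite ler_expR; apply: le_trans (_ : rho ^+ N * \sum_(m < N) rho ^+ m <= _).
  rewrite mulr_sumr; apply: ler_sum => m _; rewrite -exprD.
  by apply: ler_wiXn2l => //; [exact: ltW | case: N NN m => // N _ m; rewrite mulnS mulSn; nia].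
by rewrite ler_wpM2l ?exprn_ge0 //; apply: geometric_le; rewrite rho0.
Qed.

Lemma euler_upper N :
  cnorm (\prod_(m < N) (1 - q ^+ m.+1) ^+ 6) <= expR ((1 - rho)^-1) ^+ 6.
Proof.
rewrite prodrXl cnormX cnorm_prod lerXn2r ?nnegrE ?expR_ge0 //.
  by rewrite prodr_ge0 // => m _; exact: cnorm_ge0.
apply: le_trans (_ : \prod_(m < N) (1 + rho ^+ m.+1) <= _).
  apply: ler_prod => m _; rewrite cnorm_ge0 /=.
  by apply: le_trans (cnormD _ _) _; rewrite cnorm1 cnormN cnormX.
apply: le_trans (prod_1D_le (fun=> _)) _; first by move=> m; rewrite exprn_ge0.
by rewrite ler_expR; exact: sum_rhoS.
Qed.

(** The unordered sum over all occupation multisets is the inverse of the sixth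
    power of Euler's product; it cannot vanish because Euler's products are
    bounded. *)
Lemma partition_sum : exists S : C,
  [/\ partial_sum (fun mu => q ^+ lvl mu : C^o) A @[A --> totally] --> (S : C^o),
      S != 0
    & (\prod_(1 <= n < N.+1) (1 - q ^+ n) ^+ 6 : C^o) @[N --> \oo] --> (S^-1 : C^o)].
Proof.
have [M hM] := boxsum_bounded rho01.
have hE mu : q ^+ lvl mu != 0 -> exists n, mu \in box n.
  by move=> _; exists (lvl mu).+1; exact: box_lvl.
have [S hS] : exists S : C,
    partial_sum (fun mu => q ^+ lvl mu : C^o) A @[A --> totally] --> (S : C^o).
  apply: (@abs_exhaust _ _ _ _ M box_mono hE) => n; apply: le_trans (hM n).
  by rewrite /boxsum; apply: ler_sum => mu _; rewrite cnormX.
have hb := totally_exhaust hS box_mono hE.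
pose u N : C := \prod_(m < N) (1 - q ^+ m.+1) ^+ 6.
have bu : (fun N => boxsum q N * u N : C^o) @ \oo --> (1 : C^o).
  by under eq_fun => N do rewrite boxsum_euler; exact: euler_tail_cvg.
have S0 : S != 0.
  apply/eqP => S0; rewrite S0 in hb.
  (* otherwise the product of the box sum with the bounded Euler product would tend
     to 0 instead of 1 *)
  pose B := expR ((1 - rho)^-1) ^+ 6; have B0 : 0 < B by rewrite exprn_gt0 // expR_gt0.
  have e0 : 0 < (2 * B)^-1 by rewrite invr_gt0 mulr_gt0.
  have [N1 _ h1] := cvg_cnormP _ hb e0.
  have e2 : 0 < 2^-1 :> R by rewrite invr_gt0.
  have [N2 _ h2] := cvg_cnormP _ bu e2.
  pose N := maxn N1 N2.
  have := h1 N (leq_maxl N1 N2); have := h2 N (leq_maxr N1 N2).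
  rewrite /= sub0r cnormN => a1 a2.
  have a3 : cnorm (boxsum q N) * cnorm (u N) <= (2 * B)^-1 * B.
    by apply: ler_pM => //; [exact: cnorm_ge0 | exact: cnorm_ge0 | exact: ltW | exact: euler_upper].
  have := cnormD (1 - boxsum q N * u N) (boxsum q N * u N).
  rewrite subrK cnorm1 (cnormM (boxsum q N)).
  have a4 : (2 * B)^-1 * B = 2^-1 by field; rewrite ?lt0r_neq0.
  by rewrite a4 in a3; lra.
exists S; split; [exact: hS | exact: S0 |].
have -> : (fun N => \prod_(1 <= n < N.+1) (1 - q ^+ n) ^+ 6 : C^o) =
    (fun N => (boxsum q N * u N) * (boxsum q N)^-1).
  apply/funext => N; rewrite mulrAC divff ?mul1r /u.
    by rewrite big_add1 /= big_mkord.
  have : boxsum q N * u N != 0.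
    rewrite boxsum_euler expf_neq0 // prodf_seq_neq0; apply/allP => m _ /=.
    rewrite subr_eq0 eq_sym; have : (0 < m.+1 * N)%N.
      by rewrite muln_gt0; exact: leq_ltn_trans (ltn_ord m).
    case: (m.+1 * N)%N => // k _; apply/eqP => /(congr1 (@cnorm R)).
    rewrite cnormX cnorm1 => /eqP; rewrite pexpr_eq1 //.
    by rewrite (lt_eqF rho1).
  by apply: contraNneq => ->; rewrite mul0r.
have hV : (fun N => (boxsum q N)^-1 : C^o) @ \oo --> (S^-1 : C^o).
  exact: (@cvgV (C : numFieldType) _ _ _ _ S S0 hb).
have E1 : 1 * S^-1 = S^-1 := mul1r _.
rewrite -E1.
exact (@cvgM (C : numFieldType) _ _ _ _ _ _ _ bu hV).
Qed.

End EulerLimit.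

(** * Graded dimensions *)

Section BlockSums.

Lemma blk_box (C : fieldType) (lam : momentum C) E n : (E < n)%N ->
  #|` blk lam E| = #|` [fset mu in box n | (lvl mu + mtri lam == E)%N]%fset|.
Proof.
move=> En; set A := [fset mu in _ | _]%fset.
have -> : blk lam E = [fset (lam, mu) | mu in A]%fset.
  apply/fsetP => -[lam1 mu]; rewrite in_blk /=.
  apply/andP/imfsetP => /= [[/eqP -> h]|[nu] + [-> ->]].
    exists mu => //; rewrite !inE /= h andbT; apply: box_lvl.
    by move/eqP: h; lia.
  by rewrite !inE => /andP[_ ->].
by rewrite card_imfset // => x y [].
Qed.

Lemma card_blk_sum (C : fieldType) (K : comNzRingType) (x : K) (lam : momentum C) n :
  \sum_(0 <= E < n) #|` blk lam E|%:R * x ^+ E =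
  x ^+ mtri lam * \sum_(mu <- [fset mu in box n | (lvl mu + mtri lam < n)%N]%fset) x ^+ lvl mu.
Proof.
rewrite -big_fset_condE mulr_sumr.
transitivity (\sum_(0 <= E < n) \sum_(mu <- box n | (lvl mu + mtri lam == E)%N) x ^+ E).
  apply: eq_big_nat => E /andP[_ En]; rewrite (blk_box _ En) big_fset_condE.
  by rewrite big_const_seq count_predT iter_addr_0 mulr_natl.
rewrite (exchange_big_dep xpredT) //= [RHS]big_mkcond /=; apply: eq_bigr => mu _.
case: ltnP => h; last first.
  rewrite big_nat_cond big1 // => E /andP[/andP[_ En] /eqP hE]; lia.
rewrite big_mkcond (bigD1_seq (lvl mu + mtri lam)%N) ?mem_index_iota ?iota_uniq //=.
rewrite eqxx big1 ?addr0 => [|E]; first by rewrite exprD mulrC.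
by rewrite eq_sym => /negbTE ->.
Qed.

End BlockSums.

(** * Alternating sums *)

Section AlternatingSums.
Variable R : realType.
Local Notation C := R[i].

Lemma cvg_sum_nat (F : nat -> nat -> C) (L : nat -> C) K :
  (forall k, (F k n : C^o) @[n --> \oo] --> (L k : C^o)) ->
  (\sum_(0 <= k < K) F k n : C^o) @[n --> \oo] --> (\sum_(0 <= k < K) L k : C^o).
Proof.
move=> FL; elim: K => [|K IH].
  have E : (fun n => \sum_(0 <= k < 0) F k n : C^o) = cst (\sum_(0 <= k < 0) L k : C^o).
    by apply/funext => n; rewrite /= !big_geq.
  rewrite E; exact: cvg_cst.
have E : (fun n => \sum_(0 <= k < K.+1) F k n : C^o) =
    (fun n => (\sum_(0 <= k < K) F k n : C^o) + (F K n : C^o)).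
  by apply/funext => n; rewrite big_nat_recr.
have E2 : \sum_(0 <= k < K.+1) L k = \sum_(0 <= k < K) L k + L K.
  by rewrite big_nat_recr.
rewrite E E2; exact (cvgD IH (FL K)).
Qed.

(** Iterating x_k = y_{k+1} - x_{k+1} gives x_0 as an alternating sum of the y_k up
    to the remainder x_K; the bound on x_K is uniform in n, so that the limit in n
    can be taken first. *)
Lemma alternating_limit (x y : nat -> nat -> C) (Y : nat -> C) (Z : C) (b : nat -> R) :
  (forall k n, x k n + x k.+1 n = y k.+1 n) ->
  (forall k, (y k n : C^o) @[n --> \oo] --> (Y k : C^o)) ->
  (forall k n, cnorm (x k n) <= b k) -> b @ \oo --> (0 : R) ->
  (\sum_(0 <= k < K) (-1) ^+ k * Y k.+1 : C^o) @[K --> \oo] --> (Z : C^o) ->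
  (x 0%N n : C^o) @[n --> \oo] --> (Z : C^o).
Proof.
move=> xy yY xb b0 YZ.
have xE n K : x 0%N n = \sum_(0 <= k < K) (-1) ^+ k * y k.+1 n + (-1) ^+ K * x K n.
  elim: K => [|K IH]; first by rewrite big_geq // add0r mul1r.
  rewrite big_nat_recr //= -xy exprS IH; move: (\sum_(_ <= _ < _) _) ((-1) ^+ K) => s g.
  by ring.
apply: cvg_cnorm => e e0; have e3 : 0 < e / 3 by rewrite divr_gt0.
have /cvgrPdist_lt/(_ _ e3)[K1 _ h1] := b0.
have [K2 _ h2] := cvg_cnormP _ YZ e3.
pose K := maxn K1 K2.
have hs := @cvg_sum_nat (fun k n => (-1) ^+ k * y k.+1 n) _ K
  (fun k => @cvg_scale _ _ _ ((-1) ^+ k) (yY k.+1)).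
have [N _ hN] := cvg_cnormP _ hs e3.
exists N => // n /= Nn.
have := hN n Nn; have := h2 K (leq_maxr _ _); have /ltr_normlP[+ _] := h1 K (leq_maxl _ _).
rewrite /= (xE n K).
set s := \sum_(0 <= k < K) (-1) ^+ k * Y k.+1.
set t := \sum_(0 <= k < K) (-1) ^+ k * y k.+1 n.
rewrite opprB subr0 => bK sZ ts.
have -> : Z - (t + (-1) ^+ K * x K n) = (Z - s) + (s - t) - (-1) ^+ K * x K n by ring.
apply: le_lt_trans (cnormD _ _) _; rewrite cnormN cnormM cnorm_sign mul1r.
have := xb K n; have := cnormD (Z - s) (s - t); lra.
Qed.

End AlternatingSums.

Section ThetaSums.
Variables (R : realType) (q : R[i]).
Local Notation C := R[i].
Local Notation rho := (cnorm q).
Hypothesis rho01 : 0 < rho < 1.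

Let rho0 : 0 <= rho. Proof. by case/andP: rho01 => /ltW. Qed.
Let rhogt0 : 0 < rho. Proof. by case/andP: rho01. Qed.
Let rho1 : rho < 1. Proof. by case/andP: rho01. Qed.

(** The linear lower bound r (r + 1) / 2 >= |r| - 1. *)
Lemma tri_lower (r s : int) k : s = 1 \/ s = -1 ->
  (k <= tri (r + s * k%:Z) + `|r| + 1)%N.
Proof. by move=> hs; have := tri_mul2 (r + s * k%:Z); case: hs => ->; nia. Qed.

Lemma rho_tri_le (r s : int) k : s = 1 \/ s = -1 ->
  rho ^+ tri (r + s * k%:Z) <= rho ^+ k / rho ^+ (`|r| + 1).
Proof.
move=> hs; rewrite ler_pdivlMr ?exprn_gt0 // -exprD.
by apply: ler_wiXn2l; rewrite ?(ltW rho1) // addnA tri_lower.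
Qed.

(** The terms of a partial theta series: with l = k + 1 the exponent is that of
    q^{(l^2 + s l) / 2 + s l r} times q^{r (r + 1) / 2}. *)
Definition theta_term (s r : int) (k : nat) : C :=
  (-1) ^+ k * q ^+ tri (r + s * k.+1%:Z).

Definition squares (n : nat) : {fset nat * nat} :=
  [fset (val p.1, val p.2) | p in {: 'I_n * 'I_n}]%fset.

Lemma sum_squares (V : nmodType) (F : nat * nat -> V) n :
  \sum_(p <- squares n) F p = \sum_(i < n) \sum_(j < n) F (val i, val j).
Proof.
rewrite /squares big_imfset /=; last by move=> [? ?] [? ?] _ _ /= [/val_inj -> /val_inj ->].
by rewrite big_enum /= pair_bigA.
Qed.

Lemma mem_squares n p : (p \in squares n) = (p.1 < n)%N && (p.2 < n)%N.
Proof.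
apply/imfsetP/andP => /= [[[i j] _ ->]|[h1 h2]]; first by rewrite !ltn_ord.
by exists (Ordinal h1, Ordinal h2) => //=; case: p {h1 h2}.
Qed.

Lemma squares_mono n : (squares n `<=` squares n.+1)%fset.
Proof. by apply/fsubsetP => p; rewrite !mem_squares => /andP[/leqW -> /leqW ->]. Qed.

Lemma theta_bound s r n : s = 1 \/ s = -1 ->
  \sum_(k < n) cnorm (theta_term s r k) <= (1 - rho)^-1 / rho ^+ (`|r| + 1).
Proof.
move=> hs; apply: le_trans (_ : \sum_(k < n) rho ^+ k.+1 / rho ^+ (`|r| + 1) <= _).
  apply: ler_sum => k _; rewrite /theta_term cnormM cnorm_sign mul1r cnormX.
  exact: rho_tri_le.
by rewrite -mulr_suml ler_wpM2r ?invr_ge0 ?exprn_ge0 // sum_rhoS.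
Qed.

Definition initial (n : nat) : {fset nat} := [fset val k | k in 'I_n]%fset.

Lemma sum_initial (V : nmodType) (F : nat -> V) n :
  \sum_(k <- initial n) F k = \sum_(0 <= k < n) F k.
Proof.
rewrite /initial big_imfset /=; last by move=> ? ? _ _ /val_inj.
by rewrite big_enum /= big_mkord.
Qed.

Lemma mem_initial n k : (k \in initial n) = (k < n)%N.
Proof.
by apply/imfsetP/idP => /= [[i _ ->]|h]; [exact: ltn_ord | exists (Ordinal h)].
Qed.

Lemma theta_cvg s r : s = 1 \/ s = -1 -> exists W : C,
  (\sum_(0 <= k < n) theta_term s r k : C^o) @[n --> \oo] --> (W : C^o).
Proof.
move=> hs.
have mono n : (initial n `<=` initial n.+1)%fset.
  by apply/fsubsetP => k; rewrite !mem_initial; exact: leqW.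
have exh t : theta_term s r t != 0 -> exists n, t \in initial n.
  by move=> _; exists t.+1; rewrite mem_initial.
have [W hW] := @abs_exhaust _ _ _ initial ((1 - rho)^-1 / rho ^+ (`|r| + 1)) mono exh
  (fun n => ltac:(by rewrite sum_initial big_mkord; exact: theta_bound)).
exists W; have := totally_exhaust hW mono exh.
by under eq_fun => n do rewrite sum_initial.
Qed.

(** Total in s, so that it can be used before the sign is known. *)
Definition theta (s r : int) : C :=
  if pselect (s = 1 \/ s = -1) is left hs then projT1 (cid (theta_cvg r hs)) else 0.

Lemma thetaP s r : s = 1 \/ s = -1 ->
  (\sum_(0 <= k < n) theta_term s r k : C^o) @[n --> \oo] --> (theta s r : C^o).
Proof.
by move=> hs; rewrite /theta; case: pselect => // h; case: cid.
Qed.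

End ThetaSums.

(** * Graded traces of the projectors *)

Section TraceLimits.
Variables (R : realType) (q lq : R[i]) (S : R[i]).
Local Notation C := R[i].
Local Notation rho := (cnorm q).
Local Notation fock := (fock C).
Local Notation zmode := (zmode (qpow lq)).
Local Notation proj := (proj (qpow lq)).
Hypothesis hlq : cexp lq = q.
Hypothesis hq : 0 < `|q| < 1.
Hypothesis hS : partial_sum (fun mu => q ^+ lvl mu : C^o) A @[A --> totally] --> (S : C^o).
Implicit Types (lam : momentum C) (f : fock -> fock).

Let C0 := @char0 R.
Let q0 := qint_neq0 hlq hq.

Lemma rho_01 : 0 < rho < 1.
Proof. by rewrite (rho_gt0 hq) (rho_lt1 hq). Qed.

Definition graded_dim lam n : C := \sum_(0 <= E < n) #|` blk lam E|%:R * q ^+ E.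

Definition graded_trace lam f n : C := \sum_(0 <= E < n) trace (blk lam E) f * q ^+ E.

Lemma graded_dim_cvg lam :
  (graded_dim lam n : C^o) @[n --> \oo] --> (q ^+ mtri lam * S : C^o).
Proof.
pose G n := [fset mu in box n | (lvl mu + mtri lam < n)%N]%fset.
have E : graded_dim lam = (fun n => q ^+ mtri lam * \sum_(mu <- G n) q ^+ lvl mu).
  by apply/funext => n; exact: card_blk_sum.
rewrite E; apply: cvg_scale; apply: (totally_exhaust hS) => [n|mu _].
  apply/fsubsetP => mu; rewrite !inE /= => /andP[h1 h2].
  by rewrite (fsubsetP (box_mono n)) //= leqW.
exists (lvl mu + mtri lam).+1; rewrite !inE /= leqnn andbT.
by apply: box_lvl; rewrite ltnS leq_addr.
Qed.

Lemma graded_dim_bounded : exists M : R, forall lam n,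
  \sum_(0 <= E < n) #|` blk lam E|%:R * rho ^+ E <= rho ^+ mtri lam * M.
Proof.
have /andP[r0 r1] := rho_01.
have [M hM] := boxsum_bounded rho_01; exists M => lam n.
rewrite card_blk_sum ler_wpM2l ?exprn_ge0 ?(ltW r0) //.
apply: le_trans (hM n); apply: ler_sum_fset => [|mu]; last by rewrite exprn_ge0 // ltW.
by apply/fsubsetP => mu; rewrite !inE /= => /andP[].
Qed.

(** The trace of an idempotent is a rank. *)
Lemma graded_trace_bound lam f n : linear f -> (forall v, f (f v) = f v) ->
  (forall mom E v, block mom E v -> block mom E (f v)) ->
  cnorm (graded_trace lam f n) <= \sum_(0 <= E < n) #|` blk lam E|%:R * rho ^+ E.
Proof.
move=> lf ff fE; have /andP[r0 r1] := rho_01.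
apply: le_trans (cnorm_sum _ _ _) _; apply: ler_sum => E _.
have [r [b [[-> rK] _ _ _ _]]] := @idem_basis _ (blk lam E) f lf ff
  (fun k kK => (blockP _ _ _).1 (fE _ _ _ (@block_ket _ lam E k kK))).
by rewrite cnormM cnormX cnorm_nat ler_wpM2r ?exprn_ge0 ?(ltW r0) // ler_nat.
Qed.

Lemma shift_shift l r r' lam : shift l r (shift l r' lam) = shift l (r' + r) lam.
Proof.
congr (_, _); apply/ffunP => i; rewrite !ffunE.
by case: eqP => // _; rewrite addrA.
Qed.

Lemma shift0 l lam : shift l 0 lam = lam.
Proof.
case: lam => la lc; congr (_, _); apply/ffunP => i; rewrite !ffunE addr0.
by rewrite if_same.
Qed.

Lemma tri_le_mtri l lam : (tri (lam.2 l) <= mtri lam)%N.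
Proof. by rewrite /mtri; case: (ord2P l) => ->; rewrite ?leq_addr ?leq_addl. Qed.

(** Iterating the recursion for the trace moves the momentum of c^l by s at each
    step.  The energy r (r + 1) / 2 of the momentum grows, so that the traces tend
    to 0 and the alternating sum converges.  The factor g is what f contributes
    independently of that momentum. *)
Lemma graded_trace_proj l s f (g : momentum C -> C) lam : s = 1 \/ s = -1 ->
  linear f -> (forall mom E v, block mom E v -> block mom E (f v)) ->
  (forall v, zmode l (- s) (f v) = f (zmode l (- s) v)) ->
  (forall v, (proj l s \o f) ((proj l s \o f) v) = (proj l s \o f) v) ->
  (forall mom r, g (shift l r mom) = g mom) ->
  (forall mom, (graded_trace mom f n : C^o) @[n --> \oo] -->
     (q ^+ tri (mom.2 l) * g mom : C^o)) ->
  (graded_trace lam (proj l s \o f) n : C^o) @[n --> \oo] -->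
    (theta rho_01 s (lam.2 l) * g lam : C^o).
Proof.
move=> hs lf fE fz idem gs hf.
pose mk k := shift l (s * k%:Z) lam.
have [M hM] := graded_dim_bounded.
have /andP[r0 r1] := rho_01.
have lp : linear (proj l s \o f) := linear_comp (linear_proj (qpow lq) l hs) lf.
have pE mom E v : block mom E v -> block mom E ((proj l s \o f) v).
  by move=> hv; exact: proj_block hs (fE _ _ _ hv).
have M0 : 0 <= M.
  have := hM lam 0%N; rewrite big_geq // pmulr_rge0 ?exprn_gt0 //.
have lim := @alternating_limit R (fun k n => graded_trace (mk k) (proj l s \o f) n)
  (fun k n => graded_trace (mk k) f n)
  (fun k => q ^+ tri ((mk k).2 l) * g (mk k)) (theta rho_01 s (lam.2 l) * g lam)
  (fun k => rho ^+ k * ((rho ^+ (`|lam.2 l| + 1))^-1 * M)).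
rewrite (_ : graded_trace lam (proj l s \o f) =
             graded_trace (mk 0%N) (proj l s \o f)); last first.
  by rewrite /mk mulr0 shift0.
apply: lim.
- move=> k n; rewrite /graded_trace -big_split; apply: eq_bigr => E _ /=.
  rewrite -mulrDl; congr (_ * _).
  rewrite (@trace_proj_rec _ _ C0 q0 l s (mk k) E f hs lf (fun mom => fE mom E) fz).
  have -> : mk k.+1 = shift l s (mk k).
    by rewrite /mk shift_shift; congr (shift _ _ _); lia.
  by rewrite subrK.
- by move=> k; exact: hf.
- move=> k n; apply: le_trans (graded_trace_bound _ _ lp idem pE) _.
  apply: le_trans (hM _ _) _; rewrite mulrA ler_wpM2r //.
  apply: le_trans (rho_tri_le rho_01 _ _ hs).
  apply: ler_wiXn2l; rewrite ?(ltW r0) ?(ltW r1) //.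
  by have := tri_le_mtri l (mk k); rewrite /mk shiftE eqxx.
- exact: cvg_rho rho_01 _.
- have E : (fun K => \sum_(0 <= k < K) (-1) ^+ k * (q ^+ tri ((mk k.+1).2 l) * g (mk k.+1)) : C^o)
    = (fun K => g lam * \sum_(0 <= k < K) theta_term q s (lam.2 l) k).
    apply/funext => K; rewrite mulr_sumr; apply: eq_bigr => k _.
    by rewrite /theta_term /mk gs shiftE eqxx mulrA mulrC.
  rewrite E [X in _ --> X]mulrC; apply: cvg_scale.
  exact: (@thetaP _ _ rho_01 s _ hs).
Qed.

Variables (s1 s2 : int).
Hypotheses (hs1 : s1 = 1 \/ s1 = -1) (hs2 : s2 = 1 \/ s2 = -1).

(** The two projectors are treated one after the other: first the second one cuts
    the whole space, then the first one cuts its image. *)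
Lemma graded_trace_proj2 lam :
  (graded_trace lam (proj2 (qpow lq) s1 s2) n : C^o) @[n --> \oo] -->
    (theta rho_01 s1 (lam.2 0) * (theta rho_01 s2 (lam.2 1) * S) : C^o).
Proof.
have lp := linear_proj (qpow lq) 1 hs2.
have pE mom E v : block mom E v -> block mom E (proj 1 s2 v).
  exact: proj_block hs2.
have step1 mom : (graded_trace mom (proj 1 s2 \o id) n : C^o) @[n --> \oo] -->
    (theta rho_01 s2 (mom.2 1) * (q ^+ tri (mom.2 0) * S) : C^o).
  have gs (mom' : momentum C) r : q ^+ tri ((shift 1 r mom').2 0) * S = q ^+ tri (mom'.2 0) * S.
    by rewrite shiftE addr0.
  have dim mom' : (graded_trace mom' id n : C^o) @[n --> \oo] -->
      (q ^+ tri (mom'.2 1) * (q ^+ tri (mom'.2 0) * S) : C^o).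
    have E : graded_trace mom' id = graded_dim mom'.
      by apply/funext => n; apply: eq_bigr => E _; rewrite trace_id.
    rewrite E mulrA -exprD addnC; exact: graded_dim_cvg.
  exact (@graded_trace_proj 1 s2 id _ mom hs2 (@linear_id_fun C fock) (fun _ _ _ h => h)
    (fun=> erefl) (fun v => @proj_idem _ _ C0 q0 1 s2 v hs2) gs dim).
have gs (mom' : momentum C) r :
    theta rho_01 s2 ((shift 0 r mom').2 1) * S = theta rho_01 s2 (mom'.2 1) * S.
  by rewrite shiftE addr0.
have step1' mom : (graded_trace mom (proj 1 s2) n : C^o) @[n --> \oo] -->
    (q ^+ tri (mom.2 0) * (theta rho_01 s2 (mom.2 1) * S) : C^o).
  rewrite mulrCA; exact (step1 mom).
exact (@graded_trace_proj 0 s1 (proj 1 s2) _ lam hs1 lp pE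
  (fun v => @zmode_proj_comm _ _ C0 q0 0 (- s1) 1 s2 v (signN hs1) hs2 isT)
  (fun v => @proj2_idem _ _ C0 q0 s1 s2 hs1 hs2 v) gs step1').
Qed.

End TraceLimits.

(** * The right-hand sides as formal series *)

Section Monomials.
Variables (R : realType) (beta : R[i]).
Local Notation C := R[i].
Local Notation index := (int * int * int)%type.
Implicit Types (B : index) (mu : weight R).

(** The exponents depend on the labels (i, j, k) only. *)
Definition monomial B : weight R := ch_exp beta ((0%N, 0%N), B).

Lemma monomial_inj : injective monomial.
Proof.
move=> [[i j] k] [[i' j'] k'] /(congr1 val) [] /(@intr_inj C) jj /(@intr_inj C) ik _.
by move=> /addrI/(@intr_inj C); rewrite jj => h; congr (_, _, _); lia.
Qed.

Lemma ch_expE p B : ch_exp beta (p, B) = monomial B.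
Proof. by case: B => [[i j] k]; case: p. Qed.

(** The contribution of the zero modes of the a^j to -d: half the sum of their
    squares with signs, from which beta drops out. *)
Definition int_energy B : int := B.1.2 * (B.1.1 - B.2).

End Monomials.

Section FormalSeries.
Variables (R : realType) (q lq beta : R[i]) (s1 s2 : int).
Local Notation C := R[i].
Local Notation rho := (cnorm q).
Hypothesis hlq : cexp lq = q.
Hypothesis hq : 0 < `|q| < 1.
Hypotheses (hs1 : s1 = 1 \/ s1 = -1) (hs2 : s2 = 1 \/ s2 = -1).
Local Notation index := (int * int * int)%type.
Local Notation monomial := (monomial beta).
Implicit Types (B : index) (mu : weight R).

Let C0 := @char0 R.
Let rho01 := rho_01 hq.

Definition theta_series B : C :=
  q ^ int_energy B * (theta rho01 s1 (B.1.1 - B.1.2) * theta rho01 s2 B.2).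

(** The coefficients of the formal series sum_B c(B) theta_series(B) x^B; distinct
    labels have distinct exponents, so that each coefficient is a single term.  The
    character has c = 1 and the supercharacter a sign. *)
Definition series_of (c : index -> C) mu : C :=
  if pselect (exists B, monomial B = mu) is left h
  then c (projT1 (cid h)) * theta_series (projT1 (cid h)) else 0.

Lemma series_of_monomial c B : series_of c (monomial B) = c B * theta_series B.
Proof.
rewrite /series_of; case: pselect => [h|[]]; last by exists B.
by case: cid => B' /= /(@monomial_inj _ beta) ->.
Qed.

Lemma series_of_out c mu : (forall B, monomial B != mu) -> series_of c mu = 0.
Proof.
move=> h; rewrite /series_of; case: pselect => // -[B Bmu].
by have := h B; rewrite Bmu eqxx.
Qed.

(** Completing squares: both exponents together are the energy of the momenta
    shifted by s1 l1 and s2 l2. *)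
Lemma ch_coefE n1 n2 B : ch_coef lq s1 s2 ((n1, n2), B) =
  q ^ int_energy B *
    (theta_term q s1 (B.1.1 - B.1.2) n1 * theta_term q s2 B.2 n2).
Proof.
case: B => [[i j] k]; rewrite /ch_coef /theta_term /int_energy /=.
rewrite -mulrA -(qpowD lq) -mulrDl -intrD.
set e := (X in qpow _ (X%:~R / 2)).
have -> : e = 2 * (j * (i - k) + (tri (i - j + s1 * n1.+1%:Z))%:Z
                   + (tri (k + s2 * n2.+1%:Z))%:Z).
  have t1 := tri_mul2 (i - j + s1 * n1.+1%:Z).
  have t2 := tri_mul2 (k + s2 * n2.+1%:Z).
  rewrite !mulrDr ![2 * (tri _)%:Z]mulrC t1 t2 /e.
  move: (n1.+1%:Z) (n2.+1%:Z) => l1 l2 {e t1 t2}.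
  by case: hs1 => ->; case: hs2 => ->; ring.
rewrite intrM mulrAC divff ?(C0 1) // mul1r (qpow_int hlq).
rewrite !expfzDr ?(q_neq0 hq) // -!exprnP.
rewrite exprD !exprS; set u := (-1) ^+ n1; set v := (-1) ^+ n2.
by ring.
Qed.

(** For a fixed exponent only l1 and l2 vary, and the sum over squares is a product
    of two partial theta sums. *)
Lemma formal_series_theta (c : index -> C) :
  formal_series (fun t : term_index => c t.2 * ch_coef lq s1 s2 t) (ch_exp beta)
    (series_of c).
Proof.
move=> mu; set a := fun t : term_index => _.
have [[B Bmu]|nB] := pselect (exists B, monomial B = mu); last first.
  have nB' B : monomial B != mu by apply/eqP => h; apply: nB; exists B.
  rewrite series_of_out //.
  have -> : partial_sum (a : term_index -> C^o) = cst (0 : C^o).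
    apply/funext => A; rewrite partial_sumE big1 // => -[p B] _.
    by rewrite /a ch_expE (negbTE (nB' B)).
  exact: cvg_cst.
rewrite -Bmu series_of_monomial.
have aE p B' : a (p, B') = if B' == B then c B * (q ^ int_energy B *
    (theta_term q s1 (B.1.1 - B.1.2) p.1 * theta_term q s2 B.2 p.2)) else 0.
  rewrite /a ch_expE -Bmu (inj_eq (@monomial_inj _ beta)).
  by case: eqP => // ->; case: p => n1 n2; rewrite ch_coefE.
pose G n : {fset term_index} := [fset (p, B) | p in squares n]%fset.
have GE (V : nmodType) (F : term_index -> V) n :
    \sum_(t <- G n) F t = \sum_(i < n) \sum_(j < n) F ((val i, val j), B).
  rewrite /G big_imfset /=; last by move=> x y _ _ [].
  by rewrite sum_squares.
have aB i j : a ((i, j), B) = c B * (q ^ int_energy B *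
    (theta_term q s1 (B.1.1 - B.1.2) i * theta_term q s2 B.2 j)).
  by rewrite aE eqxx.
apply: (@totally_of_exhaust _ _ a G (cnorm (c B) * (cnorm (q ^ int_energy B) *
   (((1 - rho)^-1 / rho ^+ (`|B.1.1 - B.1.2| + 1)) * ((1 - rho)^-1 / rho ^+ (`|B.2| + 1)))))).
- move=> n; apply/fsubsetP => _ /imfsetP[p /= pn ->].
  by apply/imfsetP; exists p => //; exact: (fsubsetP (squares_mono n)).
- move=> [p B']; rewrite aE; case: (B' =P B) => [-> _|_]; last by rewrite eqxx.
  exists (maxn p.1 p.2).+1; apply/imfsetP; exists p => //=.
  by rewrite mem_squares !ltnS leq_maxl leq_maxr.
- move=> n; rewrite GE.
  under eq_bigr => i _ do under eq_bigr => j _ do rewrite aB 3!cnormM.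
  under eq_bigr => i _ do rewrite -!mulr_sumr.
  rewrite -!mulr_sumr; apply: ler_wpM2l; first exact: cnorm_ge0.
  apply: ler_wpM2l; first exact: cnorm_ge0.
  rewrite -mulr_suml; apply: ler_pM; try (by apply: sumr_ge0 => *; exact: cnorm_ge0).
    exact: theta_bound.
  exact: theta_bound.
have E : (fun n => \sum_(t <- G n) a t : C^o) = (fun n => c B * (q ^ int_energy B *
    ((\sum_(0 <= k < n) theta_term q s1 (B.1.1 - B.1.2) k) *
     (\sum_(0 <= k < n) theta_term q s2 B.2 k)))).
  apply/funext => n; rewrite GE.
  under eq_bigr => i _ do under eq_bigr => j _ do rewrite aB.
  under eq_bigr => i _ do rewrite -!mulr_sumr.
  by rewrite -!mulr_sumr -mulr_suml !big_mkord.
rewrite E; apply: cvg_scale; apply: cvg_scale.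
exact (@cvgM (C : numFieldType) _ _ _ _ _ _ _
  (@thetaP _ _ rho01 s1 (B.1.1 - B.1.2) hs1) (@thetaP _ _ rho01 s2 B.2 hs2)).
Qed.

End FormalSeries.

(** * The traces as formal series *)

Section CharacterSeries.
Variables (R : realType) (q lq beta : R[i]) (s1 s2 : int) (S : R[i]).
Local Notation C := R[i].
Local Notation rho := (cnorm q).
Hypothesis hlq : cexp lq = q.
Hypothesis hq : 0 < `|q| < 1.
Hypotheses (hs1 : s1 = 1 \/ s1 = -1) (hs2 : s2 = 1 \/ s2 = -1).
Hypothesis hS : partial_sum (fun mu => q ^+ lvl mu : C^o) A @[A --> totally] --> (S : C^o).
Local Notation index := (int * int * int)%type.

Variable r : index * nat -> nat.
Hypothesis r_trace : forall B, trace (blk (momt beta B.1) B.2) (proj2 (qpow lq) s1 s2) = (r B)%:R.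
Hypothesis r_le : forall B, (r B <= #|` blk (momt beta B.1) B.2|)%N.
Local Notation T := {B : index * nat & 'I_(r B)}.

Definition basis_energy (B : index * nat) : C := - (B.2%:R + (int_energy B.1)%:~R).

Lemma qpow_basis_energy (B : index * nat) :
  qpow lq (- basis_energy B) = q ^ int_energy B.1 * q ^+ B.2.
Proof. by rewrite opprK (qpowD lq) (qpow_int hlq) (qpow_nat hlq) mulrC. Qed.

Definition fiber (B : index * nat) : {fset T} :=
  [fset Tagged (fun B => 'I_(r B)) s | s in 'I_(r B)]%fset.

Lemma mem_fiber B (t : T) : (t \in fiber B) = (tag t == B).
Proof.
apply/imfsetP/eqP => /= [[s _ ->] //|]; case: t => B' s /= E; move: s; rewrite E => s.
by exists s.
Qed.

Lemma sum_fiber (V : nmodType) (F : index * nat -> V) B :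
  \sum_(t <- fiber B) F (tag t) = F B *+ r B.
Proof.
rewrite /fiber big_imfset /=; last by move=> s s' _ _ /eqP; rewrite eq_Tagged /= => /eqP.
by rewrite big_enum /= sumr_const card_ord.
Qed.

Fixpoint layers (B : index) (n : nat) : {fset T} :=
  if n is m.+1 then (layers B m `|` fiber (B, m))%fset else fset0.

Lemma mem_layers B n (t : T) :
  (t \in layers B n) = ((tag t).1 == B) && ((tag t).2 < n)%N.
Proof.
elim: n => [|n IHn]; first by rewrite andbF.
rewrite /= inE IHn mem_fiber; case: (tag t) => B' m /=.
by rewrite xpair_eqE; case: (B' == B) => //=; rewrite orbC -leq_eqVlt.
Qed.

Lemma sum_layers (V : nmodType) (F : index * nat -> V) B n :
  \sum_(t <- layers B n) F (tag t) = \sum_(0 <= E < n) F (B, E) *+ r (B, E).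
Proof.
elim: n => [|n IHn]; first by rewrite big_seq_fset0 big_geq.
rewrite big_nat_recr //= -IHn -sum_fiber (big_fsetID _ (mem (layers B n))) /=.
congr (_ + _); apply: eq_fbigl => t; rewrite !inE /= !(mem_layers, mem_fiber);
  case: (tag t) => B' m /=; rewrite xpair_eqE; case: (B' == B) => //=.
  by case: ltngtP.
by case: ltngtP.
Qed.

(** For a fixed exponent only the energy varies, and the partial sums over basis
    vectors of bounded energy are graded traces of the projector. *)
Lemma formal_series_trace (c : index -> C) :
  formal_series (fun t : T => c (tag t).1 * qpow lq (- basis_energy (tag t)))
    (fun t => monomial beta (tag t).1)
    (fun mu => S * series_of beta s1 s2 hq c mu).
Proof.
move=> mu; set a := fun t : T => _.
have [[B Bmu]|nB] := pselect (exists B, monomial beta B = mu); last first.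
  have nB' B : monomial beta B != mu by apply/eqP => h; apply: nB; exists B.
  have Z : series_of beta s1 s2 hq c mu = 0 by exact: series_of_out.
  rewrite Z mulr0.
  have -> : partial_sum (a : T -> C^o) = cst (0 : C^o).
    apply/funext => A; rewrite partial_sumE big1 // => t _.
    by rewrite /a (negbTE (nB' _)).
  exact: cvg_cst.
rewrite -Bmu series_of_monomial.
pose F (BE : index * nat) : C :=
  if BE.1 == B then c B * (q ^ int_energy B * q ^+ BE.2) else 0.
have aE t : a t = F (tag t).
  rewrite /a /F -Bmu (inj_eq (@monomial_inj _ beta)); case: eqP => // E.
  by rewrite qpow_basis_energy E.
have [M hM] := graded_dim_bounded hq.
have rho0 := rho_gt0 hq.
apply: (@totally_of_exhaust _ _ a (layers B)
  (cnorm (c B) * (cnorm (q ^ int_energy B) * (rho ^+ mtri (momt beta B) * M)))).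
- by move=> n; apply/fsubsetP => t; rewrite !mem_layers => /andP[-> /leqW ->].
- move=> t; rewrite aE /F; case: ((tag t).1 =P B) => [tB _|_]; last by rewrite eqxx.
  by exists (tag t).2.+1; rewrite mem_layers tB eqxx ltnSn.
- move=> n; under eq_bigr => t _ do rewrite aE.
  rewrite (sum_layers (fun BE => cnorm (F BE))).
  have -> : \sum_(0 <= E < n) cnorm (F (B, E)) *+ r (B, E) =
      cnorm (c B) * (cnorm (q ^ int_energy B) * \sum_(0 <= E < n) (r (B, E))%:R * rho ^+ E).
    rewrite !mulr_sumr; apply: eq_bigr => E _.
    rewrite /F eqxx 2!cnormM cnormX -mulr_natl /=.
    move: (cnorm (c B)) (cnorm (q ^ _)) (rho ^+ E) => x y z; ring.
  apply: ler_wpM2l; first exact: cnorm_ge0.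
  apply: ler_wpM2l; first exact: cnorm_ge0.
  apply: le_trans (hM (momt beta B) n); apply: ler_sum => E _.
  by rewrite ler_wpM2r ?exprn_ge0 ?(ltW rho0) // ler_nat; exact: (r_le (B, E)).
have E : (fun n => \sum_(t <- layers B n) a t : C^o) =
    (fun n => c B * (q ^ int_energy B * graded_trace q (momt beta B) (proj2 (qpow lq) s1 s2) n)).
  apply/funext => n; under eq_bigr => t _ do rewrite aE.
  rewrite (sum_layers F) /graded_trace !mulr_sumr; apply: eq_bigr => E _.
  rewrite /F eqxx (r_trace (B, E)) -mulr_natl /=.
  move: (q ^ _) (q ^+ E) => x y; ring.
have E2 : S * (c B * theta_series s1 s2 hq B) =
  c B * (q ^ int_energy B * (theta (rho_01 hq) s1 (B.1.1 - B.1.2) * (theta (rho_01 hq) s2 B.2 * S))).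
  by rewrite /theta_series; move: (theta _ _ _) (theta _ _ _) (q ^ _) => x y z; ring.
rewrite E E2; apply: cvg_scale; apply: cvg_scale.
have := @graded_trace_proj2 R q lq S hlq hq hS s1 s2 hs1 hs2 (momt beta B).
have -> : (momt beta B).2 0 = B.1.1 - B.1.2 by rewrite ffunE.
have -> : (momt beta B).2 1 = B.2 by rewrite ffunE.
exact.
Qed.

End CharacterSeries.

Theorem proposition6 (R : realType) (q lq beta : R[i]) (s1 s2 : int)
    (hq : 0 < `|q| < 1) (hlq : cexp lq = q)
    (hs1 : s1 = 1 \/ s1 = -1) (hs2 : s2 = 1 \/ s2 = -1) :
  exists (phi : R[i]) (f g : weight R -> R[i]),
    [/\ (\prod_(1 <= n < N.+1) (1 - q ^+ n) ^+ 6 : R[i]^o)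
          @[N --> \oo] --> (phi : R[i]^o),
        phi != 0,
        formal_series (ch_coef lq s1 s2) (ch_exp beta) f
        /\ is_character lq (Msub (qpow lq) beta s1 s2) (fun mu => phi^-1 * f mu)
      & formal_series (sch_coef lq s1 s2) (ch_exp beta) g
        /\ is_supercharacter lq beta (Msub (qpow lq) beta s1 s2)
             (fun mu => phi^-1 * g mu)].
Proof.
have C0 := @char0 R; have q0 := qint_neq0 hlq hq.
have qz : qpow lq 0 = 1 := qpow_0 lq.
have q2 := q2_neq0 hlq hq.
have [S [hS S0 hphi]] := partition_sum (rho_01 hq).
have [r [b [r_trace r_le b_blk b_basis]]] := @Msub_basis _ _ C0 q0 beta s1 s2 hs1 hs2.
have b_block t : block (momt beta (tag t).1) (tag t).2 (b t) by apply/blockP; exact: b_blk.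
pose sgn (B : int * int * int) : R[i] := (-1) ^ (B.1.1 - B.1.2 + B.2).
pose ser := series_of beta s1 s2 hq.
have hop_b j : eigenvectors (hop (qpow lq) j) b (fun t => tnth (monomial beta (tag t).1) j).
  move=> t; have := b_block t; case: (tag t) => [[[i j'] k] E] /= hb.
  exact: (hop_mom C0 qz j hb).
have dop_b : eigenvectors (dop (qpow lq)) b (fun t => basis_energy R (tag t)).
  move=> t; have := b_block t; case: (tag t) => [[[i j'] k] E] /= hb.
  exact: (dop_mom C0 q0 qz q2 hb).
exists S^-1, (ser (fun=> 1)), (ser sgn); rewrite invrK; split.
- exact hphi.
- by rewrite invr_eq0.
- split.
    have -> : ch_coef lq s1 s2 = fun t => 1 * ch_coef lq s1 s2 t.
      by apply/funext => t; rewrite mul1r.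
    exact (@formal_series_theta _ q lq beta s1 s2 hlq hq hs1 hs2 (fun=> 1)).
  exists _, b, (fun t => monomial beta (tag t).1), (fun t => basis_energy R (tag t)).
  split; [exact b_basis | exact hop_b | exact dop_b |].
  have := @formal_series_trace _ q lq beta s1 s2 S hlq hq hs1 hs2 hS r r_trace r_le (fun=> 1).
  congr (formal_series _ _ _); apply/funext => t; exact: mul1r.
- split.
    have -> : sch_coef lq s1 s2 = fun t => sgn t.2 * ch_coef lq s1 s2 t.
      by apply/funext => -[p [[i j] k]].
    exact (@formal_series_theta _ q lq beta s1 s2 hlq hq hs1 hs2 sgn).
  exists _, b, (fun t => monomial beta (tag t).1), (fun t => basis_energy R (tag t)),
    (fun t => - 2 * beta + (- (tag t).1.1.1 + (tag t).1.1.2 - (tag t).1.2)%:~R).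
  split; [exact b_basis | exact hop_b | exact dop_b | |].
    move=> t; have := b_block t; case: (tag t) => [[[i j'] k] E] /= hb.
    exact: Nf_mom hb.
  have := @formal_series_trace _ q lq beta s1 s2 S hlq hq hs1 hs2 hS r r_trace r_le sgn.
  congr (formal_series _ _ _); apply/funext => t; congr (_ * _).
  rewrite mulNr addrAC addNr add0r cexp_pi /sgn.
  have -> : - (tag t).1.1.1 + (tag t).1.1.2 - (tag t).1.2
    = - ((tag t).1.1.1 - (tag t).1.1.2 + (tag t).1.2) by ring.
  by rewrite -exprz_inv invrN1.
Qed.
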